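(* Let $\Omega\subset\mathbb{R}^2$ be a plane body of constant width and let $\mathbb{T}$ be the Reuleaux triangle of the same width. Then $$h(\Omega)\le h(\mathbb{T}),$$ where $h$ denotes the Cheeger constant. In other words, the Reuleaux triangle maximizes the Cheeger constant in the class of plane bodies of (the same) constant width.
   Context: A plane body of constant width $w>0$ is a compact convex set in $\mathbb{R}^2$ with nonempty interior such that, in every direction, the distance between its two parallel supporting lines equals $w$. The Reuleaux triangle of width $w$ is the intersection of the three closed disks of radius $w$ centered at the vertices of an equilateral triangle of side $w$. The Cheeger constant of a bounded planar domain (or convex body) $\Omega$ is $h(\Omega)=\min_{E\subset\Omega} P(E)/|E|$, where the minimum is over measurable sets $E\subset\Omega$ of positive area, $P(E)$ is the perimeter of $E$ in the sense of De Giorgi and $|E|$ is its area. *)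

(* Defs.v *)
From HB Require Import structures.
From mathcomp Require Import all_boot all_order all_algebra.
From mathcomp Require Import all_classical all_reals all_analysis.

Set Implicit Arguments.
Unset Strict Implicit.
Unset Printing Implicit Defensive.

Import Order.TTheory GRing.Theory Num.Theory.
Import numFieldNormedType.Exports.

Local Open Scope classical_set_scope.
Local Open Scope ring_scope.

(* [R * R] carries the right topology and sigma-algebra, but the library's norm
   on it is the sup norm; Euclidean lengths are therefore taken from [enorm]. *)
Notation plane R := (R * R)%type (only parsing).

Section Plane.
Context {R : realType}.
Implicit Types (x y u : plane R) (K L E : set (plane R)) (w r : R).

Definition dot x y : R := x.1 * y.1 + x.2 * y.2.
Definition enorm x : R := Num.sqrt (dot x x).
Definition edist x y : R := enorm (x - y).

Definition closed_disk x r : set (plane R) := [set y | edist x y <= r].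

Definition set_dist K L : R := inf [set edist p.1 p.2 | p in K `*` L].

(* [L] is the supporting line of [K] with outer normal [u]. *)
Definition supporting_line K u L : Prop :=
  exists c : R, [/\ L = [set x | dot u x = c],
    K `<=` [set x | dot u x <= c] & K `&` L !=set0].

Definition constant_width_body w K : Prop :=
  [/\ compact K, convex_set K, interior K !=set0 &
    forall u, enorm u = 1 -> forall L L' : set (plane R),
      supporting_line K u L -> supporting_line K (- u) L' -> set_dist L L' = w].

Definition reuleaux_triangle w K : Prop :=
  exists a b c : plane R,
    [/\ edist a b = w, edist b c = w, edist c a = w &
      K = closed_disk a w `&` closed_disk b w `&` closed_disk c w].

Definition area : set (measurableTypeR R * measurableTypeR R) -> \bar R :=
  (lebesgue_measure \x lebesgue_measure)%E.
HB.instance Definition _ := Measure.on area.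

Definition e1 : plane R := (1, 0).
Definition e2 : plane R := (0, 1).

Definition C1 (f : plane R -> R) : Prop :=
  forall v : plane R, v = e1 \/ v = e2 ->
    (forall x, derivable f x v) /\ continuous (fun x => 'D_v f x).

Definition divergence (phi : plane R -> plane R) x : R :=
  'D_e1 (fun y => (phi y).1) x + 'D_e2 (fun y => (phi y).2) x.

Definition test_field (phi : plane R -> plane R) : Prop :=
  [/\ C1 (fun x => (phi x).1), C1 (fun x => (phi x).2),
    compact (closure [set x | phi x <> 0]) & forall x, enorm (phi x) <= 1].

(* De Giorgi perimeter in the whole plane. *)
Definition perimeter E : \bar R :=
  ereal_sup [set (\int[area]_(x in E) (divergence phi x)%:E)%E
            | phi in test_field].

(* An infimum: its value is that of the minimum, which is classically attained.
   The measurable structure used on [R * R] is the Borel one.  Area and perimeter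
   do not see null sets, and every Lebesgue measurable set contains a Borel set
   of the same area, so Borel competitors suffice. *)
Definition cheeger (Omega : set (plane R)) : \bar R :=
  ereal_inf [set (perimeter E / area E)%E
            | E in [set E | [/\
      @measurable _ (measurableTypeR R * measurableTypeR R)%type E,
      E `<=` Omega & (0 < area E)%E]]].

End Plane.

(* Main.v *)
(** Lower bound for the Reuleaux triangle T of width 1: a stream function F on T
    with [F y - F x + wedge x y / 2 <= t |x - y|] gives, after mollification, a
    field [x / 2 + rot grad F] of divergence 1 and norm at most [t] on T, so
    [area E <= t * perimeter E] for all competitors.  F consists of three rotated
    copies of a function on a third of T, odd about the axis of that third, which
    glues the stream function of the radial field through a vertex with that of a
    field of norm exactly [t]; the two agree at the corner [J] precisely when [t]
    solves the equation that defines the Cheeger constant of T.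

    Upper bound for a body K of constant width 1: K contains every point within
    distance 1 of all of K.  Let [r = 1 / (2 cos psi)] be the circumradius of K.
    The enclosing circle touches K at three points whose directions are pairwise
    at least [4 psi] apart.  A competitor bounded by arcs of radii 1, [t] and
    [1 - r] is placed near each contact point, and the difference
    [area - t * perimeter] of the resulting set is a function of [psi] alone.  It
    decreases, and it vanishes at [psi = pi / 6], the Reuleaux case.  Areas and
    perimeters of these sets are bounded through inscribed polygons, cut into
    triangles with the common vertex at the circumcentre. *)
From HB Require Import structures.
Require Import Defs.
From mathcomp Require Import all_boot all_order all_algebra.
From mathcomp Require Import all_classical all_reals all_analysis.
From mathcomp Require Import measurable_realfun.
From mathcomp Require Import ring lra.

Set Implicit Arguments.
Unset Strict Implicit.
Unset Printing Implicit Defensive.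

Import Order.TTheory GRing.Theory Num.Theory numFieldNormedType.Exports.
Local Open Scope classical_set_scope.
Local Open Scope ring_scope.

(* [edist] is also the name of the extended distance of the topology library. *)
Local Notation edist := Defs.edist.

(** * Plane vectors *)

(** The equation for [t] says that the inner parallel set of the triangle at distance [t] has area
    [pi * t ^+ 2], the known characterisation of the Cheeger constant [1 / t] of a planar convex
    set. That inner set is the intersection of three disks of radius [s = 1 - t] about the vertices,
    and [b] is the direction in which a vertex sees its corner.

    The optimal field of divergence 1 jumps across the seams between its pieces. This is why the
    lower bound is an inequality between two points of a stream function: it involves no derivative,
    is stable under minima, and passes across a line as soon as the function is single-valued there.
    Regularity is restored only at the end, by averaging.

    In the upper bound the perimeter is a supremum over test fields, so it must be bounded through
    the divergence theorem. Triangles suffice because only an upper bound of the length and a lower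
    bound of the area are wanted, and chords are shorter than arcs.

    The Reuleaux triangle is extremal because three contact directions at mutual angles at least
    [4 * psi] have to fit into a full turn, which forces [psi <= pi / 6]. *)

Section PlaneVectors.
Context {R : realType}.
Implicit Types (x y z v : R * R) (r a b : R).

(** Besides being a signed area, [wedge W v] is the flux of a field [W] across the displacement [v];
    both meanings are used. *)
Definition wedge x y : R := x.1 * y.2 - x.2 * y.1.
Definition dir a : R * R := (cos a, sin a).

Lemma dot_ge0 x : 0 <= dot x x.
Proof. by rewrite /dot addr_ge0// -expr2 sqr_ge0. Qed.

Lemma enorm_ge0 x : 0 <= enorm x.
Proof. exact: sqrtr_ge0. Qed.

Lemma enorm_sqr x : enorm x ^+ 2 = dot x x.
Proof. by rewrite sqr_sqrtr// dot_ge0. Qed.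

Lemma enorm_le x r : 0 <= r -> (enorm x <= r) = (dot x x <= r ^+ 2).
Proof.
move=> r0; rewrite -enorm_sqr -[in RHS]ler_sqrt ?sqr_ge0//.
by rewrite !sqrtr_sqr !ger0_norm// enorm_ge0.
Qed.

Lemma enorm_ge x r : 0 <= r -> (r <= enorm x) = (r ^+ 2 <= dot x x).
Proof.
move=> r0; rewrite -enorm_sqr -[in RHS]ler_sqrt ?sqr_ge0//.
by rewrite !sqrtr_sqr !ger0_norm// enorm_ge0.
Qed.

Lemma enorm_eq x r : 0 <= r -> dot x x = r ^+ 2 -> enorm x = r.
Proof. by move=> r0; rewrite /enorm => ->; rewrite sqrtr_sqr ger0_norm. Qed.

Lemma dot_wedge x y : dot x y ^+ 2 + wedge x y ^+ 2 = dot x x * dot y y.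
Proof. by rewrite /dot /wedge; ring. Qed.

Lemma dot_le x y : dot x y <= enorm x * enorm y.
Proof.
apply: (le_trans (ler_norm _)).
rewrite -ler_sqr ?nnegrE ?mulr_ge0 ?enorm_ge0// real_normK ?num_real//.
by rewrite exprMn !enorm_sqr -dot_wedge lerDl sqr_ge0.
Qed.

Lemma wedge_le x y : wedge x y <= enorm x * enorm y.
Proof.
apply: (le_trans (ler_norm _)).
rewrite -ler_sqr ?nnegrE ?mulr_ge0 ?enorm_ge0// real_normK ?num_real//.
by rewrite exprMn !enorm_sqr -dot_wedge lerDr sqr_ge0.
Qed.

Lemma enormD x y : enorm (x + y) <= enorm x + enorm y.
Proof.
rewrite enorm_le ?addr_ge0 ?enorm_ge0// sqrrD !enorm_sqr.
have := dot_le x y; rewrite /dot /=; lra.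
Qed.

Lemma enormN x : enorm (- x) = enorm x.
Proof. by rewrite /enorm /dot /= !mulrNN. Qed.

Lemma enormZ r x : enorm (r *: x) = `|r| * enorm x.
Proof.
rewrite /enorm.
have -> : dot (r *: x) (r *: x) = r ^+ 2 * dot x x.
  by rewrite /dot /= /GRing.scale /=; ring.
by rewrite sqrtrM ?sqr_ge0// sqrtr_sqr.
Qed.

Lemma edistC x y : edist x y = edist y x.
Proof. by rewrite /edist -opprB enormN. Qed.

Lemma edist_triangle z x y : edist x y <= edist x z + edist z y.
Proof. by rewrite /edist -[x - y](subrKA z) enormD. Qed.

Lemma enorm0 : enorm (0 : R * R) = 0.
Proof. by rewrite /enorm /dot /= !mulr0 addr0 sqrtr0. Qed.

Lemma enorm_eq0 x : enorm x = 0 -> x = 0.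
Proof.
move=> e0; have := enorm_sqr x; rewrite e0 expr0n /= /dot => /esym/eqP.
rewrite paddr_eq0 -?expr2 ?sqr_ge0// !sqrf_eq0 => /andP[/eqP x1 /eqP x2].
by rewrite (surjective_pairing x) x1 x2.
Qed.

Lemma abs_le_enorm1 x : `|x.1| <= enorm x.
Proof.
by rewrite enorm_ge// real_normK ?num_real// /dot !expr2 lerDl -expr2 sqr_ge0.
Qed.

Lemma abs_le_enorm2 x : `|x.2| <= enorm x.
Proof.
by rewrite enorm_ge// real_normK ?num_real// /dot !expr2 lerDr -expr2 sqr_ge0.
Qed.

Lemma enorm_le_sum x : enorm x <= `|x.1| + `|x.2|.
Proof.
rewrite enorm_le ?addr_ge0// sqrrD !real_normK ?num_real// /dot -!expr2.
by rewrite lerD2r lerDl mulrn_wge0// mulr_ge0.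
Qed.

Lemma dot_dir a : dot (dir a) (dir a) = 1.
Proof. by rewrite /dot /dir /= -!expr2 cos2Dsin2. Qed.

Lemma enorm_dir a : enorm (dir a) = 1.
Proof. by apply: enorm_eq; rewrite // dot_dir expr1n. Qed.

Lemma wedge_dir a b : wedge (dir a) (dir b) = sin (b - a).
Proof. by rewrite /wedge /dir /= sinB; ring. Qed.

Lemma dot_dir2 a b : dot (dir a) (dir b) = cos (b - a).
Proof. by rewrite /dot /dir /= cosB; ring. Qed.

Lemma polar_exists x : exists a, x = enorm x *: dir a.
Proof.
have [->|x0] := eqVneq x 0.
  by exists 0; rewrite enorm0 scale0r.
have n0 : enorm x != 0 by apply: contra_neq x0; exact: enorm_eq0.
pose c := x.1 / enorm x; pose s := x.2 / enorm x.
have cs : c ^+ 2 + s ^+ 2 = 1.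
  rewrite /c /s !exprMn -mulrDl !exprVn enorm_sqr /dot -!expr2 divff//.
  by rewrite (_ : _ + _ = enorm x ^+ 2) ?sqrf_eq0// enorm_sqr /dot -!expr2.
have c1 : -1 <= c <= 1.
  rewrite -ler_norml -ler_sqr ?nnegrE// real_normK ?num_real// expr1n.
  by rewrite -cs lerDl sqr_ge0.
have xE : x = (enorm x * c, enorm x * s).
  by rewrite /c /s !mulrA ![enorm x * _]mulrC !mulfK// -surjective_pairing.
have sE : Num.sqrt (1 - c ^+ 2) = `|s|.
  by rewrite -cs addrAC subrr add0r sqrtr_sqr.
have [s0|/ltW s0] := lerP 0 s; [exists (acos c)|exists (- acos c)].
- rewrite {1}xE /dir sin_acos// acosK ?in_itv//= sE ger0_norm//.
- rewrite {1}xE /dir cosN sinN sin_acos// acosK ?in_itv//= sE ler0_norm//.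
  by rewrite opprK.
Qed.

End PlaneVectors.

Lemma sqrt3_sqr (R : realType) : Num.sqrt 3 ^+ 2 = 3 :> R.
Proof. by rewrite sqr_sqrtr. Qed.

Lemma sqrt3_gt0 (R : realType) : 0 < Num.sqrt 3 :> R.
Proof. by rewrite sqrtr_gt0. Qed.

Lemma sin_pi6_cos_pi6 (R : realType) :
  sin (pi / 6 : R) = 1 / 2 /\ cos (pi / 6 : R) = Num.sqrt 3 / 2.
Proof.
have p0 := @pi_gt0 R.
set x := pi / 6.
have c0 : 0 < cos x by apply: cos_gt0_pihalf; rewrite /x; lra.
have s0 : 0 < sin x by apply: sin_gt0_pihalf; rewrite /x; lra.
(* The values come from [cos (3 * x) = 0], whose left side factors as
   [cos x * (1 - 4 * sin x ^+ 2)]. *)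
have h1 : cos (x + (x + x)) = 0 by rewrite -(cos_pihalf R); congr cos; rewrite /x; lra.
move: h1; rewrite !cosD !sinD => h1.
have e := cos2Dsin2 x.
have : cos x * (1 - 4 * sin x ^+ 2) = 0.
  have -> : sin x ^+ 2 = 1 - cos x ^+ 2 by lra.
  have es : sin x ^+ 2 = 1 - cos x ^+ 2 by lra.
  transitivity (cos x * (cos x * cos x - sin x ^+ 2) - 2 * cos x * sin x ^+ 2).
    by rewrite es; ring.
  by rewrite -[RHS]h1; ring.
move/eqP; rewrite mulf_eq0 gt_eqF//= => /eqP h2.
have hs : sin x = 1 / 2.
  have : (sin x - 1 / 2) * (sin x + 1 / 2) = 0 by lra.
  by move/eqP; rewrite mulf_eq0 => /orP[] /eqP; lra.
split => //.
have s3 := sqrt3_gt0 R; have s32 := sqrt3_sqr R.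
have : (cos x - Num.sqrt 3 / 2) * (cos x + Num.sqrt 3 / 2) = 0.
  by move: e; rewrite hs; nra.
by move/eqP; rewrite mulf_eq0 => /orP[] /eqP; lra.
Qed.

Lemma sin_pi3_cos_pi3 (R : realType) :
  sin (pi / 3 : R) = Num.sqrt 3 / 2 /\ cos (pi / 3 : R) = 1 / 2.
Proof.
have [s c] := sin_pi6_cos_pi6 R.
have -> : pi / 3 = - (pi / 6) + pi / 2 :> R by lra.
by rewrite sinDpihalf cosDpihalf sinN cosN opprK.
Qed.

(** * The sharp parameter *)

Lemma ger0_increasing (R : realType) (f df : R -> R) (a b : R) :
  a <= b -> (forall x, a < x < b -> is_derive x 1 f (df x)) ->
  {within `[a, b], continuous f} -> (forall x, a <= x <= b -> 0 <= df x) ->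
  f a <= f b.
Proof.
move=> ab dfE cf df0.
have dfE' x : x \in `]a, b[ -> is_derive x 1 f (df x) by rewrite in_itv => /dfE.
have [c] := @MVT_segment _ f df a b ab dfE' cf.
rewrite in_itv/= => cab; rewrite -subr_ge0 => ->.
by rewrite mulr_ge0 ?subr_ge0// df0.
Qed.

Lemma sin_le_id (R : realType) (x : R) : 0 <= x -> sin x <= x.
Proof.
move=> x0; rewrite -subr_ge0.
suff : (fun y => y - sin y) 0 <= (fun y => y - sin y) x by rewrite /= sin0 subr0.
apply: (@ger0_increasing _ _ (fun y : R => 1 - cos y)) => //.
- apply: continuous_subspaceT => y.
  by apply: continuousB; [exact: cvg_id|exact: continuous_sin].
Qed.

Lemma sin_pi4_sqr (R : realType) : sin (pi / 4 : R) ^+ 2 = 1 / 2 /\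
  cos (pi / 4 : R) = sin (pi / 4) :> R /\ 0 < sin (pi / 4 : R).
Proof.
have p0 := @pi_gt0 R.
have s0 : 0 < sin (pi / 4 : R) by apply: sin_gt0_pihalf; lra.
have cs : cos (pi / 4 : R) = sin (pi / 4).
  by rewrite -sinDpihalf -[RHS]opprK -sinN -sinDpi; congr sin; lra.
split => //; have := cos2Dsin2 (pi / 4 : R); rewrite cs; lra.
Qed.

(** The last equation states that the inner parallel set of the unit Reuleaux triangle at distance
    [t] has area [pi * t ^+ 2]. That set has six congruent pieces, each a circular sector of radius
    [s] and angle [mu] minus a triangle with sides [s] and [Num.sqrt 3 / 3]. The equation is solved
    for [b] by the intermediate value theorem; the two bounds on [s] are the two ends of the
    interval for [b]. *)
Lemma sharp_parameter (R : realType) : exists b s t mu : R,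
  [/\ [/\ 0 < b <= pi / 4, t = 1 - s & mu = pi / 3 - b],
      s * sin b = 1 / 2, 1 / 2 <= s ^+ 2, 0 < s <= (3 + Num.sqrt 3) / 6 &
      s ^+ 2 * mu - Num.sqrt 3 / 3 * s * sin mu = pi / 3 * t ^+ 2].
Proof.
have p0 := @pi_gt0 R.
set q := Num.sqrt 3 : R.
have q2 : q ^+ 2 = 3 by exact: sqrt3_sqr.
have q0 : 0 < q by exact: sqrt3_gt0.
have q1 : 45 / 26 < q by rewrite ltNge; apply/negP => h; nra.
have q3 : q < 7 / 4 by rewrite ltNge; apply/negP => h; nra.
have [r2 [r4 r0]] := sin_pi4_sqr R.
set r := sin (pi / 4) in r2 r4 r0.
have r1 : 7 / 10 < r by rewrite ltNge; apply/negP => h; nra.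
(* [sin b = sg] corresponds to [s = (3 + q) / 6], that is to [2 * s - 1 = q / 3]: the largest [s]
   for which the radial field used later has norm at most [t] at the centre of the triangle. *)
pose sg := (3 - q) / 2.
have sg01 : -1 <= sg <= 1 by rewrite /sg; lra.
pose b0 := asin sg.
have sb0 : sin b0 = sg by rewrite asinK// in_itv.
have b0pi : - (pi / 2) <= b0 <= pi / 2.
  by rewrite asin_geNpi2// asin_lepi2.
have b04 : b0 <= pi / 4.
  rewrite leNgt -ltr_sin ?in_itv/=; [|lra|lra].
  rewrite sb0 -/r -leNgt leNgt; apply/negP => h.
  by move: h; rewrite /sg; nra.
have b06 : pi / 6 <= b0.
  rewrite leNgt -ltr_sin ?in_itv/=; [|lra|lra].
  by rewrite sb0 (sin_pi6_cos_pi6 R).1 -leNgt /sg; lra.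
(* Gives [pi / 3 - b0 > pi / 9], as used in [Kb0]. It is checked on the triple angle, by comparing
   [3 * b0] with [2 * pi / 3]. *)
have b09 : b0 < 2 * pi / 9.
  rewrite ltNge; apply/negP => b09.
  have h : sin (3 * b0) <= q / 2.
    rewrite -cosBpihalf -(sin_pi6_cos_pi6 R).2.
    by rewrite leNgt ltr_cos ?in_itv/=; [rewrite -leNgt|..]; lra.
  move: h; have -> : 3 * b0 = b0 + (b0 + b0) by ring.
  rewrite sinD cosD sinD sb0.
  have : cos b0 ^+ 2 = 1 - sg ^+ 2 by rewrite cos2sin2 sb0.
  move=> c2.
  have -> : sg * (cos b0 * cos b0 - sg * sg) + cos b0 * (sg * cos b0 + cos b0 * sg)
    = 3 * sg * cos b0 ^+ 2 - sg ^+ 3 by ring.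
  by rewrite c2 /sg; nra.
(* The equation divided by [s ^+ 2], with [s^-1 = 2 * sin b], hence [t / s = 2 * sin b - 1]. *)
pose K b := (pi / 3 - b) - 2 * (q / 3) * sin b * sin (pi / 3 - b)
  - pi / 3 * (2 * sin b - 1) ^+ 2.
have Kc : continuous K.
  have cs : continuous (fun b : R => sin (pi / 3 - b)).
    move=> x; apply: (@continuous_comp _ _ _ (fun b => pi / 3 - b)).
      by apply: cvgB; [exact: cvg_cst|exact: cvg_id].
    exact: continuous_sin.
  move=> x; rewrite /K; apply: cvgB; first apply: cvgB.
  - by apply: cvgB; [exact: cvg_cst|exact: cvg_id].
  - apply: cvgM; last exact: cs.
    by apply: cvgM; [exact: cvg_cst|exact: continuous_sin].
  - apply: cvgM; first exact: cvg_cst.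
    apply: (@continuous_comp _ _ _ (fun b => 2 * sin b - 1) (fun y => y ^+ 2)).
      apply: cvgB; last exact: cvg_cst.
      by apply: cvgM; [exact: cvg_cst|exact: continuous_sin].
    exact: exprn_continuous.
have Kb0 : 0 <= K b0.
  have := @sin_le_id R (pi / 3 - b0); rewrite subr_ge0.
  have -> : b0 <= pi / 3 by lra.
  move=> /(_ isT) smu; rewrite /K sb0.
  have e1 : 2 * (q / 3) * sg = q - 1 by rewrite /sg; nra.
  have e2 : 2 * sg - 1 = 2 - q by rewrite /sg; lra.
  rewrite e1 e2.
  have : 0 <= (2 - q) * ((pi / 3 - b0) - pi / 3 * (2 - q)) by apply: mulr_ge0; nra.
  have : (q - 1) * sin (pi / 3 - b0) <= (q - 1) * (pi / 3 - b0).
    by rewrite ler_pM2l//; lra.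
  by lra.
have K4 : K (pi / 4) <= 0.
  rewrite /K.
  rewrite sinB (sin_pi3_cos_pi3 R).1 (sin_pi3_cos_pi3 R).2 r4 -/r -/q.
  have pi4 : pi < 4 :> R by have := pihalf_lt2 R; lra.
  have -> : pi / 3 - pi / 4 - 2 * (q / 3) * r * (q / 2 * r - 1 / 2 * r) -
    pi / 3 * (2 * r - 1) ^+ 2 = pi / 12 - q / 3 * (q - 1) * r ^+ 2
     - pi / 3 * (4 * r ^+ 2 - 4 * r + 1) by field.
  by rewrite r2; nra.
have [|b] := @IVT R K b0 (pi / 4) 0 b04 (continuous_subspaceT Kc).
  by rewrite ge_min le_max K4 Kb0 orbT.
rewrite in_itv/= => /andP[bl br] Kb.
have sb : sg <= sin b.
  by rewrite -sb0 leNgt ltr_sin ?in_itv/= -?leNgt//; lra.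
have sbr : sin b <= r.
  by rewrite leNgt ltr_sin ?in_itv/= -?leNgt//; lra.
have sb_gt0 : 0 < sin b by apply: lt_le_trans sb; rewrite /sg; lra.
pose s := (2 * sin b)^-1.
have ssb : s * sin b = 1 / 2.
  by rewrite /s invfM -mulrA mulVf ?gt_eqF//; lra.
have s0 : 0 < s by rewrite /s invr_gt0; lra.
exists b, s, (1 - s), (pi / 3 - b); split => //.
- by split => //; lra.
- have : s * sin b <= s * r by rewrite ler_pM2l.
  by rewrite ssb => h; nra.
- rewrite s0 /=; have : s * sg <= s * sin b by rewrite ler_pM2l.
  by rewrite ssb /sg => h; nra.
- have sE : sin b = 1 / 2 / s by rewrite -ssb mulrAC mulfV ?mul1r// gt_eqF.
  move: Kb; rewrite /K sE => Kb.
  have := congr1 (fun x => s ^+ 2 * x) Kb; rewrite mulr0 => {}Kb.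
  apply/eqP; rewrite -subr_eq0 -[X in _ == X]Kb; apply/eqP.
  by field; rewrite gt_eqF.
Qed.

(** * Stream functions *)

Section StreamFunctions.
Context {R : realType}.
Implicit Types (x y z d : R * R) (U : set (R * R)) (F : R * R -> R) (t : R).

Definition segment_closed U := forall x y (l : R), 0 <= l <= 1 ->
  U x -> U y -> U (x + l *: (y - x)).

(* The field [W] with [wedge W v = 'D_v F x + wedge x v / 2] for all [v] has
   divergence 1; the bound integrates [enorm W <= t] along segments. *)
Definition flux_bounded t U F := forall x y, U x -> U y ->
  F y - F x + wedge x y / 2 <= t * edist x y.

Lemma flux_bounded_sub t U U' F : U `<=` U' ->
  flux_bounded t U' F -> flux_bounded t U F.
Proof. by move=> UU' gF x y /UU' Ux /UU' Uy; exact: gF. Qed.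

Lemma flux_bounded_eq t U F F' : (forall x, U x -> F x = F' x) ->
  flux_bounded t U F' -> flux_bounded t U F.
Proof. by move=> FF' gF x y Ux Uy; rewrite !FF'//; exact: gF. Qed.

(** The function that realises the minimum at [x] is an upper bound for the minimum at [y], so its
    own inequality suffices. *)
Lemma flux_bounded_min t U F F' : flux_bounded t U F -> flux_bounded t U F' ->
  flux_bounded t U (fun x => Num.min (F x) (F' x)).
Proof.
move=> gF gF' x y Ux Uy; have := gF x y Ux Uy; have := gF' x y Ux Uy.
case: (leP (F x) (F' x)) => ?; case: (leP (F y) (F' y)) => ?; lra.
Qed.

Lemma segment_closedI U U' : segment_closed U -> segment_closed U' ->
  segment_closed (U `&` U').
Proof. by move=> sU sU' x y l l01 [? ?] [? ?]; split; [exact: sU|exact: sU']. Qed.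

Lemma segment_closed_ge a c : segment_closed [set x | 0 <= dot a x - c].
Proof.
move=> x y l /andP[l0 l1] /=; rewrite /dot /= /GRing.scale /= => hx hy.
have := mulr_ge0 l0 hy; have l1' : 0 <= 1 - l by lra.
have := mulr_ge0 l1' hx; lra.
Qed.

Lemma segment_closed_le a c : segment_closed [set x | dot a x - c <= 0].
Proof.
move=> x y l /andP[l0 l1] /=; rewrite /dot /= /GRing.scale /= => hx hy.
have : 0 <= l * - (a.1 * y.1 + a.2 * y.2 - c) by rewrite mulr_ge0// oppr_ge0.
have : 0 <= (1 - l) * - (a.1 * x.1 + a.2 * x.2 - c).
  by rewrite mulr_ge0 ?subr_ge0// oppr_ge0.
lra.
Qed.

Lemma segment_closed_disk a r : segment_closed [set x | edist x a <= r].
Proof.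
move=> x y l /andP[l0 l1] /= hx hy; rewrite /edist.
have -> : x + l *: (y - x) - a = (1 - l) *: (x - a) + l *: (y - a).
  rewrite !scalerBr scalerBl !scale1r scalerBl scale1r.
  by apply/eqP; rewrite -subr_eq0; apply/eqP/pair_eqP/andP; split; apply/eqP => /=;
    ring.
apply: le_trans (enormD _ _) _; rewrite !enormZ ger0_norm ?subr_ge0// ger0_norm//.
have := ler_wpM2l l0 hy; have l1' : 0 <= 1 - l by lra.
have := ler_wpM2l l1' hx; rewrite /edist; lra.
Qed.

(* A segment crossing the line splits at the crossing point: lengths and the
   swept areas [wedge x y / 2] both add up. *)
Lemma flux_bounded_glue t U F a c : segment_closed U ->
  flux_bounded t (U `&` [set x | 0 <= dot a x - c]) F ->
  flux_bounded t (U `&` [set x | dot a x - c <= 0]) F -> flux_bounded t U F.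
Proof.
move=> sU gp gn.
have cross x y : U x -> U y -> 0 < dot a x - c -> dot a y - c < 0 ->
    exists l, [/\ 0 <= l <= 1, U (x + l *: (y - x)) &
      dot a (x + l *: (y - x)) - c = 0].
  move=> Ux Uy x0 y0.
  set p := dot a x - c in x0; set n := dot a y - c in y0.
  have pn : 0 < p - n by lra.
  have l01 : 0 <= p / (p - n) <= 1.
    by rewrite divr_ge0 ?(ltW x0) ?(ltW pn)//= ler_pdivrMr// mul1r; lra.
  exists (p / (p - n)); split => //; first exact: sU.
  transitivity (p - p / (p - n) * (p - n)).
    by rewrite /p /n /dot /= /GRing.scale /=; ring.
  by rewrite divfK ?subrr// gt_eqF.
have split_dist x y l : 0 <= l <= 1 -> let z := x + l *: (y - x) in
    edist x y = edist x z + edist z y /\ wedge x y = wedge x z + wedge z y.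
  move=> /andP[l0 l1] z; split; last first.
    by rewrite /z /wedge /= /GRing.scale /=; ring.
  have -> : edist x z = l * edist x y.
    rewrite /edist /z opprD addrA subrr add0r -scalerN enormZ ger0_norm//.
    by rewrite opprB.
  have -> : edist z y = (1 - l) * edist x y.
    rewrite /edist /z -[1 - l]ger0_norm ?subr_ge0// -enormZ.
    by rewrite scalerBl scale1r -addrA addrC -scalerN opprB addrC addrA addrAC.
  by ring.
move=> x y Ux Uy.
have [xp|xn] := leP 0 (dot a x - c); have [yp|yn] := leP 0 (dot a y - c).
- exact: gp.
- have [x0|x0] := leP (dot a x - c) 0.
    by apply: gn => //; split => //=; exact: ltW.
  have [l [l01 Uz z0]] := cross x y Ux Uy x0 yn.
  have [-> ->] := split_dist x y l l01; set z := _ + l *: _.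
  have h1 : F z - F x + wedge x z / 2 <= t * edist x z.
    by apply: gp; split => //=; rewrite z0.
  have h2 : F y - F z + wedge z y / 2 <= t * edist z y.
    by apply: gn; split => //=; [rewrite z0|exact: ltW].
  by move: h1 h2; lra.
- have [y0|y0] := leP (dot a y - c) 0.
    by apply: gn => //; split => //=; exact: ltW.
  have [l [l01 Uz z0]] := cross y x Uy Ux y0 xn.
  have [h3 h4] := split_dist y x l l01; move: Uz z0 h3 h4; set z := _ + l *: _.
  move=> Uz z0 h3 h4.
  have h1 : F z - F x + wedge x z / 2 <= t * edist x z.
    by apply: gn; split => //=; [exact: ltW|rewrite z0].
  have h2 : F y - F z + wedge z y / 2 <= t * edist z y.
    by apply: gp; split => //=; rewrite z0.
  move: h1 h2; rewrite (edistC x y) h3 (edistC x z) (edistC z y).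
  have -> : wedge x y = wedge x z + wedge z y.
    by move: h4; rewrite /wedge; lra.
  by rewrite mulrDr; lra.
- by apply: gn => //; split => //=; exact: ltW.
Qed.

(** Along the segment [wedge (x + l *: (y - x)) (y - x)] is constantly [wedge x y], so only the
    increment of [F] calls for the mean value theorem. *)
Lemma flux_bounded_MVT t U F : (forall x y, U x -> U y ->
    exists2 df : R -> R,
      (forall l : R, 0 <= l <= 1 -> is_derive l 1 (fun l : R => F (x + l *: (y - x))) (df l)) &
      forall l : R, 0 <= l <= 1 -> df l + wedge x y / 2 <= t * edist x y) ->
  flux_bounded t U F.
Proof.
move=> hF x y Ux Uy; have [df dfE dfle] := hF x y Ux Uy.
pose f l := F (x + l *: (y - x)).
have dfE' (l : R) : l \in `]0, 1[ -> is_derive l 1 f (df l).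
  by rewrite in_itv/= => /andP[l0 l1]; apply: dfE; rewrite !ltW.
have cf : {within `[0, 1], continuous f}.
  apply: derivable_within_continuous => l; rewrite in_itv/= => l01.
  by have [] := dfE l l01.
have [l] := @MVT_segment _ f df 0 1 ler01 dfE' cf.
rewrite in_itv/= /f scale0r addr0 scale1r (addrC x) subrK subr0 mulr1 => l01 ->.
exact: dfle.
Qed.

(** The area of the part of a quarter disk of radius [t] between heights 0 and [y]: the primitive of
    [Num.sqrt (t ^+ 2 - y ^+ 2)] that vanishes at 0. *)
Definition quarter_area t (y : R) : R :=
  (y * Num.sqrt (t ^+ 2 - y ^+ 2) + t ^+ 2 * asin (y / t)) / 2.

Lemma is_derive_quarter_area t (y : R) : 0 < t -> `|y| < t ->
  is_derive y 1 (quarter_area t) (Num.sqrt (t ^+ 2 - y ^+ 2)).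
Proof.
move=> t0 yt.
have h : 0 < t ^+ 2 - y ^+ 2 by move: yt; rewrite ltr_norml => /andP[? ?]; nra.
have yt1 : -1 < y / t < 1.
  by rewrite -ltr_norml normrM normfV (gtr0_norm t0) ltr_pdivrMr// mul1r.
have d1 := is_derive1_asin yt1.
have d2 := is_derive1_sqrt h.
have d3 : is_derive y 1 (fun y : R => t ^+ 2 - y ^+ 2) (- (2 * y)).
  by apply: is_derive_eq; rewrite ?sub0r /GRing.scale /=; ring.
have d4 : is_derive y 1 (fun y : R => y / t) (t^-1).
  by apply: is_derive_eq; rewrite /GRing.scale /=; ring.
have d5 := @is_derive1_comp R Num.sqrt (fun y : R => t ^+ 2 - y ^+ 2) y _ _ d2 d3.
have d6 := @is_derive1_comp R asin (fun y : R => y / t) y _ _ d1 d4.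
pose S := Num.sqrt (t ^+ 2 - y ^+ 2).
have S0 : 0 < S by rewrite sqrtr_gt0.
have SE : Num.sqrt (1 - (y / t) ^+ 2) = S / t.
  have -> : 1 - (y / t) ^+ 2 = (t ^+ 2 - y ^+ 2) * t^-1 ^+ 2.
    by field; rewrite gt_eqF.
  by rewrite sqrtrM ?(ltW h)// sqrtr_sqr ger0_norm// invr_ge0 ltW.
have S2 : S ^+ 2 = t ^+ 2 - y ^+ 2 by rewrite sqr_sqrtr// ltW.
rewrite SE -/S in d6.
rewrite -/S in d5 *.
have -> : quarter_area t = 2^-1 \*: ((id * (Num.sqrt \o (fun y : R => t ^+ 2 - y ^+ 2))) +
   t ^+ 2 \*: (asin \o (fun y : R => y / t))).
  by apply/funext => z; rewrite /quarter_area /= mulrC.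
apply: is_derive_eq; rewrite /GRing.scale /= -/S.
apply/eqP; rewrite -subr_eq0; apply/eqP.
transitivity ((t ^+ 2 - y ^+ 2 - S ^+ 2) / (2 * S)).
  by field; rewrite !gt_eqF.
by rewrite S2 subrr mul0r.
Qed.

End StreamFunctions.

(** * The stream function of the Reuleaux triangle *)

Lemma is_derive_affine (R : realType) (p d l : R) :
  is_derive l 1 (fun l : R => p + l * d) d.
Proof. by apply: is_derive_eq; rewrite /GRing.scale /=; ring. Qed.

Lemma is_derive_atan_div (R : realType) (f g : R -> R) (df dg l : R) :
  is_derive l 1 f df -> is_derive l 1 g dg -> g l != 0 ->
  is_derive l 1 (fun l => atan (f l / g l))
    ((g l * df - f l * dg) / (g l ^+ 2 + f l ^+ 2)).
Proof.
move=> hf hg g0.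
have hV : is_derive l 1 (fun l => (g l)^-1) (- (g l) ^- 2 *: dg) by exact: is_deriveV.
have hM : is_derive l 1 (fun l => f l / g l) ((g l * df - f l * dg) / g l ^+ 2).
  apply: is_derive_eq; rewrite /GRing.scale /=; by field.
have := @is_derive1_comp R atan (fun l => f l / g l) l _ _ (is_derive1_atan _) hM.
move/is_derive_eq; apply; field; rewrite g0 /=.
have h : 0 < g l ^+ 2 by rewrite exprn_even_gt0.
by rewrite !gt_eqF// ltr_wpDr// sqr_ge0.
Qed.

Lemma asin0 (R : realType) : asin 0 = 0 :> R.
Proof.
rewrite -[in LHS](sin0 R) sinK// in_itv/= oppr_le0.
by rewrite divr_ge0// pi_ge0.
Qed.

Lemma quarter_area0 (R : realType) (t : R) : quarter_area t 0 = 0.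
Proof. by rewrite /quarter_area !mul0r asin0 mulr0 addr0 mul0r. Qed.

Lemma sqrt3_itv (R : realType) (q : R) : q ^+ 2 = 3 -> 0 < q ->
  17 / 10 < q < 7 / 4.
Proof.
move=> q2 q0; apply/andP; split; rewrite ltNge; apply/negP => h; nra.
Qed.

Section SharpStream.
Context {R : realType}.
Variables (q b s t mu : R).
Hypothesis q2 : q ^+ 2 = 3.
Hypothesis q0 : 0 < q.
Hypothesis b_itv : 0 < b <= pi / 4.
Hypothesis tE : t = 1 - s.
Hypothesis muE : mu = pi / 3 - b.
Hypothesis ssb : s * sin b = 1 / 2.
Hypothesis s2 : 1 / 2 <= s ^+ 2.
Hypothesis s_itv : 0 < s <= (3 + q) / 6.
Hypothesis tileE : s ^+ 2 * mu - q / 3 * s * sin mu = pi / 3 * t ^+ 2.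

Local Notation k := (1 - 2 * t).
Local Notation yJ := (t * sin b).

Let q_itv : 17 / 10 < q < 7 / 4.
Proof. exact: sqrt3_itv. Qed.
Let s7 : 7 / 10 < s.
Proof. by rewrite ltNge; apply/negP => h; move: s2 s_itv; nra. Qed.
Let t_itv : 0 < t < 3 / 10.
Proof. by rewrite tE; move: q_itv s_itv s7; lra. Qed.
Let sb_itv : 0 < sin b < 3 / 4.
Proof. by apply/andP; split; rewrite ltNge; apply/negP => h; move: ssb s7; nra. Qed.
Let sb2 : sin b ^+ 2 <= 1 / 2.
Proof.
have : (s * sin b) ^+ 2 = 1 / 4 by rewrite ssb; lra.
rewrite exprMn => h.
have : 0 <= (s ^+ 2 - 1 / 2) * sin b ^+ 2 by rewrite mulr_ge0 ?sqr_ge0// subr_ge0.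
by lra.
Qed.
Let cb_gt0 : 0 < cos b.
Proof. by apply: cos_gt0_pihalf; have := @pi_gt0 R; move: b_itv; lra. Qed.
Let cb2 : cos b ^+ 2 = 1 - sin b ^+ 2. Proof. exact: cos2sin2. Qed.
Let yJE : yJ = sin b - 1 / 2. Proof. by rewrite tE -ssb; ring. Qed.
Let yJ_itv : 0 < yJ < t.
Proof. by move: t_itv sb_itv; nra. Qed.

(* The field is [(Num.sqrt (t ^+ 2 - x.2 ^+ 2), x.2)], of norm exactly [t]. *)
Definition strip_stream (x : R * R) : R := quarter_area t x.2 - x.1 * x.2 / 2.

(* The field is [(1 - k / enorm X ^+ 2) / 2 *: X], where [X] is the position relative
   to the vertex [(- q / 6, - 1 / 2)]. *)
Definition radial_stream (x : R * R) : R :=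
  - (x.1 / 2 - q / 6 * x.2) / 2 +
  k / 2 * (pi / 3 - atan ((x.2 + 1 / 2) / (x.1 + q / 6))).

(** On the right half of every circle of radius [t] centred on the axis the field is the radius
    vector, so it calibrates the arc that rounds off the tip of the Cheeger set. The bound on the
    height keeps the square root differentiable along the segment. *)
Lemma flux_bounded_strip (U : set (R * R)) :
  (forall x, U x -> `|x.2| <= yJ) -> flux_bounded t U strip_stream.
Proof.
move=> UJ; apply: flux_bounded_MVT => x y /UJ xJ /UJ yyJ.
pose p l := x.2 + l * (y.2 - x.2).
have pt l : 0 <= l <= 1 -> `|p l| < t.
  move=> /andP[l0 l1]; apply: le_lt_trans (_ : yJ < t); last by have /andP[] := yJ_itv.
  have -> : p l = (1 - l) * x.2 + l * y.2 by rewrite /p; ring.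
  rewrite (le_trans (ler_normD _ _))// !normrM (ger0_norm l0) ger0_norm ?subr_ge0//.
  have := ler_wpM2l l0 yyJ; have l1' : 0 <= 1 - l by lra.
  have := ler_wpM2l l1' xJ; lra.
pose S l := Num.sqrt (t ^+ 2 - p l ^+ 2).
exists (fun l => S l * (y.2 - x.2) -
   ((y.1 - x.1) * p l + (x.1 + l * (y.1 - x.1)) * (y.2 - x.2)) / 2).
  move=> l l01.
  have d1 := @is_derive_affine R x.1 (y.1 - x.1) l.
  have d2 : is_derive l 1 p (y.2 - x.2) := @is_derive_affine R x.2 (y.2 - x.2) l.
  have d3 := @is_derive_quarter_area R t (p l) _ (pt l l01).
  have {}d3 := d3 (andP t_itv).1.
  have d4 := @is_derive1_comp R (quarter_area t) p l _ _ d3 d2.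
  have -> : (fun l => strip_stream (x + l *: (y - x))) =
     ((quarter_area t) \o p) - 2^-1 \*: ((fun l => x.1 + l * (y.1 - x.1)) * p).
    apply/funext => l' /=; rewrite /strip_stream /= /GRing.scale /= !fctE /=.
    by rewrite /GRing.scale /= /p; field.
  apply: is_derive_eq; rewrite /GRing.scale /= /S; ring.
move=> l l01.
have h := wedge_le (S l, p l) (y - x).
have e : enorm (S l, p l) = t.
  apply: enorm_eq; first by rewrite ltW// (andP t_itv).1.
  rewrite /dot /= -!expr2 sqr_sqrtr; first by ring.
  have := pt l l01; rewrite ltr_norml => /andP[? ?]; nra.
move: h; rewrite e edistC /edist /wedge /= => h; apply: le_trans h.
rewrite /p; lra.
Qed.

(** At distance [r] from the vertex the field has norm half the absolute value of [r - k / r], which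
    is at most [t] exactly for [k <= r <= 1]. In the quadrant [r >= q / 3], and [s <= (3 + q) / 6]
    means [k <= q / 3]. *)
Lemma flux_bounded_radial (U : set (R * R)) :
  (forall x, U x -> [/\ 0 <= x.1, 0 <= x.2 & (x.1 + q / 6) ^+ 2 + (x.2 + 1 / 2) ^+ 2 <= 1]) ->
  segment_closed U -> flux_bounded t U radial_stream.
Proof.
move=> UP sU; apply: flux_bounded_MVT => x y Ux Uy.
pose X1 l := x.1 + q / 6 + l * (y.1 - x.1).
pose X2 l := x.2 + 1 / 2 + l * (y.2 - x.2).
have XP l : 0 <= l <= 1 -> [/\ 0 < X1 l, 0 < X2 l, X1 l ^+ 2 + X2 l ^+ 2 <= 1 &
     k ^+ 2 <= X1 l ^+ 2 + X2 l ^+ 2].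
  move=> l01; have [h1 h2] := UP _ (sU x y l l01 Ux Uy).
  move: h1 h2; rewrite /= /GRing.scale /=.
  set z1 := x.1 + _; set z2 := x.2 + _ => h1 h2.
  have -> : X1 l = z1 + q / 6 by rewrite /X1 /z1; ring.
  have -> : X2 l = z2 + 1 / 2 by rewrite /X2 /z2; ring.
  move=> h3; split => //; [by move: q_itv; lra|by lra|].
  have : (q / 3) ^+ 2 <= (z1 + q / 6) ^+ 2 + (z2 + 1 / 2) ^+ 2.
    by move: q_itv q2; nra.
  apply: le_trans; move: s_itv s7; rewrite tE => ? ?.
  by rewrite ler_sqr ?nnegrE; move: q_itv; lra.
pose r2 l := X1 l ^+ 2 + X2 l ^+ 2.
exists (fun l => - ((y.1 - x.1) / 2 - q / 6 * (y.2 - x.2)) / 2 -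
   k / 2 * ((X1 l * (y.2 - x.2) - X2 l * (y.1 - x.1)) / r2 l)).
  move=> l l01; have [X10 X20 _ _] := XP l l01.
  have d1 : is_derive l 1 X1 (y.1 - x.1) := @is_derive_affine R _ (y.1 - x.1) l.
  have d2 : is_derive l 1 X2 (y.2 - x.2) := @is_derive_affine R _ (y.2 - x.2) l.
  have d3 := @is_derive_atan_div R X2 X1 _ _ l d2 d1 (lt0r_neq0 X10).
  rewrite -/(r2 l) in d3.
  have -> : (fun l => radial_stream (x + l *: (y - x))) =
     cst (k / 2 * (pi / 3)) - 4^-1 \*: (X1 - cst (q / 6)) + (q / 12) \*: (X2 - cst (1 / 2))
      - (k / 2) \*: (fun l => atan (X2 l / X1 l)).
    apply/funext => l' /=; rewrite /radial_stream /= /GRing.scale /=.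
    rewrite !fctE /=.
    have -> : x.1 + l' * (y.1 - x.1) + q / 6 = X1 l' by rewrite /X1; ring.
    have -> : x.2 + l' * (y.2 - x.2) + 1 / 2 = X2 l' by rewrite /X2; ring.
    by rewrite /GRing.scale /= /X1 /X2; field.
  apply: is_derive_eq; rewrite /GRing.scale /=; field.
  by rewrite gt_eqF// addr_gt0// exprn_gt0.
move=> l l01; have [X10 X20 r21 r2k] := XP l l01.
rewrite -/(r2 l) in r21 r2k.
have r2_gt0 : 0 < r2 l by rewrite addr_gt0// exprn_gt0.
pose r := Num.sqrt (r2 l).
have rr : r ^+ 2 = r2 l by rewrite sqr_sqrtr// ltW.
have r0 : 0 < r by rewrite sqrtr_gt0.
have r1 : r <= 1 by rewrite leNgt; apply/negP => h; nra.
have k0 : 0 < k by move: s7; rewrite tE; lra.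
have kr : k <= r by rewrite leNgt; apply/negP => h; nra.
pose f := (r - k / r) / 2.
have fk : `|f| <= t.
  have ur : k / r * r = k by rewrite divfK// gt_eqF.
  (* Since [k = 1 - 2 * t], these products are [r ^+ 2 + 2 * t * r - k] and
     [k + 2 * t * r - r ^+ 2], the two bounds on [f] cleared of denominators. *)
  have h1 : 0 <= (r + 1) * (r - k) by rewrite mulr_ge0 ?subr_ge0//; lra.
  have h2 : 0 <= (1 - r) * (r + k) by rewrite mulr_ge0 ?subr_ge0//; lra.
  have h3 : 0 <= (r - k / r + 2 * t) * r.
    have -> : (r - k / r + 2 * t) * r = r * r - k / r * r + 2 * t * r by ring.
    by rewrite ur; move: h1; lra.
  have h4 : 0 <= (2 * t - (r - k / r)) * r.
    have -> : (2 * t - (r - k / r)) * r = 2 * t * r - (r * r - k / r * r) by ring.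
    by rewrite ur; move: h2; lra.
  move: h3 h4; rewrite !pmulr_lge0// => h3 h4.
  by rewrite ler_norml /f; apply/andP; split; lra.
have h := wedge_le ((f / r) *: (X1 l, X2 l)) (y - x).
have e : enorm ((f / r) *: (X1 l, X2 l)) = `|f|.
  rewrite enormZ (_ : enorm _ = r); last by rewrite /enorm /dot /= -!expr2.
  by rewrite normrM normfV (gtr0_norm r0) divfK// gt_eqF.
rewrite e in h.
apply: (@le_trans _ _ (`|f| * edist x y)); last first.
  by rewrite ler_wpM2r// enorm_ge0.
rewrite edistC; apply: le_trans h.
rewrite /wedge /= /GRing.scale /=.
have -> : f / r = (1 - k / r2 l) / 2.
  by rewrite -rr /f; field; rewrite gt_eqF.
rewrite le_eqVlt; apply/orP; left; apply/eqP.
have := lt0r_neq0 r2_gt0; move: (r2 l) => rho rho0.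
by rewrite /X1 /X2; field.
Qed.


Let qE : q = Num.sqrt 3.
Proof.
have := sqrt3_sqr R; have := sqrt3_gt0 R; set q' := Num.sqrt 3 => h1 h2.
have : (q - q') * (q + q') = 0 by rewrite -subr_sqr q2 h2 subrr.
by move/eqP; rewrite mulf_eq0 => /orP[] /eqP; move: q0; lra.
Qed.

Let tan_pi3 : tan (pi / 3) = q.
Proof.
by have [s3 c3] := sin_pi3_cos_pi3 R; rewrite /tan s3 c3 qE; field.
Qed.

Let sin_mu : sin mu = q / 2 * cos b - 1 / 2 * sin b.
Proof.
have [s3 c3] := sin_pi3_cos_pi3 R.
by rewrite muE sinB s3 c3 -qE.
Qed.

(* The two streams agree at the corner [J = (- q / 6, - 1 / 2) + dir b]: this is
   where [tileE] is needed. *)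
Lemma streams_eq_corner : strip_stream (cos b - q / 6, yJ) =
  radial_stream (cos b - q / 6, yJ).
Proof.
have t0 : t != 0 by rewrite gt_eqF// (andP t_itv).1.
have Bb : asin (sin b) = b.
  by apply: sinK; rewrite in_itv/=; have := @pi_gt0 R; move: b_itv; lra.
have tb : atan (sin b / cos b) = b.
  by apply: tanK; rewrite in_itv/=; have := @pi_gt0 R; move: b_itv; lra.
rewrite /strip_stream /radial_stream /= /quarter_area.
have -> : yJ / t = sin b by rewrite mulrAC mulfV// mul1r.
have -> : yJ + 1 / 2 = sin b by rewrite yJE; ring.
have -> : cos b - q / 6 + q / 6 = cos b by ring.
rewrite Bb tb -muE.
have -> : t ^+ 2 - yJ ^+ 2 = (t * cos b) ^+ 2 by rewrite !exprMn cb2; ring.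
rewrite sqrtr_sqr ger0_norm; last first.
  by rewrite mulr_ge0// ?(ltW cb_gt0)// ltW// (andP t_itv).1.
have e1 : q / 3 * s * sin mu = s * cos b / 2 - q / 12.
  rewrite sin_mu; transitivity (q ^+ 2 / 6 * (s * cos b) - q / 6 * (s * sin b)).
    by field.
  by rewrite ssb q2; field.
have e2 : k * mu = t ^+ 2 * b + s * cos b / 2 - q / 12.
  have : s ^+ 2 * mu = pi / 3 * t ^+ 2 + s * cos b / 2 - q / 12.
    by rewrite -tileE e1; ring.
  have -> : s ^+ 2 = k + t ^+ 2 by rewrite tE; ring.
  by rewrite mulrDl [X in _ + X = _ -> _]mulrC muE; lra.
have -> : k / 2 * mu = (k * mu) / 2 by field.
rewrite e2.
have -> : yJ * (t * cos b) = yJ * cos b - (s * sin b) * t * cos b.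
  by rewrite tE; ring.
by rewrite ssb yJE tE; field.
Qed.

(** The radial field has no flux across a ray from the vertex, so along the ray the difference
    changes by the flux of the strip field alone, [S * sin b - p * cos b]. This is nonnegative
    because [p <= t * sin b], and the difference vanishes at the outer end, the corner [J]. *)
Lemma strip_le_radial_ray (r : R) : s <= r <= 1 ->
  strip_stream (r * cos b - q / 6, r * sin b - 1 / 2) <=
  radial_stream (r * cos b - q / 6, r * sin b - 1 / 2).
Proof.
move=> /andP[sr r1].
pose p r := r * sin b - 1 / 2.
have pP r' : s <= r' <= 1 -> 0 <= p r' <= yJ.
  move=> /andP[h1 h2]; have /andP[sb0 _] := sb_itv.
  have := ler_wpM2r (ltW sb0) h1; have := ler_wpM2r (ltW sb0) h2.
  rewrite ssb mul1r yJE /p; lra.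
pose A r := - ((r * cos b - q / 6) / 2 - q / 6 * p r) / 2 + k / 2 * mu.
pose S r := Num.sqrt (t ^+ 2 - p r ^+ 2).
pose D r := strip_stream (r * cos b - q / 6, p r) - A r.
have AE r' : 0 < r' -> radial_stream (r' * cos b - q / 6, p r') = A r'.
  move=> r0; rewrite /radial_stream /= /A /p.
  rewrite !subrK.
  have -> : r' * sin b / (r' * cos b) = tan b.
    by rewrite /tan -mulf_div divff ?gt_eqF// mul1r.
  rewrite tanK ?muE// in_itv/=.
  by have := @pi_gt0 R; move: b_itv; lra.
have s0 : 0 < s by move: s7; lra.
rewrite -/(p r) AE; last by lra.
rewrite -subr_le0 -/(D r).
have D1 : D 1 = 0.
  have e : p 1 = yJ by rewrite /p yJE; ring.
  by rewrite /D -AE// mul1r e streams_eq_corner subrr.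
rewrite -D1.
have dD (x : R) : s <= x <= 1 -> is_derive x 1 D (S x * sin b - p x * cos b).
  move=> sx1; have /andP[p0 p1] := pP x sx1.
  have pt : `|p x| < t by rewrite ger0_norm//; move: yJ_itv; lra.
  have d2 : is_derive x 1 p (sin b).
    by apply: is_derive_eq; rewrite /GRing.scale /=; ring.
  have d3 := @is_derive_quarter_area R t (p x) (andP t_itv).1 pt.
  have d4 := @is_derive1_comp R (quarter_area t) p x _ _ d3 d2.
  have -> : D = (quarter_area t \o p) -
     2^-1 \*: ((fun r : R => r * cos b - q / 6) * p)
     + 4^-1 \*: ((fun r : R => r * cos b - q / 6)) - (q / 12) \*: p - cst (k / 2 * mu).
    apply/funext => r' /=; rewrite /D /A /strip_stream /= !fctE /=.
    by rewrite /GRing.scale /=; field.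
  apply: is_derive_eq; by rewrite /GRing.scale /= /S /p; field.
apply: (@ger0_increasing R D (fun x => S x * sin b - p x * cos b) r 1 r1).
- by move=> x /andP[x1 x2]; apply: dD; lra.
- apply: derivable_within_continuous => x; rewrite in_itv/= => /andP[x1 x2].
  by have [] // := dD x _; lra.
- move=> x /andP[x1 x2]; have /andP[p0 p1] : 0 <= p x <= yJ by apply: pP; lra.
  have t0 : 0 < t by have /andP[] := t_itv.
  have Sc : t * cos b <= S x.
    rewrite -[t * cos b]ger0_norm; last by rewrite mulr_ge0 ?ltW.
    rewrite -sqrtr_sqr ler_wsqrtr// exprMn cb2.
    by rewrite mulrBr mulr1 lerD2l lerN2 -exprMn ler_sqr ?nnegrE// (le_trans p0).
  have /andP[sb0 _] := sb_itv.
  have := ler_wpM2r (ltW sb0) Sc; have := ler_wpM2r (ltW cb_gt0) p1; lra.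
Qed.

(** Along a horizontal line the difference of the streams changes by the difference of the vertical
    components of the fields. These agree at [J], and inside the unit disk about the vertex the
    radial one is the smaller. *)
Lemma radial_le_strip_level (x1 : R) : 0 <= x1 -> x1 <= cos b - q / 6 ->
  radial_stream (x1, yJ) <= strip_stream (x1, yJ).
Proof.
move=> x10 x1c.
pose D x := strip_stream (x, yJ) - radial_stream (x, yJ).
rewrite -subr_ge0 -/(D x1) -oppr_le0.
have D1 : - D (cos b - q / 6) = 0 by rewrite /D streams_eq_corner subrr oppr0.
rewrite -D1.
pose r2 x := (x + q / 6) ^+ 2 + sin b ^+ 2.
have r20 x : 0 <= x -> 0 < r2 x.
  by move=> x0; rewrite ltr_pwDl// ?sqr_ge0// exprn_gt0//; move: q0; lra.
have dD (x : R) : 0 <= x -> is_derive x 1 (fun x : R => - D x)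
    (yJ / 2 - 1 / 4 + k / 2 * (sin b / r2 x)).
  move=> x0.
  have d1 : is_derive x 1 (fun x : R => x + q / 6) 1.
    by apply: is_derive_eq; rewrite addr0.
  have d3 := @is_derive_atan_div R (cst (sin b)) (fun x : R => x + q / 6) _ _ x
    (is_derive_cst _ _ _) d1.
  have {}d3 := d3 (lt0r_neq0 (_ : 0 < x + q / 6)).
  have {}d3 := d3 (ltr_wpDl x0 (divr_gt0 q0 (ltr0Sn _ _))).
  have -> : (fun x : R => - D x) = cst (- quarter_area t yJ + q / 12 * yJ + k / 2 * (pi / 3)) + (yJ / 2) \*: id
      - 4^-1 \*: id - (k / 2) \*: (fun x : R => atan (cst (sin b) x / (x + q / 6))).
    apply/funext => x' /=; rewrite /D /strip_stream /radial_stream /= !fctE /=.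
    have -> : yJ + 1 / 2 = sin b by rewrite yJE; ring.
    by rewrite /GRing.scale /=; field.
  apply: is_derive_eq; rewrite /GRing.scale /= -/(r2 x); field.
  by rewrite gt_eqF// r20.
apply: (@ger0_increasing R (fun x : R => - D x)
  (fun x => yJ / 2 - 1 / 4 + k / 2 * (sin b / r2 x)) x1 (cos b - q / 6) x1c).
- by move=> x /andP[h1 h2]; apply: dD; lra.
- apply: derivable_within_continuous => x; rewrite in_itv/= => /andP[h1 h2].
  by have [] // := dD x _; lra.
- move=> x /andP[h1 h2].
  have r21 : r2 x <= 1.
    rewrite /r2 -[X in _ <= X](cos2Dsin2 b) lerD2r ler_sqr ?nnegrE ?(ltW cb_gt0)//.
      by move: q0; lra.
    by move: q0; lra.
  have : sin b <= sin b / r2 x.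
    rewrite ler_pdivlMr ?r20//; last by lra.
    by rewrite ler_piMr// ltW// (andP sb_itv).1.
  have k0 : 0 <= k / 2 by move: t_itv; lra.
  move=> /(ler_wpM2l k0); rewrite yJE.
  have : k * sin b = 2 * (s * sin b) - sin b by rewrite tE; ring.
  by rewrite ssb; lra.
Qed.

Definition std_reuleaux : set (R * R) := [set x | [/\ edist x (q / 3, 0) <= 1,
  edist x (- (q / 6), 1 / 2) <= 1 & edist x (- (q / 6), - (1 / 2)) <= 1]].

Let disk_sqr (x a : R * R) :
  edist x a <= 1 -> (x.1 - a.1) ^+ 2 + (x.2 - a.2) ^+ 2 <= 1.
Proof. by rewrite /edist enorm_le// expr1n /dot /= -!expr2. Qed.

(** One sixth of the triangle, between the symmetry axes through the vertices [(q / 3, 0)] and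
    [(- (q / 6), - (1 / 2))]; the boundary arc along it is centred at the latter. *)
Definition half_sector : set (R * R) :=
  std_reuleaux `&` [set x | 0 <= x.2 /\ x.2 <= q * x.1].

Definition ray_side (x : R * R) : R :=
  (x.1 + q / 6) * sin b - (x.2 + 1 / 2) * cos b.

(** The strip stream serves the tip beyond the ray through [J], the radial one the part above the
    height of [J]. The remaining region borders on both, and there the minimum is taken: by
    [strip_le_radial_ray] and [radial_le_strip_level] it agrees on each border with the neighbouring
    piece. *)
Definition half_sector_stream (x : R * R) : R :=
  if 0 <= ray_side x then strip_stream x
  else if yJ <= x.2 then radial_stream x
  else Num.min (strip_stream x) (radial_stream x).

Let half_sectorP x : half_sector x ->
  [/\ 0 <= x.1, 0 <= x.2, x.2 <= q * x.1 &
     (x.1 + q / 6) ^+ 2 + (x.2 + 1 / 2) ^+ 2 <= 1].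
Proof.
move=> [[_ _ /disk_sqr /=]]; rewrite !opprK => h [x20 x2q]; split => //.
by rewrite -(pmulr_rge0 _ q0); apply: le_trans x2q.
Qed.

Let segment_closed_std : segment_closed std_reuleaux.
Proof.
move=> x y l l01 [x1 x2 x3] [y1 y2 y3].
by split; apply: segment_closed_disk.
Qed.

Let segment_closed_half : segment_closed half_sector.
Proof.
apply: segment_closedI => // x y l /andP[l0 l1] /= [x1 x2] [y1 y2].
have l1' : 0 <= 1 - l by lra.
have := mulr_ge0 l0 y1; have := mulr_ge0 l1' x1.
have := ler_wpM2l l0 y2; have := ler_wpM2l l1' x2.
by rewrite /GRing.scale /= => *; split; lra.
Qed.

Let on_rayP x : half_sector x -> ray_side x = 0 ->
  exists2 r, s <= r <= 1 & x = (r * cos b - q / 6, r * sin b - 1 / 2).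
Proof.
move=> /half_sectorP[x10 x20 _ x31] w0.
pose r := (x.1 + q / 6) / cos b.
have rc : x.1 + q / 6 = r * cos b by rewrite /r divfK// gt_eqF.
have rs : x.2 + 1 / 2 = r * sin b.
  apply: (mulIf (lt0r_neq0 cb_gt0)); move: w0; rewrite /ray_side rc; lra.
exists r; last by rewrite [LHS]surjective_pairing -rc -rs !addrK.
have r0 : 0 < r by rewrite divr_gt0// ltr_wpDl// divr_gt0.
have /andP[sb0 _] := sb_itv.
apply/andP; split.
  by rewrite -(ler_pM2r sb0) ssb -rs; lra.
move: x31; rewrite rc rs.
have -> : (r * cos b) ^+ 2 + (r * sin b) ^+ 2 = r ^+ 2 * (cos b ^+ 2 + sin b ^+ 2).
  by ring.
by rewrite cos2Dsin2 mulr1 -[X in _ <= X](expr1n _ 2) ler_sqr ?nnegrE// ltW.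
Qed.

Lemma flux_bounded_half_sector : flux_bounded t half_sector half_sector_stream.
Proof.
have /andP[sb0 _] := sb_itv.
have dotE x : dot (sin b, - cos b) x - (cos b / 2 - q / 6 * sin b) = ray_side x.
  by rewrite /dot /ray_side /=; field.
apply: (@flux_bounded_glue _ t _ _ (sin b, - cos b) (cos b / 2 - q / 6 * sin b)) => //.
  apply: (@flux_bounded_eq _ t _ _ strip_stream).
    by move=> x [_ /=]; rewrite dotE /half_sector_stream => ->.
  apply: flux_bounded_strip => x [/half_sectorP[x10 x20 _ x31]] /=.
  rewrite dotE /ray_side => w0; rewrite ger0_norm// yJE lerBrDr.
  (* A point higher than [J] on this side of the ray would exceed [dir b] in both coordinates
     relative to the vertex, and so leave the unit disk. *)
  rewrite leNgt; apply/negP => h.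
  have h1 : sin b * cos b < (x.1 + q / 6) * sin b.
    by apply: lt_le_trans (_ : (x.2 + 1 / 2) * cos b <= _); [rewrite ltr_pM2r|lra].
  move: h1; rewrite [X in X < _]mulrC ltr_pM2r// => h1.
  have : cos b ^+ 2 < (x.1 + q / 6) ^+ 2.
    by rewrite ltr_sqr ?nnegrE ?ltW//; apply: lt_trans h1.
  have : sin b ^+ 2 < (x.2 + 1 / 2) ^+ 2.
    by rewrite ltr_sqr ?nnegrE ?ltW//; apply: lt_trans h.
  by have := cb2; lra.
apply: (@flux_bounded_eq _ t _ _ (fun x => if yJ <= x.2 then radial_stream x
  else Num.min (strip_stream x) (radial_stream x))).
  move=> x [hx /=]; rewrite dotE /half_sector_stream => w0.
  have [w1|//] := boolP (0 <= ray_side x).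
  have {w0 w1} w0 : ray_side x = 0 by apply/eqP; rewrite eq_le w0 w1.
  have [r r01 xE] := on_rayP hx w0.
  have [yJx|_] := leP yJ x.2.
    suff r1 : r = 1.
      have -> : x = (cos b - q / 6, yJ) by rewrite xE r1 yJE; congr (_, _); ring.
      exact: streams_eq_corner.
    apply/eqP; rewrite eq_le (andP r01).2 /= -(ler_pM2r sb0) mul1r.
    by move: yJx; rewrite xE yJE /=; lra.
  by rewrite min_l// xE; exact: strip_le_radial_ray.
apply: (@flux_bounded_glue _ t _ _ (0, 1) yJ).
- apply: segment_closedI => //; exact: segment_closed_le.
- apply: (@flux_bounded_eq _ t _ _ radial_stream).
    by move=> x [_ /=]; rewrite /dot /= mul0r add0r mul1r subr_ge0 => ->.
  apply: flux_bounded_radial.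
    by move=> x [[/half_sectorP[? ? ? ?] _] _].
  apply: segment_closedI; last exact: segment_closed_ge.
  by apply: segment_closedI => //; exact: segment_closed_le.
- apply: (@flux_bounded_eq _ t _ _
    (fun x => Num.min (strip_stream x) (radial_stream x))).
    move=> x [[/half_sectorP[x10 x20 _ _] /=]]; rewrite dotE /dot /= mul0r add0r mul1r.
    move=> w0; rewrite subr_le0 => x2J; have [yJx|//] := leP yJ x.2.
    have x2E : x.2 = yJ by apply/eqP; rewrite eq_le x2J yJx.
    rewrite min_r// (surjective_pairing x) x2E; apply: radial_le_strip_level => //.
    move: w0; rewrite /ray_side x2E yJE => w0.
    by rewrite -(ler_pM2r sb0); lra.
  apply: flux_bounded_min.
    apply: flux_bounded_strip => x [[/half_sectorP[_ x20 _ _] _] /=].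
    by rewrite /dot /= mul0r add0r mul1r subr_le0 ger0_norm.
  apply: flux_bounded_radial.
    by move=> x [[/half_sectorP[? ? ? ?] _] _].
  apply: segment_closedI; last exact: segment_closed_le.
  by apply: segment_closedI => //; exact: segment_closed_le.
Qed.

(** On the axis the radial stream starts at 0, increases while the squared distance to the vertex is
    at most [k], and decreases afterwards. At the far end it is nonnegative because it dominates the
    strip stream, which vanishes on the axis. *)
Let radial_ge0_axis (x : R) : 0 <= x -> x <= s * cos b - q / 6 ->
  0 <= radial_stream (x, 0).
Proof.
move=> x0 xe.
have [r20 kgt0] : (forall x : R, 0 < (x + q / 6) ^+ 2 + (1 / 2) ^+ 2) /\ 0 < k.
  split; first by move=> y; rewrite ltr_wpDl ?sqr_ge0// exprn_gt0.
  by move: t_itv; lra.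
pose f (x : R) := radial_stream (x, 0).
pose df (x : R) := - 1 / 4 + k / 4 / ((x + q / 6) ^+ 2 + (1 / 2) ^+ 2).
have f0 : f 0 = 0.
  rewrite /f /radial_stream /= !add0r.
  have -> : 1 / 2 / (q / 6) = tan (pi / 3 : R).
    have -> : 1 / 2 / (q / 6) = 3 / q by field; rewrite gt_eqF.
    by rewrite tan_pi3 -q2; field; rewrite gt_eqF.
  rewrite tanK ?subrr; first by rewrite !(mul0r, mulr0, subr0, oppr0, addr0).
  by rewrite in_itv/=; have := @pi_gt0 R; lra.
have fe : 0 <= f (s * cos b - q / 6).
  have /andP[s0 _] := s_itv.
  have := @strip_le_radial_ray s; rewrite lexx ssb subrr /=.
  have -> : s <= 1 by move: t_itv; rewrite tE; lra.
  move=> /(_ isT); apply: le_trans.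
  by rewrite /strip_stream /= quarter_area0 mulr0 mul0r subr0.
have dfE (y : R) : 0 <= y -> is_derive y 1 f (df y).
  move=> y0.
  have d1 : is_derive y 1 (fun x : R => x + q / 6) 1.
    by apply: is_derive_eq; rewrite addr0.
  have d3 := @is_derive_atan_div R (cst (1 / 2)) (fun x : R => x + q / 6) _ _ y
    (is_derive_cst _ _ _) d1.
  have {}d3 := d3 (lt0r_neq0 (_ : 0 < y + q / 6)).
  have {}d3 := d3 (ltr_wpDl y0 (divr_gt0 q0 (ltr0Sn _ _))).
  have -> : f = cst (k / 2 * (pi / 3)) - 4^-1 \*: id
      - (k / 2) \*: (fun x : R => atan (cst (1 / 2) x / (x + q / 6))).
    apply/funext => x' /=; rewrite /f /radial_stream /= !fctE /=.
    by rewrite /GRing.scale /= add0r; field.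
  apply: is_derive_eq; rewrite /GRing.scale /= /df; field.
  by rewrite gt_eqF// ltr_wpDl// mulr_ge0// sqr_ge0.
have fc u v : 0 <= u -> {within `[u, v], continuous f}.
  move=> u0; apply: derivable_within_continuous => y; rewrite in_itv/= => /andP[h _].
  by have [] := dfE y (le_trans u0 h).
rewrite -/(f x).
have [kr|kr] := leP ((x + q / 6) ^+ 2 + (1 / 2) ^+ 2) k.
  rewrite -f0; apply: (@ger0_increasing R f df 0 x x0).
  - by move=> y /andP[/ltW h _]; exact: dfE.
  - exact: fc.
  - move=> y /andP[h1 h2]; rewrite /df.
    have h3 : (y + q / 6) ^+ 2 + (1 / 2) ^+ 2 <= k.
      by apply: le_trans kr; rewrite lerD2r ler_sqr ?nnegrE; move: q0; lra.
    have : k / 4 / k <= k / 4 / ((y + q / 6) ^+ 2 + (1 / 2) ^+ 2).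
      by rewrite ler_pM2l ?divr_gt0// lef_pV2 ?posrE.
    have -> : k / 4 / k = 1 / 4 by field; rewrite gt_eqF.
    by lra.
apply: le_trans fe _; rewrite -lerN2.
apply: (@ger0_increasing R (fun x => - f x) (fun x => - df x) x _ xe).
- by move=> y /andP[h _]; apply: is_deriveN; apply: dfE; lra.
- apply: derivable_within_continuous => y; rewrite in_itv/= => /andP[h _].
  by apply: derivableN; have [] := dfE y (le_trans x0 h).
- move=> y /andP[h1 h2]; rewrite /df.
  have h3 : k <= (y + q / 6) ^+ 2 + (1 / 2) ^+ 2.
    by apply: (le_trans (ltW kr)); rewrite lerD2r ler_sqr ?nnegrE; move: q0; lra.
  have : k / 4 / ((y + q / 6) ^+ 2 + (1 / 2) ^+ 2) <= k / 4 / k.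
    by rewrite ler_pM2l ?divr_gt0// lef_pV2 ?posrE.
  have -> : k / 4 / k = 1 / 4 by field; rewrite gt_eqF.
  by lra.
Qed.

(** This makes the odd reflection across the axis consistent. *)
Lemma half_sector_stream_axis x : half_sector x -> x.2 = 0 ->
  half_sector_stream x = 0.
Proof.
move=> /half_sectorP[x10 _ _ _] x2; rewrite /half_sector_stream.
have V0 : strip_stream x = 0.
  by rewrite /strip_stream x2 quarter_area0 mulr0 mul0r subr0.
case: ifPn => // w0; rewrite V0 x2 leNgt (andP yJ_itv).1 /= min_l//.
rewrite (surjective_pairing x) x2; apply: radial_ge0_axis => //.
move: w0; rewrite -ltNge /ray_side x2 add0r => w0.
have /andP[sb0 _] := sb_itv.
by rewrite -(ler_pM2r sb0) mulrBl mulrAC ssb; lra.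
Qed.

(** This line passes through the vertex at angle [pi / 3], the angle at which the radial stream is
    normalised to vanish. Where the minimum is taken, the strip stream has to be nonnegative on the
    line, and [sin b ^+ 2 <= 1 / 2] provides that. The common value 0 lets the rotated copies fit
    together. *)
Lemma half_sector_stream_diagonal x : half_sector x -> x.2 = q * x.1 ->
  half_sector_stream x = 0.
Proof.
move=> /half_sectorP[x10 x20 _ x31] x2; rewrite /half_sector_stream.
have p0 : 0 < x.1 + q / 6 by rewrite ltr_wpDl// divr_gt0.
have e : x.2 + 1 / 2 = q * (x.1 + q / 6).
  by rewrite x2 mulrDr mulrA -expr2 q2; congr (_ + _); lra.
have sc : sin b < q * cos b.
  rewrite ltNge; apply/negP => h; have := cb2; have := sb2.
  have : (q * cos b) ^+ 2 <= sin b ^+ 2.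
    by rewrite ler_sqr ?nnegrE ?mulr_ge0// ltW// (andP sb_itv).1.
  by rewrite exprMn q2; lra.
have -> : (0 <= ray_side x) = false.
  apply/negbTE; rewrite -ltNge /ray_side e.
  have -> : (x.1 + q / 6) * sin b - q * (x.1 + q / 6) * cos b =
    - ((x.1 + q / 6) * (q * cos b - sin b)) by ring.
  by rewrite oppr_lt0 mulr_gt0// subr_gt0.
have A0 : radial_stream x = 0.
  rewrite /radial_stream e mulfK ?gt_eqF//.
  rewrite -[X in atan X]tan_pi3 tanK ?subrr ?mulr0 ?addr0; last first.
    by rewrite in_itv/=; have := @pi_gt0 R; lra.
  have -> : q / 6 * x.2 = q ^+ 2 * x.1 / 6 by rewrite x2; field.
  by rewrite q2; field.
rewrite A0; case: ifPn => //; rewrite -ltNge => yJx.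
suff V0 : 0 <= strip_stream x by rewrite min_r.
have -> : strip_stream x = quarter_area t x.2 - q / 6 * x.2 ^+ 2.
  rewrite /strip_stream; congr (_ - _); rewrite x2.
  by transitivity (q ^+ 2 * (q * x.1 ^+ 2) / 6); [rewrite q2|]; field.
pose f (y : R) := quarter_area t y - q / 6 * y ^+ 2.
have t0 : 0 < t by have /andP[] := t_itv.
have dfE (y : R) : 0 <= y <= x.2 -> is_derive y 1 f (Num.sqrt (t ^+ 2 - y ^+ 2) - q / 3 * y).
  move=> /andP[y0 y1]; have yt : `|y| < t.
    by rewrite ger0_norm//; move: yJ_itv; lra.
  have d3 := is_derive_quarter_area t0 yt.
  have -> : f = quarter_area t - (q / 6) \*: (id ^+ 2) by [].
  by apply: is_derive_eq; rewrite /GRing.scale /=; field.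
rewrite -/(f x.2); have <- : f 0 = 0 by rewrite /f quarter_area0 expr0n mulr0 subr0.
apply: (@ger0_increasing R f (fun y => Num.sqrt (t ^+ 2 - y ^+ 2) - q / 3 * y) 0 _ x20).
- by move=> y /andP[h1 h2]; apply: dfE; rewrite !ltW.
- apply: derivable_within_continuous => y; rewrite in_itv/= => h.
  by have [] := dfE y h.
- move=> y /andP[y0 y1]; rewrite subr_ge0.
  have q3 : 0 <= q / 3 * y by rewrite mulr_ge0// divr_ge0// ltW.
  rewrite -[q / 3 * y]ger0_norm// -sqrtr_sqr ler_wsqrtr//.
  have -> : (q / 3 * y) ^+ 2 = y ^+ 2 / 3.
    by transitivity (q ^+ 2 * y ^+ 2 / 9); [|rewrite q2]; field.
  have yy : y ^+ 2 <= yJ ^+ 2.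
    by rewrite ler_sqr ?nnegrE//; [lra|rewrite ltW// (andP yJ_itv).1].
  have : yJ ^+ 2 <= t ^+ 2 * (1 / 2) by rewrite exprMn ler_wpM2l ?sqr_ge0.
  by have := sqr_ge0 y; have := sqr_ge0 t; lra.
Qed.

Definition sector_stream (x : R * R) : R :=
  if 0 <= x.2 then half_sector_stream x else - half_sector_stream (x.1, - x.2).

(* The rotation by [- 2 * pi / 3]. *)
Definition turn (x : R * R) : R * R :=
  (- (x.1 / 2) + q / 2 * x.2, - (q / 2 * x.1) - x.2 / 2).

(** The sector of angle [2 * pi / 3] about the positive axis, expressed by comparing first
    coordinates of [x] and its rotations, so that applying [turn] only permutes the comparisons. *)
Definition third_sector : set (R * R) :=
  std_reuleaux `&` [set x | (turn x).1 <= x.1 /\ (turn (turn x)).1 <= x.1].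

Definition reuleaux_stream (x : R * R) : R :=
  if `[< third_sector x >] then sector_stream x
  else if `[< third_sector (turn x) >] then sector_stream (turn x)
  else sector_stream (turn (turn x)).

Let turn3 x : turn (turn (turn x)) = x.
Proof.
have qq : q * q = 3 by rewrite -expr2.
rewrite [RHS]surjective_pairing /turn /=; congr (_, _).
  transitivity (x.1 * ((- 1 + 3 * (q * q)) / 8) + x.2 * (q * (3 - q * q)) / 8).
    by field.
  by rewrite qq; field.
transitivity (x.2 * ((- 1 + 3 * (q * q)) / 8) + x.1 * (q * (q * q - 3)) / 8).
  by field.
by rewrite qq; field.
Qed.

Let dot_turn x : dot (turn x) (turn x) = dot x x.
Proof.
rewrite /dot /turn /=.
transitivity ((1 + q ^+ 2) / 4 * (x.1 * x.1 + x.2 * x.2)); first by field.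
by rewrite q2; field.
Qed.

Let turnB x y : turn (x - y) = turn x - turn y.
Proof. by rewrite /turn /=; congr (_, _) => /=; field. Qed.

Let edist_turn x y : edist (turn x) (turn y) = edist x y.
Proof. by rewrite /edist -turnB /enorm dot_turn. Qed.

Let wedge_turn x y : wedge (turn x) (turn y) = wedge x y.
Proof.
rewrite /wedge /turn /=.
transitivity ((1 + q ^+ 2) / 4 * (x.1 * y.2 - x.2 * y.1)); first by field.
by rewrite q2; field.
Qed.

Let turn2_1 x : (turn (turn x)).1 = - x.1 - (turn x).1.
Proof.
rewrite /turn /=.
transitivity (x.1 * ((1 - q ^+ 2) / 4) - q / 2 * x.2); first by field.
by rewrite q2; field.
Qed.

Let std_turn x : std_reuleaux x -> std_reuleaux (turn x).
Proof.
have t0 : turn (q / 3, 0) = (- (q / 6), - (1 / 2)).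
  rewrite /turn /=; congr (_, _); first by field.
  by transitivity (- (q ^+ 2) / 6); [field|rewrite q2; field].
have t1 : turn (- (q / 6), 1 / 2) = (q / 3, 0).
  rewrite /turn /=; congr (_, _); first by field.
  by transitivity (q ^+ 2 / 12 - 1 / 4); [field|rewrite q2; field].
have t2 : turn (- (q / 6), - (1 / 2)) = (- (q / 6), 1 / 2).
  rewrite /turn /=; congr (_, _); first by field.
  by transitivity (q ^+ 2 / 12 + 1 / 4); [field|rewrite q2; field].
move=> [h0 h1 h2]; split.
- by rewrite -t1 edist_turn.
- by rewrite -t2 edist_turn.
- by rewrite -t0 edist_turn.
Qed.

Let sectorE x : (third_sector x) = (std_reuleaux x /\ `|x.2| <= q * x.1).
Proof.
have h1 : ((turn x).1 <= x.1) = (x.2 <= q * x.1).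
  rewrite /turn /= -(ler_pM2l (_ : 0 < 2 * q))//; last by rewrite mulr_gt0.
  have -> : 2 * q * (- (x.1 / 2) + q / 2 * x.2) = - (q * x.1) + q ^+ 2 * x.2 by field.
  by rewrite q2; apply/idP/idP; lra.
have h2 : ((turn (turn x)).1 <= x.1) = (- x.2 <= q * x.1).
  rewrite turn2_1 /turn /= -(ler_pM2l (_ : 0 < 2 * q))//; last by rewrite mulr_gt0.
  have -> : 2 * q * (- x.1 - (- (x.1 / 2) + q / 2 * x.2)) =
     - (q * x.1) - q ^+ 2 * x.2 by field.
  by rewrite q2; apply/idP/idP; lra.
rewrite /third_sector /setI /= h1 h2 ler_norml; apply/propext; split.
  by move=> [? [? ?]]; split => //; apply/andP; split; lra.
by move=> [? /andP[? ?]]; do !split => //; lra.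
Qed.

Let std_mirror (x : R * R) : std_reuleaux x -> std_reuleaux (x.1, - x.2).
Proof.
have m (a : R * R) : edist (x.1, - x.2) (a.1, - a.2) = edist x a.
  rewrite /edist /enorm; congr Num.sqrt; rewrite /dot /=; ring.
move=> [h0 h1 h2]; split.
- by move: h0; rewrite -(m (q / 3, 0)) /= oppr0.
- by rewrite -(m (- (q / 6), - (1 / 2))) /= opprK in h2.
- by rewrite -(m (- (q / 6), 1 / 2)) /= in h1.
Qed.

Let half_of_sector (x : R * R) : third_sector x -> 0 <= x.2 -> half_sector x.
Proof. by rewrite sectorE => -[Tx] + x2; rewrite ger0_norm. Qed.

Let half_of_sectorN (x : R * R) : third_sector x -> x.2 <= 0 -> half_sector (x.1, - x.2).
Proof.
rewrite sectorE => -[Tx] + x2; rewrite ler0_norm// => h.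
by split; [exact: std_mirror|split => //=; rewrite oppr_ge0].
Qed.

Let sector_streamN (x : R * R) : third_sector x -> x.2 <= 0 ->
  sector_stream x = - half_sector_stream (x.1, - x.2).
Proof.
move=> Sx x2; rewrite /sector_stream; case: ifPn => // x20.
have {}x2 : x.2 = 0 by apply/eqP; rewrite eq_le x2 x20.
rewrite (half_sector_stream_axis (half_of_sector Sx x20) x2).
have x2' : x.2 <= 0 by rewrite x2.
by rewrite (half_sector_stream_axis (half_of_sectorN Sx x2'))/= ?x2 ?oppr0.
Qed.

Let segment_closed_sector : segment_closed third_sector.
Proof.
move=> x y l /andP[l0 l1]; rewrite !sectorE => -[Tx hx] [Ty hy]; split.
  by apply: segment_closed_std => //; rewrite l0.
have l1' : 0 <= 1 - l by lra.
have := ler_wpM2l l0 hy; have := ler_wpM2l l1' hx.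
rewrite /= /GRing.scale /= => h1 h2.
have -> : x.2 + l * (y.2 - x.2) = (1 - l) * x.2 + l * y.2 by ring.
apply: le_trans (ler_normD _ _) _; rewrite !normrM (ger0_norm l0) (ger0_norm l1').
by lra.
Qed.

Lemma flux_bounded_sector : flux_bounded t third_sector sector_stream.
Proof.
apply: (@flux_bounded_glue _ t _ _ (0, 1) 0) => //.
  move=> x y [Sx /=] + [Sy /=]; rewrite /dot /= !mul0r !add0r !mul1r !subr0 => x2 y2.
  rewrite /sector_stream x2 y2; apply: flux_bounded_half_sector.
    exact: half_of_sector.
  exact: half_of_sector.
move=> x y [Sx /=] + [Sy /=]; rewrite /dot /= !mul0r !add0r !mul1r !subr0 => x2 y2.
rewrite !sector_streamN//.
(* The mirror changes the sign of [wedge] and the extension is odd, so the bound is used for the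
   mirrored points in the opposite order. *)
have := flux_bounded_half_sector (half_of_sectorN Sy y2) (half_of_sectorN Sx x2).
have -> : edist (y.1, - y.2) (x.1, - x.2) = edist x y.
  by rewrite edistC /edist /enorm; congr Num.sqrt; rewrite /dot /=; ring.
by rewrite /wedge /=; lra.
Qed.

Let sector_stream_edge x : third_sector x ->
  (turn x).1 = x.1 \/ (turn (turn x)).1 = x.1 -> sector_stream x = 0.
Proof.
move=> Sx; have := Sx; rewrite sectorE => -[Tx nx].
have x10 : 0 <= x.1 by rewrite -(pmulr_rge0 _ q0); apply: le_trans nx.
rewrite turn2_1 /turn /= => -[] e.
  have e2 : x.2 = q * x.1.
    apply: (mulfI (lt0r_neq0 q0)).
    have -> : q * x.2 = 3 * x.1 by lra.
    by rewrite mulrA -expr2 q2.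
  have x20 : 0 <= x.2 by rewrite e2 mulr_ge0// ltW.
  rewrite /sector_stream x20; apply: half_sector_stream_diagonal => //.
  exact: half_of_sector.
have e2 : - x.2 = q * x.1.
  apply: (mulfI (lt0r_neq0 q0)).
  have -> : q * - x.2 = 3 * x.1 by lra.
  by rewrite mulrA -expr2 q2.
have x20 : x.2 <= 0 by rewrite -oppr_ge0 e2 mulr_ge0// ltW.
rewrite sector_streamN// half_sector_stream_diagonal ?oppr0//.
exact: half_of_sectorN.
Qed.

Let sector_ineq x : third_sector x -> (turn x).1 <= x.1 /\ (turn (turn x)).1 <= x.1.
Proof. by case. Qed.

Let sectorI x : std_reuleaux x -> (turn x).1 <= x.1 -> (turn (turn x)).1 <= x.1 ->
  third_sector x.
Proof. by move=> Tx h1 h2; split. Qed.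

Let reuleaux_stream0 x : third_sector x -> reuleaux_stream x = sector_stream x.
Proof. by move=> Sx; rewrite /reuleaux_stream; case: asboolP. Qed.

(** A point claimed by two sectors lies on a common edge, where both candidate values are 0; hence
    the order of the tests in [reuleaux_stream] is immaterial. *)
Let reuleaux_stream1 x : third_sector (turn x) -> reuleaux_stream x = sector_stream (turn x).
Proof.
move=> Sx; rewrite /reuleaux_stream; case: asboolP => S0; last by case: asboolP.
have [h1 h2] := sector_ineq Sx; have [h3 h4] := sector_ineq S0.
have e : (turn x).1 = x.1 by apply/eqP; rewrite eq_le h3 -{1}(turn3 x) h2.
rewrite !sector_stream_edge//; first by right; rewrite turn3.
by left.
Qed.

Let reuleaux_stream2 x : third_sector (turn (turn x)) ->
  reuleaux_stream x = sector_stream (turn (turn x)).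
Proof.
move=> Sx; rewrite /reuleaux_stream; have [h1 h2] := sector_ineq Sx.
rewrite turn3 in h1 h2.
case: asboolP => [S0|_].
  have [h3 h4] := sector_ineq S0.
  have e : (turn (turn x)).1 = x.1 by apply/eqP; rewrite eq_le h4 h1.
  rewrite !sector_stream_edge//; first by left; rewrite turn3.
  by right.
case: asboolP => // S1; have [h3 h4] := sector_ineq S1.
have e : (turn (turn x)).1 = (turn x).1 by apply/eqP; rewrite eq_le h3 h2.
rewrite !sector_stream_edge//; last by left.
by right; rewrite turn3.
Qed.

Lemma flux_bounded_reuleaux : flux_bounded t std_reuleaux reuleaux_stream.
Proof.
have g0 : flux_bounded t third_sector reuleaux_stream.
  exact: flux_bounded_eq reuleaux_stream0 flux_bounded_sector.
have g1 : flux_bounded t [set x | third_sector (turn x)] reuleaux_stream.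
  move=> x y /= Sx Sy; rewrite !reuleaux_stream1// -edist_turn -wedge_turn.
  exact: flux_bounded_sector.
have g2 : flux_bounded t [set x | third_sector (turn (turn x))] reuleaux_stream.
  move=> x y /= Sx Sy; rewrite !reuleaux_stream2// -edist_turn -wedge_turn.
  by rewrite -edist_turn -wedge_turn; exact: flux_bounded_sector.
(* Three lines through the centre: the sign of each form compares two of the first coordinates of
   [x], [turn x] and [turn (turn x)]. *)
pose a01 : R * R := (3 / 2, - (q / 2)).
pose a02 : R * R := (3 / 2, q / 2).
pose a12 : R * R := (0, q).
have d01 x : dot a01 x - 0 = x.1 - (turn x).1.
  by rewrite /dot /turn /=; field.
have d02 x : dot a02 x - 0 = x.1 - (turn (turn x)).1.
  by rewrite turn2_1 /dot /turn /=; field.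
have d12 x : dot a12 x - 0 = (turn x).1 - (turn (turn x)).1.
  by rewrite turn2_1 /dot /turn /=; field.
apply: (@flux_bounded_glue _ t _ _ a01 0) => //.
  apply: (@flux_bounded_glue _ t _ _ a02 0).
  - by apply: segment_closedI => //; exact: segment_closed_ge.
  - apply: flux_bounded_sub g0 => x [[Tx /=]]; rewrite d01 d02 !subr_ge0.
    by move=> h1 h2; split.
  - apply: flux_bounded_sub g2 => x [[Tx /=]]; rewrite d01 d02 subr_ge0 subr_le0.
    move=> h1 h2; apply: sectorI; rewrite ?turn3//; first by do 2 apply: std_turn.
    by apply: le_trans h2.
apply: (@flux_bounded_glue _ t _ _ a12 0).
- by apply: segment_closedI => //; exact: segment_closed_le.
- apply: flux_bounded_sub g1 => x [[Tx /=]]; rewrite d01 d12 subr_ge0 subr_le0.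
  by move=> h1 h2; apply: sectorI; rewrite ?turn3//; exact: std_turn.
- apply: flux_bounded_sub g2 => x [[Tx /=]]; rewrite d01 d12 !subr_le0.
  move=> h1 h2; apply: sectorI; rewrite ?turn3//; first by do 2 apply: std_turn.
  by apply: le_trans h2.
Qed.

End SharpStream.

(** * Smoothing by averages *)

Lemma is_derive_addl (R : realType) (y x : R) : is_derive x 1 (fun u : R => y + u) 1.
Proof.
have -> : (fun u : R => y + u) = cst y + id by [].
by apply: is_derive_eq; rewrite add0r.
Qed.

Lemma is_derive_addr (R : realType) (y x : R) : is_derive x 1 (fun u : R => u + y) 1.
Proof.
have -> : (fun u : R => u + y) = id + cst y by [].
by apply: is_derive_eq; rewrite addr0.
Qed.

Lemma continuous_pairr (R : realType) (u : R) : continuous (fun v : R => (u, v)).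
Proof.
move=> v.
have := @cvg_pair R R R (nbhs v) (nbhs u) (nbhs v) _ _ _ (fun=> u) id (cvg_cst _) cvg_id.
exact.
Qed.

Lemma continuous_pairl (R : realType) (v : R) : continuous (fun u : R => (u, v)).
Proof.
move=> u.
have := @cvg_pair R R R (nbhs u) (nbhs u) (nbhs v) _ _ _ id (fun=> v) cvg_id (cvg_cst _).
exact.
Qed.

Lemma continuous_slice1 (R : realType) (h : R * R -> R) u : continuous h ->
  continuous (fun v => h (u, v)).
Proof.
by move=> ch v; apply: continuous_comp; [exact: continuous_pairr|exact: ch].
Qed.

Lemma continuous_slice2 (R : realType) (h : R * R -> R) v : continuous h ->
  continuous (fun u => h (u, v)).
Proof.
move=> ch u; apply: (@continuous_comp _ _ _ (fun u => (u, v))).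
  exact: continuous_pairl.
exact: ch.
Qed.

Section PlaneMeasure.
Context {R : realType}.
Local Notation mu := (@lebesgue_measure R).
Local Notation RR := (measurableTypeR R * measurableTypeR R)%type.

(** The sigma-algebra is generated by rectangles, so [O] is exhibited as the union of the countably
    many rational boxes that it contains. *)
Lemma open_measurable_plane (O : set (R * R)) : open O ->
  @measurable _ RR O.
Proof.
move=> oO.
pose box (i : (rat * rat) * (rat * rat)) : set (R * R) :=
  `]ratr i.1.1, ratr i.1.2[ `*` `]ratr i.2.1, ratr i.2.2[.
pose G i := if `[< box i `<=` O >] then box i else set0.
have -> : O = \bigcup_i G i.
  apply/seteqP; split => [x Ox|x [i _]]; last first.
    by rewrite /G; case: asboolP => // h; exact: h.
  have /nbhs_ballP[e /= e0 xeO] : nbhs x O by exact: open_nbhs_nbhs.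
  have rat_near (y : R) : exists p q : rat, [/\ ratr p < y, y < ratr q,
      y - e < ratr p & ratr q < y + e].
    have /rat_in_itvoo[p] : y - e < y by rewrite ltrBlDr ltrDl.
    have /rat_in_itvoo[q] : y < y + e by rewrite ltrDl.
    by rewrite !in_itv/= => /andP[? ?] /andP[? ?]; exists p, q.
  have [p1 [q1 [h1 h2 h3 h4]]] := rat_near x.1.
  have [p2 [q2 [k1 k2 k3 k4]]] := rat_near x.2.
  have bO : box ((p1, q1), (p2, q2)) `<=` O.
    move=> y [/=]; rewrite !in_itv/= => /andP[a1 a2] /andP[a3 a4].
    by apply: xeO; split; rewrite /ball/= ltr_norml; apply/andP; split; lra.
  exists ((p1, q1), (p2, q2)) => //; rewrite /G; case: asboolP => // _.
  by split; rewrite /= in_itv/= ?h1 ?h2 ?k1 ?k2.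
apply: countable_bigcupT_measurable; first exact: countableP.
move=> i; rewrite /G; case: asboolP => // _.
by apply: measurableX; exact: measurable_itv.
Qed.

Lemma continuous_measurable_plane (f : R * R -> R) : continuous f ->
  measurable_fun [set: RR] f.
Proof.
move=> cf; apply: (measurability _ (RGenOpens.measurableE R)) => //.
move=> _ [_ [a [b ->] <-]]; rewrite setTI.
apply: open_measurable_plane; apply: open_comp; last exact: interval_open.
by move=> x _; exact: cf.
Qed.

End PlaneMeasure.

Section Averages.
Context {R : realType}.
Local Notation mu := (@lebesgue_measure R).
Local Notation RR := (measurableTypeR R * measurableTypeR R)%type.
Variable eta : R.
Hypothesis eta_gt0 : 0 < eta.
Implicit Types (g h : R -> R).

(** Averaging over a one-sided interval, rather than against a smooth kernel, makes the derivative
    of an average an explicit difference quotient; each further average gains one derivative. *)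
Definition avg g : R := eta^-1 * (\int[mu]_(u in `[0%R, eta]) g u)%R.

Let integrable_avg g : continuous g -> mu.-integrable `[0%R, eta] (EFin \o g).
Proof.
move=> cg; apply: continuous_compact_integrable; first exact: segment_compact.
exact: continuous_subspaceT.
Qed.

Let mI : measurable (`[0%R, eta] : set (measurableTypeR R)).
Proof. exact: measurable_itv. Qed.

Lemma avg_le g h : continuous g -> continuous h ->
  (forall u, 0 <= u <= eta -> g u <= h u) -> avg g <= avg h.
Proof.
move=> cg ch gh; rewrite /avg ler_pM2l ?invr_gt0//.
by apply: le_Rintegral; [by []|exact: integrable_avg..|].
Qed.

Lemma avgB g h : continuous g -> continuous h ->
  avg (fun u => g u - h u) = avg g - avg h.
Proof.
move=> cg ch; rewrite /avg RintegralB ?mulrBr//; exact: integrable_avg.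
Qed.

Lemma avg_cst r : avg (fun=> r) = r.
Proof.
have muI : mu `[0%R, eta]%classic = eta%:E.
  by rewrite lebesgue_measure_itv/= lte_fin eta_gt0 -EFinB subr0.
by rewrite /avg Rintegral_cst//= muI /= mulrCA mulVf ?mulr1// gt_eqF.
Qed.

Lemma is_derive_avg g (x : R) : continuous g ->
  is_derive x 1 (fun x : R => avg (fun u => g (x + u))) (eta^-1 * (g (x + eta) - g x)).
Proof.
(* The interval from [a] to [b] is wide enough for the primitive [G] to be differentiable on all of
   [[y, y + eta]] whenever [y] is within 1 of [x]. *)
move=> cg; pose a := x - 1; pose b := x + eta + 2.
pose G y := (\int[mu]_(u in `[a, y]) g u)%R.
have Gd (y : R) : a < y < b -> is_derive y 1 G (g y).
  move=> /andP[ay yb].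
  have ig : mu.-integrable `[a, b] (EFin \o g).
    apply: continuous_compact_integrable; first exact: segment_compact.
    exact: continuous_subspaceT.
  have [d1 d2] := @continuous_FTC1_closed R g a y b yb ig ay (cg y).
  by apply: DeriveDef; [exact: d1|rewrite -derive1E; exact: d2].
have Gavg y : x - 1 < y < x + 1 -> avg (fun u => g (y + u)) = eta^-1 * (G (y + eta) - G y).
  move=> /andP[y1 y2]; congr (_ * _).
  have Gs (u : R) : 0 <= u <= eta -> is_derive u 1 (fun u : R => G (y + u)) (g (y + u)).
    move=> /andP[u0 u1].
    have d1 := is_derive_addl y u.
    have d2 : is_derive (y + u) 1 G (g (y + u)) by apply: Gd; rewrite /a /b; lra.
    have := @is_derive1_comp R G (fun u : R => y + u) u _ _ d2 d1.
    by rewrite mulr1.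
  have Gc (u : R) : 0 <= u <= eta -> {for u, continuous (fun u : R => G (y + u))}.
    move=> u01; have [d _] := Gs u u01.
    by apply: differentiable_continuous; exact/derivable1_diffP.
  rewrite /Rintegral (@continuous_FTC2 R (fun u => g (y + u)) (fun u => G (y + u))) //.
  - by rewrite -EFinB /= addr0.
  - apply: continuous_subspaceT => u.
    apply: (@continuous_comp _ _ _ (fun u => y + u)); last exact: cg.
    by apply: cvgD; [exact: cvg_cst|exact: cvg_id].
  - split.
    + by move=> u; rewrite in_itv/= => /andP[u0 u1]; have [] := Gs u _; rewrite ?ltW.
    + by apply: cvg_at_right_filter; apply: Gc; rewrite lexx ltW.
    + by apply: cvg_at_left_filter; apply: Gc; rewrite lexx ltW.
  - move=> u; rewrite in_itv/= => /andP[u0 u1].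
    have u01 : 0 <= u <= eta by rewrite !ltW.
    by rewrite derive1E; have [_ ->] := Gs u u01.
have e0 := eta_gt0.
have d0 : is_derive x 1 (fun y : R => eta^-1 * (G (y + eta) - G y))
    (eta^-1 * (g (x + eta) - g x)).
  have dx : is_derive x 1 G (g x) by apply: Gd; rewrite /a /b; lra.
  have d2 : is_derive (x + eta) 1 G (g (x + eta)) by apply: Gd; rewrite /a /b; lra.
  have d1 := is_derive_addr eta x.
  have d3 := @is_derive1_comp R G (fun u : R => u + eta) x _ _ d2 d1.
  have -> : (fun y => eta^-1 * (G (y + eta) - G y)) =
    eta^-1 \*: ((G \o (fun u : R => u + eta)) - G) by [].
  by apply: is_derive_eq; rewrite mulr1.
apply: near_eq_is_derive d0.
near=> y; apply/esym/Gavg.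
suff : y \in `]x - 1, x + 1[ by rewrite in_itv.
near: y; apply: near_in_itvoo; rewrite in_itv/=; apply/andP; split; lra.
Unshelve. all: by end_near. Qed.

Local Notation II := (`[0%R, eta] `*` `[0%R, eta] : set (R * R)).

Let integrable_square (h : R * R -> R) : continuous h ->
  (mu \x mu)%E.-integrable II (EFin \o h).
Proof.
move=> ch.
have mII : measurable (II : set RR) by exact: measurableX.
apply: measurable_bounded_integrable => //.
- apply: (@le_lt_trans _ _ (mu `[0%R, eta]%classic * mu `[0%R, eta]%classic)%E).
    by rewrite -(product_measure1E mu mu).
  rewrite !lebesgue_measure_itv/= lte_fin eta_gt0.
  by rewrite -EFinB -EFinM ltry.
- exact: measurable_funTS (continuous_measurable_plane ch).
- have cII : compact II by apply: compact_setX; exact: segment_compact.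
  have := compact_bounded (continuous_compact (continuous_subspaceT ch) cII).
  move=> [M [Mr MP]]; exists M; split => // x Mx y IIy.
  by apply: MP => //; exists y.
Qed.

Let Rintegral_Fubini (h : R * R -> R) : continuous h ->
  (\int[mu]_(u in `[0%R, eta]) \int[mu]_(v in `[0%R, eta]) h (u, v) =
   \int[mu]_(v in `[0%R, eta]) \int[mu]_(u in `[0%R, eta]) h (u, v))%R.
Proof.
move=> ch; have ih := integrable_square ch.
have mII : measurable (II : set RR) by exact: measurableX.
move/(@integrable_mkcond _ _ _ _ _ _ mII) in ih.
have := Fubini ih; set k := _ \_ _.
have -> : (\int[mu]_x \int[mu]_y k (x, y) =
   \int[mu]_(u in `[0%R, eta]) (\int[mu]_(v in `[0%R, eta]) h (u, v))%:E)%E.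
  rewrite [RHS]integral_mkcond; apply: eq_integral => u _ /=.
  rewrite patchE; case: ifPn => uI.
    rewrite /Rintegral fineK; last first.
      by apply: integrable_fin_num => //; exact: (integrable_avg (@continuous_slice1 R h u ch)).
    rewrite [RHS]integral_mkcond; apply: eq_integral => v _.
    by rewrite /k !patchE in_setX uI.
  apply: integral0_eq => v _; rewrite /k patchE in_setX.
  by rewrite (negbTE uI).
have -> : (\int[mu]_y \int[mu]_x k (x, y) =
   \int[mu]_(v in `[0%R, eta]) (\int[mu]_(u in `[0%R, eta]) h (u, v))%:E)%E.
  rewrite [RHS]integral_mkcond; apply: eq_integral => v _ /=.
  rewrite patchE; case: ifPn => vI.
    rewrite /Rintegral fineK; last first.
      by apply: integrable_fin_num => //; exact: (integrable_avg (@continuous_slice2 R h v ch)).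
    rewrite [RHS]integral_mkcond; apply: eq_integral => u _.
    by rewrite /k !patchE in_setX vI andbT.
  apply: integral0_eq => u _; rewrite /k patchE in_setX.
  by rewrite (negbTE vI) andbF.
by rewrite /Rintegral => ->.
Qed.

Lemma avg_Fubini (h : R * R -> R) : continuous h ->
  avg (fun u => avg (fun v => h (u, v))) = avg (fun v => avg (fun u => h (u, v))).
Proof.
move=> ch; rewrite /avg; congr (_ * _).
have ch' : continuous (fun z => eta^-1 * h z).
  by move=> z; apply: cvgM; [exact: cvg_cst|exact: ch].
transitivity (\int[mu]_(u in `[0%R, eta]) \int[mu]_(v in `[0%R, eta]) (eta^-1 * h (u, v)))%R.
  apply: eq_Rintegral => u _; apply/esym/RintegralZl => //.
  exact: (integrable_avg (@continuous_slice1 R h u ch)).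
rewrite (Rintegral_Fubini ch').
apply: eq_Rintegral => u _; apply/RintegralZl => //.
exact: (integrable_avg (@continuous_slice2 R h u ch)).
Qed.

End Averages.

(** * Functions of class C1 with explicit partial derivatives *)

Section Partials.
Context {R : realType}.
Implicit Types (f g : R * R -> R) (x : R * R).

(** Keeping the derivatives as explicit functions lets sums, products and compositions be
    differentiated by formula; [C1] and the directional derivatives are read off at the end. *)
Definition partials f (f1 f2 : R * R -> R) : Prop :=
  [/\ continuous f, continuous f1, continuous f2,
    forall x, is_derive x.1 1 (fun u => f (u, x.2)) (f1 x) &
    forall x, is_derive x.2 1 (fun v => f (x.1, v)) (f2 x)].

Let is_derive_line f x (v : R * R) (df : R) :
  is_derive (0 : R) 1 (fun h : R => f (x + h *: v)) df -> is_derive x v f df.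
Proof.
move=> [d1 d2].
have e : (fun h : R => h^-1 *: ((f \o shift x) (h *: v) - f x)) =
  (fun h : R => h^-1 *: (((fun h : R => f (x + h *: v)) \o shift 0) (h *: 1) - f (x + 0 *: v))).
  apply/funext => h /=; rewrite scale0r !addr0 [x + _]addrC.
  by rewrite /GRing.scale /= mulr1.
apply: DeriveDef.
  by move: d1; rewrite /derivable /= e scale0r addr0.
by move: d2; rewrite /derive /= e scale0r addr0.
Qed.

Lemma partials_derive f f1 f2 : partials f f1 f2 -> forall x,
  is_derive x e1 f (f1 x) /\ is_derive x e2 f (f2 x).
Proof.
move=> [_ _ _ d1 d2] x; split; apply: is_derive_line.
  have h1 := is_derive_addl x.1 (0 : R).
  have h2 : is_derive (x.1 + 0) 1 (fun u => f (u, x.2)) (f1 x) by rewrite addr0.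
  have := @is_derive1_comp R (fun u => f (u, x.2)) (fun h => x.1 + h) 0 _ _ h2 h1.
  rewrite mulr1.
  have -> // : (fun u : R => f (u, x.2)) \o (fun h : R => x.1 + h) =
     (fun h : R => f (x + h *: e1)).
  apply/funext => h /=; congr f.
  by rewrite [RHS]surjective_pairing /= /GRing.scale /= mulr1 mulr0 addr0.
have h1 := is_derive_addl x.2 (0 : R).
have h2 : is_derive (x.2 + 0) 1 (fun u => f (x.1, u)) (f2 x) by rewrite addr0.
have := @is_derive1_comp R (fun u => f (x.1, u)) (fun h => x.2 + h) 0 _ _ h2 h1.
rewrite mulr1.
have -> // : (fun u : R => f (x.1, u)) \o (fun h : R => x.2 + h) =
   (fun h : R => f (x + h *: e2)).
apply/funext => h /=; congr f.
by rewrite [RHS]surjective_pairing /= /GRing.scale /= mulr1 mulr0 addr0.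
Qed.

Lemma partials_D1 f f1 f2 x : partials f f1 f2 -> 'D_e1 f x = f1 x.
Proof. by move=> /partials_derive/(_ x)[[_ ->]]. Qed.

Lemma partials_D2 f f1 f2 x : partials f f1 f2 -> 'D_e2 f x = f2 x.
Proof. by move=> /partials_derive/(_ x)[_ [_ ->]]. Qed.

Lemma partials_C1 f f1 f2 : partials f f1 f2 -> C1 f.
Proof.
move=> pf v [->|->]; split.
- by move=> x; have [[]] := partials_derive pf x.
- have -> : (fun x => 'D_e1 f x) = f1 by apply/funext => x; exact: partials_D1 pf.
  by case: pf.
- by move=> x; have [_ []] := partials_derive pf x.
- have -> : (fun x => 'D_e2 f x) = f2 by apply/funext => x; exact: partials_D2 pf.
  by case: pf.
Qed.

Lemma partialsD f f1 f2 g g1 g2 : partials f f1 f2 -> partials g g1 g2 ->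
  partials (fun x => f x + g x) (fun x => f1 x + g1 x) (fun x => f2 x + g2 x).
Proof.
move=> [cf cf1 cf2 df1 df2] [cg cg1 cg2 dg1 dg2]; split.
- by move=> x; apply: cvgD; [exact: cf|exact: cg].
- by move=> x; apply: cvgD; [exact: cf1|exact: cg1].
- by move=> x; apply: cvgD; [exact: cf2|exact: cg2].
- by move=> x; exact: is_deriveD.
- by move=> x; exact: is_deriveD.
Qed.

Lemma partialsM f f1 f2 g g1 g2 : partials f f1 f2 -> partials g g1 g2 ->
  partials (fun x => f x * g x) (fun x => f1 x * g x + f x * g1 x)
    (fun x => f2 x * g x + f x * g2 x).
Proof.
move=> [cf cf1 cf2 df1 df2] [cg cg1 cg2 dg1 dg2]; split.
- by move=> x; apply: cvgM; [exact: cf|exact: cg].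
- by move=> x; apply: cvgD; apply: cvgM;
    [exact: cf1|exact: cg|exact: cf|exact: cg1].
- by move=> x; apply: cvgD; apply: cvgM;
    [exact: cf2|exact: cg|exact: cf|exact: cg2].
- move=> x.
  have := @is_deriveM _ _ (fun u => f (u, x.2)) (fun u => g (u, x.2)) x.1 1 _ _ (df1 x) (dg1 x).
  move/is_derive_eq; apply.
  by rewrite /GRing.scale /= -!surjective_pairing; ring.
- move=> x.
  have := @is_deriveM _ _ (fun u => f (x.1, u)) (fun u => g (x.1, u)) x.2 1 _ _ (df2 x) (dg2 x).
  move/is_derive_eq; apply.
  by rewrite /GRing.scale /= -!surjective_pairing; ring.
Qed.

Lemma partials_cst (r : R) : partials (fun=> r) (fun=> 0) (fun=> 0).
Proof. by split; try (by move=> x; exact: cvg_cst); move=> x; exact: is_derive_cst. Qed.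

Lemma partials_fst : partials (fun x => x.1) (fun=> 1) (fun=> 0).
Proof.
split; try (by move=> x; exact: cvg_cst).
- by move=> x; exact: cvg_fst.
- by move=> x; exact: is_derive_id.
- by move=> x; exact: is_derive_cst.
Qed.

Lemma partials_snd : partials (fun x => x.2) (fun=> 0) (fun=> 1).
Proof.
split; try (by move=> x; exact: cvg_cst).
- by move=> x; exact: cvg_snd.
- by move=> x; exact: is_derive_cst.
- by move=> x; exact: is_derive_id.
Qed.

Lemma partials_comp (b db : R -> R) f f1 f2 : (forall u : R, is_derive u 1 b (db u)) ->
  continuous db -> partials f f1 f2 ->
  partials (fun x => b (f x)) (fun x => db (f x) * f1 x) (fun x => db (f x) * f2 x).
Proof.
move=> hb cdb [cf cf1 cf2 df1 df2].
have cb : continuous b.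
  by move=> u; apply: differentiable_continuous; apply/derivable1_diffP; have [] := hb u.
split.
- by move=> x; apply: continuous_comp; [exact: cf|exact: cb].
- move=> x; apply: cvgM; last exact: cf1.
  by apply: (@continuous_comp _ _ _ f db); [exact: cf|exact: cdb].
- move=> x; apply: cvgM; last exact: cf2.
  by apply: (@continuous_comp _ _ _ f db); [exact: cf|exact: cdb].
- move=> x; have h := hb (f x); rewrite [x in f x]surjective_pairing in h.
  have := @is_derive1_comp R b (fun u => f (u, x.2)) x.1 _ _ h (df1 x).
  by rewrite -surjective_pairing.
- move=> x; have h := hb (f x); rewrite [x in f x]surjective_pairing in h.
  have := @is_derive1_comp R b (fun u => f (x.1, u)) x.2 _ _ h (df2 x).
  by rewrite -surjective_pairing.
Qed.

Lemma continuous_affine (l : R) (p : R * R) : continuous (fun x : R * R => l *: (x - p)).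
Proof.
move=> x; apply: cvgZr; apply: cvgB; [exact: cvg_id|exact: cvg_cst].
Qed.

Lemma partials_affine (l : R) (p : R * R) f f1 f2 : partials f f1 f2 ->
  partials (fun x => f (l *: (x - p))) (fun x => l * f1 (l *: (x - p)))
    (fun x => l * f2 (l *: (x - p))).
Proof.
have ca := @continuous_affine l p.
move=> [cf cf1 cf2 df1 df2]; split.
- by move=> x; apply: continuous_comp; [exact: ca|exact: cf].
- move=> x; apply: cvgM; first exact: cvg_cst.
  by apply: (@continuous_comp _ _ _ (fun x => l *: (x - p)) f1); [exact: ca|exact: cf1].
- move=> x; apply: cvgM; first exact: cvg_cst.
  by apply: (@continuous_comp _ _ _ (fun x => l *: (x - p)) f2); [exact: ca|exact: cf2].
- move=> x.
  have d1 : is_derive x.1 1 (fun u : R => l * (u - p.1)) l.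
    have -> : (fun u : R => l * (u - p.1)) = l \*: (id - cst p.1) by [].
    by apply: is_derive_eq; rewrite subr0 /GRing.scale /= mulr1.
  have := @is_derive1_comp R (fun u => f (u, l * (x.2 - p.2))) (fun u => l * (u - p.1)) x.1
    _ _ (df1 (l *: (x - p))) d1.
  by rewrite [_ * l]mulrC.
- move=> x.
  have d1 : is_derive x.2 1 (fun u : R => l * (u - p.2)) l.
    have -> : (fun u : R => l * (u - p.2)) = l \*: (id - cst p.2) by [].
    by apply: is_derive_eq; rewrite subr0 /GRing.scale /= mulr1.
  have := @is_derive1_comp R (fun u => f (l * (x.1 - p.1), u)) (fun u => l * (u - p.2)) x.2
    _ _ (df2 (l *: (x - p))) d1.
  by rewrite [_ * l]mulrC.
Qed.

End Partials.

Section Lipschitz.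
Context {R : realType}.
Implicit Types (f : R * R -> R) (L : R).

Definition elipschitz L f := forall x y, `|f x - f y| <= L * edist x y.

Lemma elipschitz_slice1 L f x2 : elipschitz L f ->
  forall u v, `|f (u, x2) - f (v, x2)| <= L * `|u - v|.
Proof.
move=> Lf u v; have := Lf (u, x2) (v, x2).
by rewrite /edist /enorm /dot /= subrr mulr0 addr0 -expr2 sqrtr_sqr.
Qed.

Lemma elipschitz_slice2 L f x1 : elipschitz L f ->
  forall u v, `|f (x1, u) - f (x1, v)| <= L * `|u - v|.
Proof.
move=> Lf u v; have := Lf (x1, u) (x1, v).
by rewrite /edist /enorm /dot /= subrr mulr0 add0r -expr2 sqrtr_sqr.
Qed.

Lemma elipschitz_continuous L f : 0 <= L -> elipschitz L f -> continuous f.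
Proof.
move=> L0 Lf x; apply/cvgrPdist_le => e e0.
have d0 : 0 < e / (2 * (L + 1)) by rewrite divr_gt0// mulr_gt0//; lra.
pose d := e / (2 * (L + 1)).
exists (ball x.1 d, ball x.2 d) => /=; first by split; exact: nbhsx_ballx.
move=> y [/= h1 h2].
apply: le_trans (Lf x y) _.
have h : edist x y <= e / (L + 1).
  apply: le_trans (enorm_le_sum _) _.
  have -> : e / (L + 1) = e / (2 * (L + 1)) + e / (2 * (L + 1)).
    by field; rewrite gt_eqF//; lra.
  by apply: lerD; exact: ltW.
apply: le_trans (ler_wpM2l L0 h) _.
rewrite mulrCA -[X in _ <= X]mulr1 ler_pM2l//.
by rewrite ler_pdivrMr ?mul1r; lra.
Qed.

End Lipschitz.

(** * Averages in one coordinate direction *)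

Section Steklov.
Context {R : realType}.
Variable eta : R.
Hypothesis eta_gt0 : 0 < eta.
Implicit Types (f : R * R -> R) (L : R).

Definition havg f (x : R * R) : R := avg eta (fun u => f (x.1 + u, x.2)).
Definition vavg f (x : R * R) : R := avg eta (fun v => f (x.1, x.2 + v)).
Definition hdiff f (x : R * R) : R := eta^-1 * (f (x.1 + eta, x.2) - f x).
Definition vdiff f (x : R * R) : R := eta^-1 * (f (x.1, x.2 + eta) - f x).

Let cont_h f (x : R * R) : continuous f -> continuous (fun u : R => f (x.1 + u, x.2)).
Proof.
move=> cf; have cs := @continuous_slice2 R f x.2 cf.
move=> u; apply: (@continuous_comp _ _ _ (fun u => x.1 + u) (fun u => f (u, x.2))).
  by apply: cvgD; [exact: cvg_cst|exact: cvg_id].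
exact: cs.
Qed.

Let cont_v f (x : R * R) : continuous f -> continuous (fun u : R => f (x.1, x.2 + u)).
Proof.
move=> cf; have cs := @continuous_slice1 R f x.1 cf.
move=> u; apply: (@continuous_comp _ _ _ (fun u => x.2 + u) (fun u => f (x.1, u))).
  by apply: cvgD; [exact: cvg_cst|exact: cvg_id].
exact: cs.
Qed.

Let edist_shift u v (x y : R * R) :
  edist (x.1 + u, x.2 + v) (y.1 + u, y.2 + v) = edist x y.
Proof.
by rewrite /edist /enorm; congr Num.sqrt; rewrite /dot /=; ring.
Qed.

Let edist_shift1 u (x y : R * R) : edist (x.1 + u, x.2) (y.1 + u, y.2) = edist x y.
Proof. by rewrite -(edist_shift u 0 x y) !addr0. Qed.

Let edist_shift2 u (x y : R * R) : edist (x.1, x.2 + u) (y.1, y.2 + u) = edist x y.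
Proof. by rewrite -(edist_shift 0 u x y) !addr0. Qed.

Let avg_near g h c : continuous g -> continuous h ->
  (forall u, 0 <= u <= eta -> `|g u - h u| <= c) -> `|avg eta g - avg eta h| <= c.
Proof.
move=> cg ch gh; rewrite -avgB// ler_norml.
have cB : continuous (fun u => g u - h u).
  by move=> u; apply: cvgB; [exact: cg|exact: ch].
have h1 : avg eta (fun=> - c) <= avg eta (fun u => g u - h u).
  apply: avg_le => //; first exact: cst_continuous.
  by move=> u /gh; rewrite ler_norml => /andP[].
have h2 : avg eta (fun u => g u - h u) <= avg eta (fun=> c).
  apply: avg_le => //; first exact: cst_continuous.
  by move=> u /gh; rewrite ler_norml => /andP[].
by rewrite !avg_cst// in h1 h2; rewrite h1 h2.
Qed.

Lemma elipschitz_havg L f : 0 <= L -> elipschitz L f -> elipschitz L (havg f).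
Proof.
move=> L0 Lf x y; have cf := elipschitz_continuous L0 Lf.
apply: avg_near; [exact: cont_h|exact: cont_h|] => u _.
by apply: le_trans (Lf _ _) _; rewrite edist_shift1.
Qed.

Lemma elipschitz_vavg L f : 0 <= L -> elipschitz L f -> elipschitz L (vavg f).
Proof.
move=> L0 Lf x y; have cf := elipschitz_continuous L0 Lf.
apply: avg_near; [exact: cont_v|exact: cont_v|] => u _.
by apply: le_trans (Lf _ _) _; rewrite edist_shift2.
Qed.

Lemma elipschitz_hdiff L f : 0 <= L -> elipschitz L f ->
  elipschitz (eta^-1 * (L + L)) (hdiff f).
Proof.
move=> L0 Lf x y; rewrite /hdiff -mulrBr normrM gtr0_norm ?invr_gt0//.
rewrite -mulrA ler_pM2l ?invr_gt0// mulrDl.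
have h1 := Lf (x.1 + eta, x.2) (y.1 + eta, y.2); have h2 := Lf x y.
rewrite edist_shift1 in h1.
rewrite [X in `|X|](_ : _ = (f (x.1 + eta, x.2) - f (y.1 + eta, y.2)) - (f x - f y)); last by ring.
by apply: le_trans (ler_normB _ _) (lerD h1 h2).
Qed.

Lemma elipschitz_vdiff L f : 0 <= L -> elipschitz L f ->
  elipschitz (eta^-1 * (L + L)) (vdiff f).
Proof.
move=> L0 Lf x y; rewrite /vdiff -mulrBr normrM gtr0_norm ?invr_gt0//.
rewrite -mulrA ler_pM2l ?invr_gt0// mulrDl.
have h1 := Lf (x.1, x.2 + eta) (y.1, y.2 + eta); have h2 := Lf x y.
rewrite edist_shift2 in h1.
rewrite [X in `|X|](_ : _ = (f (x.1, x.2 + eta) - f (y.1, y.2 + eta)) - (f x - f y)); last by ring.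
by apply: le_trans (ler_normB _ _) (lerD h1 h2).
Qed.

Lemma is_derive_havg f (x : R * R) : continuous f ->
  is_derive x.1 1 (fun u : R => havg f (u, x.2)) (hdiff f x).
Proof.
move=> cf; have := @is_derive_avg R eta eta_gt0 (fun u => f (u, x.2)) x.1 (@continuous_slice2 R f x.2 cf).
by rewrite /hdiff /= -surjective_pairing.
Qed.

Lemma is_derive_vavg f (x : R * R) : continuous f ->
  is_derive x.2 1 (fun u : R => vavg f (x.1, u)) (vdiff f x).
Proof.
move=> cf; have := @is_derive_avg R eta eta_gt0 (fun u => f (x.1, u)) x.2 (@continuous_slice1 R f x.1 cf).
by rewrite /vdiff /= -surjective_pairing.
Qed.

Lemma havg_vavg f : continuous f -> havg (vavg f) = vavg (havg f).
Proof.
move=> cf; apply/funext => x; rewrite /havg /vavg /=.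
apply: (@avg_Fubini R eta eta_gt0 (fun z => f (x.1 + z.1, x.2 + z.2))).
move=> z; apply: (@continuous_comp _ _ _ (fun z : R * R => x + z) f); last exact: cf.
by apply: cvgD; [exact: cvg_cst|exact: cvg_id].
Qed.

(** The area term is not translation invariant: shifting both points by [(u, 0)] changes
    [wedge x y / 2] by [u * (y.2 - x.2) / 2]. For [u <= eta] this costs at most [eta / 2] in the
    constant. *)
Lemma flux_bounded_havg t (U U' : set (R * R)) f : continuous f ->
  (forall x u, U' x -> 0 <= u <= eta -> U (x.1 + u, x.2)) ->
  flux_bounded t U f -> flux_bounded (t + eta / 2) U' (havg f).
Proof.
move=> cf UU' gf x y Ux Uy.
pose c := (t + eta / 2) * edist x y - wedge x y / 2.
suff : avg eta (fun u => f (y.1 + u, y.2)) <= avg eta (fun u => f (x.1 + u, x.2) + c).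
  have -> : (fun u => f (x.1 + u, x.2) + c) = (fun u => f (x.1 + u, x.2) - (fun=> - c) u).
    by apply/funext => u; rewrite opprK.
  rewrite avgB//; [|exact: cont_h|exact: cst_continuous].
  by rewrite avg_cst// opprK /havg /c; lra.
have ch := @cont_h f x cf.
apply: avg_le => //; first exact: cont_h.
  by move=> u; apply: cvgD; [exact: ch|exact: cvg_cst].
move=> u u01; have := gf _ _ (UU' _ _ Ux u01) (UU' _ _ Uy u01).
rewrite edist_shift1.
have := abs_le_enorm2 (x - y); rewrite -/(edist x y) ler_norml /= => /andP[_ h].
have {}h : u * (x.2 - y.2) <= eta * edist x y.
  have /andP[u0 u1] := u01.
  by apply: le_trans (ler_wpM2l u0 h) _; rewrite ler_wpM2r// enorm_ge0.
by rewrite /wedge /= /c; rewrite /wedge; lra.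
Qed.

Lemma flux_bounded_vavg t (U U' : set (R * R)) f : continuous f ->
  (forall x u, U' x -> 0 <= u <= eta -> U (x.1, x.2 + u)) ->
  flux_bounded t U f -> flux_bounded (t + eta / 2) U' (vavg f).
Proof.
move=> cf UU' gf x y Ux Uy.
pose c := (t + eta / 2) * edist x y - wedge x y / 2.
suff : avg eta (fun u => f (y.1, y.2 + u)) <= avg eta (fun u => f (x.1, x.2 + u) + c).
  have -> : (fun u => f (x.1, x.2 + u) + c) = (fun u => f (x.1, x.2 + u) - (fun=> - c) u).
    by apply/funext => u; rewrite opprK.
  rewrite avgB//; [|exact: cont_v|exact: cst_continuous].
  by rewrite avg_cst// opprK /vavg /c; lra.
have ch := @cont_v f x cf.
apply: avg_le => //; first exact: cont_v.
  by move=> u; apply: cvgD; [exact: ch|exact: cvg_cst].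
move=> u u01; have := gf _ _ (UU' _ _ Ux u01) (UU' _ _ Uy u01).
rewrite edist_shift2.
have := abs_le_enorm1 (x - y); rewrite -/(edist x y) ler_norml /= => /andP[h _].
have {}h : - (eta * edist x y) <= u * (x.1 - y.1).
  have /andP[u0 u1] := u01.
  apply: le_trans (ler_wpM2l u0 h); rewrite mulrN lerN2.
  by rewrite ler_wpM2r// enorm_ge0.
by rewrite /wedge /= /c; rewrite /wedge; lra.
Qed.

End Steklov.

(** * Calibration *)

Lemma plane_eq (T : Type) (x y : T * T) : x.1 = y.1 -> x.2 = y.2 -> x = y.
Proof. by case: x y => [? ?] [? ?] /= -> ->. Qed.

Section Mollify.
Context {R : realType}.
Implicit Types (f : R * R -> R) (x : R * R).

(** Averages reach outside the region where the stream function is given, so it is first extended to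
    the plane, as the lower envelope of the cones [Phi y + L * edist x y]. *)
Lemma mcshane (T : set (R * R)) (Phi : R * R -> R) (L : R) : 0 <= L -> T !=set0 ->
  (forall x y, T x -> T y -> Phi x - Phi y <= L * edist x y) ->
  exists2 f, elipschitz L f & forall x, T x -> f x = Phi x.
Proof.
move=> L0 [x0 Tx0] hL.
pose S x := [set Phi y + L * edist x y | y in T].
have S0 x : S x !=set0 by exists (Phi x0 + L * edist x x0), x0.
have Slb x : lbound (S x) (Phi x0 - L * edist x0 x).
  move=> _ [y Ty <-]; have := hL _ _ Tx0 Ty.
  by have := ler_wpM2l L0 (edist_triangle x x0 y); rewrite mulrDr; lra.
have fle x y : inf (S x) - inf (S y) <= L * edist x y.
  rewrite lerBlDr -lerBlDl; apply: lb_le_inf => // _ [z Tz <-].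
  rewrite lerBlDl; apply: (@le_trans _ _ (Phi z + L * edist x z)).
    by apply: ge_inf; [exists (Phi x0 - L * edist x0 x)|exists z].
  by have := ler_wpM2l L0 (edist_triangle y x z); rewrite mulrDr; lra.
exists (fun x => inf (S x)).
  by move=> x y; rewrite ler_norml lerNl opprB [edist x y]edistC fle edistC fle.
move=> x Tx; apply/eqP; rewrite eq_le; apply/andP; split.
  apply: ge_inf; first by exists (Phi x0 - L * edist x0 x).
  by exists x => //; rewrite /edist subrr enorm0 mulr0 addr0.
by apply: lb_le_inf => // _ [y Ty <-]; have := hL _ _ Tx Ty; lra.
Qed.

Definition elip f := exists2 L, 0 <= L & elipschitz L f.

Lemma elip_continuous f : elip f -> continuous f.
Proof. by move=> [L L0]; exact: elipschitz_continuous. Qed.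

Variable eta : R.
Hypothesis eta_gt0 : 0 < eta.

Lemma elip_havg f : elip f -> elip (havg eta f).
Proof. by move=> [L L0 Lf]; exists L => //; exact: elipschitz_havg. Qed.

Lemma elip_vavg f : elip f -> elip (vavg eta f).
Proof. by move=> [L L0 Lf]; exists L => //; exact: elipschitz_vavg. Qed.

Let eL L : 0 <= L -> 0 <= eta^-1 * (L + L).
Proof. by move=> L0; rewrite mulr_ge0 ?addr_ge0// invr_ge0 ltW. Qed.

Lemma elip_hdiff f : elip f -> elip (hdiff eta f).
Proof.
by move=> [L L0 Lf]; exists (eta^-1 * (L + L)); [exact: eL|exact: elipschitz_hdiff].
Qed.

Lemma elip_vdiff f : elip f -> elip (vdiff eta f).
Proof.
by move=> [L L0 Lf]; exists (eta^-1 * (L + L)); [exact: eL|exact: elipschitz_vdiff].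
Qed.

Let cont_hdiff f : continuous f -> continuous (hdiff eta f).
Proof.
move=> cf x; apply: cvgM; first exact: cvg_cst.
apply: cvgB; last exact: cf.
have -> : (fun x => f (x.1 + eta, x.2)) = f \o (fun x => x + (eta, 0)).
  by apply/funext => y /=; congr f; rewrite [RHS]surjective_pairing /= addr0.
have -> : (x.1 + eta, x.2) = x + (eta, 0) by rewrite [RHS]surjective_pairing /= addr0.
by apply: continuous_comp; [apply: cvgD; [exact: cvg_id|exact: cvg_cst]|exact: cf].
Qed.

Let cont_vdiff f : continuous f -> continuous (vdiff eta f).
Proof.
move=> cf x; apply: cvgM; first exact: cvg_cst.
apply: cvgB; last exact: cf.
have -> : (fun x => f (x.1, x.2 + eta)) = f \o (fun x => x + (0, eta)).
  by apply/funext => y /=; congr f; rewrite [RHS]surjective_pairing /= addr0.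
have -> : (x.1, x.2 + eta) = x + (0, eta) by rewrite [RHS]surjective_pairing /= addr0.
by apply: continuous_comp; [apply: cvgD; [exact: cvg_id|exact: cvg_cst]|exact: cf].
Qed.

Let is_derive_shift (g : R -> R) (c u d : R) :
  is_derive (u + c) 1 g d -> is_derive u 1 (fun u : R => g (u + c)) d.
Proof.
move=> h; have h1 := is_derive_addr c u.
by have := @is_derive1_comp R g (fun u => u + c) u _ _ h h1; rewrite mulr1.
Qed.

Lemma partials_hdiff f f1 f2 : partials f f1 f2 ->
  partials (hdiff eta f) (hdiff eta f1) (hdiff eta f2).
Proof.
move=> [cf cf1 cf2 df1 df2]; split; try exact: cont_hdiff.
- move=> x; rewrite /hdiff /=.
  have d1 := df1 x.
  have /is_derive_shift d2 := df1 (x.1 + eta, x.2).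
  have -> : (fun u => eta^-1 * (f (u + eta, x.2) - f (u, x.2))) =
    eta^-1 \*: ((fun u => f (u + eta, x.2)) - (fun u => f (u, x.2))) by [].
  by apply: is_derive_eq.
- move=> x; rewrite /hdiff /=.
  have d1 := df2 x; have d2 := df2 (x.1 + eta, x.2); rewrite /= in d2.
  have -> : (fun v => eta^-1 * (f (x.1 + eta, v) - f (x.1, v))) =
    eta^-1 \*: ((fun v => f (x.1 + eta, v)) - (fun v => f (x.1, v))) by [].
  by apply: is_derive_eq.
Qed.

Lemma partials_vdiff f f1 f2 : partials f f1 f2 ->
  partials (vdiff eta f) (vdiff eta f1) (vdiff eta f2).
Proof.
move=> [cf cf1 cf2 df1 df2]; split; try exact: cont_vdiff.
- move=> x; rewrite /vdiff /=.
  have d1 := df1 x; have d2 := df1 (x.1, x.2 + eta); rewrite /= in d2.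
  have -> : (fun v => eta^-1 * (f (v, x.2 + eta) - f (v, x.2))) =
    eta^-1 \*: ((fun v => f (v, x.2 + eta)) - (fun v => f (v, x.2))) by [].
  by apply: is_derive_eq.
- move=> x; rewrite /vdiff /=.
  have d1 := df2 x.
  have /is_derive_shift d2 := df2 (x.1, x.2 + eta).
  have -> : (fun u => eta^-1 * (f (x.1, u + eta) - f (x.1, u))) =
    eta^-1 \*: ((fun u => f (x.1, u + eta)) - (fun u => f (x.1, u))) by [].
  by apply: is_derive_eq.
Qed.

Lemma partials_havg_vavg f : elip f -> partials (havg eta (vavg eta f))
  (hdiff eta (vavg eta f)) (vdiff eta (havg eta f)).
Proof.
move=> lf; split.
- by apply: elip_continuous; apply: elip_havg; exact: elip_vavg.
- by apply: elip_continuous; apply: elip_hdiff; exact: elip_vavg.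
- by apply: elip_continuous; apply: elip_vdiff; exact: elip_havg.
- by move=> x; apply: is_derive_havg => //; apply: elip_continuous; exact: elip_vavg.
- move=> x; rewrite havg_vavg//; last exact: elip_continuous.
  by apply: is_derive_vavg => //; apply: elip_continuous; exact: elip_havg.
Qed.

(** The increment is split into a vertical step at the old abscissa and a horizontal step at the new
    height. The Lipschitz bounds on the partial derivatives make the error quadratic in [h]. *)
Lemma partials_increment f f1 f2 x d : partials f f1 f2 -> elip f1 -> elip f2 ->
  exists C, forall h : R, 0 < h ->
    h * (d.1 * f1 x + d.2 * f2 x) - C * h ^+ 2 <= f (x + h *: d) - f x.
Proof.
move=> [cf cf1 cf2 df1 df2] [L1 L10 Lf1] [L2 L20 Lf2].
have mvt (g dg : R -> R) a k L : 0 <= L -> (forall u : R, is_derive u 1 g (dg u)) ->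
   (forall u, `|dg u - dg a| <= L * `|u - a|) ->
   k * dg a - L * k ^+ 2 <= g (a + k) - g a.
  move=> L0 dg1 dgL.
  have mv (p q : R) : p < q -> exists2 c, p < c < q & g q - g p = dg c * (q - p).
    move=> pq; have [|c] := @MVT R g dg p q pq (fun u _ => dg1 u).
      by apply: derivable_within_continuous => u _; have [] := dg1 u.
    by rewrite in_itv /=; exists c.
  have [k0|k0|->] := ltgtP k 0.
  - have [|c /andP[c1 c2]] := mv (a + k) a; first lra.
    have := dgL c; rewrite [`|c - a|]ltr0_norm; last lra.
    rewrite ler_norml => /andP[h1 h2] h3.
    have : L * (a - c) <= L * - k by rewrite ler_wpM2l//; lra.
    nra.
  - have [|c /andP[c1 c2]] := mv a (a + k); first lra.
    have := dgL c; rewrite [`|c - a|]gtr0_norm; last lra.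
    rewrite ler_norml => /andP[h1 h2] h3.
    have : L * (c - a) <= L * k by rewrite ler_wpM2l//; lra.
    nra.
  - by rewrite addr0 expr0n /= mulr0 mul0r !subrr.
exists (L1 * (`|d.1| * `|d.2| + d.1 ^+ 2) + L2 * d.2 ^+ 2) => h h0.
have hd : `|h * d.2| = h * `|d.2| by rewrite normrM gtr0_norm.
have i1 := mvt (fun u => f (u, x.2 + h * d.2)) (fun u => f1 (u, x.2 + h * d.2)) x.1 (h * d.1) L1 L10
  (fun u => df1 (u, x.2 + h * d.2)) (fun u => elipschitz_slice1 _ Lf1 u x.1).
have i2 := mvt (fun u => f (x.1, u)) (fun u => f2 (x.1, u)) x.2 (h * d.2) L2 L20
  (fun u => df2 (x.1, u)) (fun u => elipschitz_slice2 _ Lf2 u x.2).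
have i3 := elipschitz_slice2 x.1 Lf1 (x.2 + h * d.2) x.2.
have e : x.2 + h * d.2 - x.2 = h * d.2 by rewrite addrC addKr.
rewrite e hd in i3.
have {}i3 : - (h ^+ 2 * (L1 * (`|d.1| * `|d.2|))) <=
   h * d.1 * (f1 (x.1, x.2 + h * d.2) - f1 (x.1, x.2)).
  rewrite lerNl; apply: le_trans (ler_norm _) _; rewrite normrN !normrM (gtr0_norm h0).
  have -> : h ^+ 2 * (L1 * (`|d.1| * `|d.2|)) = h * `|d.1| * (L1 * (h * `|d.2|)) by ring.
  by rewrite ler_wpM2l//; apply: mulr_ge0; rewrite // ltW.
move: i1 i2 i3; rewrite -!surjective_pairing.
have -> : x + h *: d = (x.1 + h * d.1, x.2 + h * d.2) by [].
lra.
Qed.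

(** A converse to integrating along segments. One direction is enough: for [d], the field turned by
    a right angle, [wedge F d = enorm F ^+ 2], and letting the step tend to 0 gives
    [enorm F ^+ 2 <= t * enorm F]. *)
Lemma flux_bounded_gradient t (U : set (R * R)) f f1 f2 x : partials f f1 f2 ->
  elip f1 -> elip f2 -> 0 <= t -> flux_bounded t U f ->
  (forall d, exists2 h0, 0 < h0 & forall h, 0 <= h < h0 -> U (x + h *: d)) ->
  enorm (x.1 / 2 + f2 x, x.2 / 2 - f1 x) <= t.
Proof.
move=> pf l1 l2 t0 gf hU; set F := (_, _).
pose d : R * R := (- F.2, F.1).
have [h0 h0_gt0 Uh] := hU d.
have [C hC] := partials_increment x d pf l1 l2.
have dE : enorm d = enorm F by rewrite /enorm /d /dot /= mulrNN addrC.
have dotF : d.1 * f1 x + d.2 * f2 x + wedge x d / 2 = enorm F ^+ 2.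
  by rewrite enorm_sqr /dot /wedge /d /F /=; field.
have key h : 0 < h < h0 -> enorm F ^+ 2 <= t * enorm F + C * h.
  move=> /andP[hp hh].
  have Ux : U x by have := Uh 0; rewrite lexx h0_gt0 scale0r addr0; exact.
  have Uxh : U (x + h *: d) by apply: Uh; rewrite hh ltW.
  have := gf _ _ Ux Uxh; have := hC h hp.
  have -> : edist x (x + h *: d) = h * enorm F.
    by rewrite edistC /edist addrC addKr enormZ dE gtr0_norm.
  have -> : wedge x (x + h *: d) = h * wedge x d.
    by rewrite /wedge /= /GRing.scale /=; ring.
  move=> i1 i2.
  have : h * enorm F ^+ 2 <= h * (t * enorm F + C * h) by rewrite -dotF; lra.
  by rewrite ler_pM2l.
have F0 := enorm_ge0 F.
have {}key : enorm F ^+ 2 <= t * enorm F.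
  rewrite leNgt; apply/negP => lt.
  pose e := enorm F ^+ 2 - t * enorm F; have e0 : 0 < e by rewrite subr_gt0.
  have C1 : 0 < `|C| + 1 by have := normr_ge0 C; lra.
  pose h := Num.min (h0 / 2) (e / (2 * (`|C| + 1))).
  have hp : 0 < h by rewrite lt_min !divr_gt0// mulr_gt0.
  have hh : h < h0 by rewrite gt_min; apply/orP; left; lra.
  have := key h; rewrite hp hh => /(_ isT).
  have : C * h <= (`|C| + 1) * h by rewrite ler_wpM2r ?ltW//; have := ler_norm C; lra.
  have : (`|C| + 1) * h <= e / 2.
    have -> : e / 2 = (`|C| + 1) * (e / (2 * (`|C| + 1))) by field; rewrite gt_eqF.
    by rewrite ler_pM2l// ge_min lexx orbT.
  rewrite /e; lra.
have [F00|F00] := eqVneq (enorm F) 0; first by rewrite F00.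
by move: key; rewrite expr2 ler_pM2r// lt_neqAle eq_sym F00.
Qed.

(* Averaging twice in each direction makes the field of class C1; the mixed
   second derivatives of the averaged stream function cancel. *)
Local Notation H := (havg eta).
Local Notation V := (vavg eta).

Lemma hdiff_vdiff f x : hdiff eta (vdiff eta f) x = vdiff eta (hdiff eta f) x.
Proof. by rewrite /hdiff /vdiff /=; ring. Qed.

(** The points all of whose shifts within the given range stay in [U]. Every average uses up [eta]
    of the window and [eta / 2] of the flux constant. *)
Definition window (U : set (R * R)) (a b : R) : set (R * R) :=
  [set x | forall u v : R, 0 <= u <= a -> 0 <= v <= b -> U (x.1 + u, x.2 + v)].

Lemma flux_bounded_window_havg s U a b f : elip f ->
  flux_bounded s (window U a b) f ->
  flux_bounded (s + eta / 2) (window U (a + eta) b) (H f).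
Proof.
move=> lf; apply: flux_bounded_havg; [exact: eta_gt0|exact: elip_continuous|].
move=> x u Wx /andP[u0 u1] v v' /andP[v0 v1] hv' /=.
rewrite -addrA; apply: Wx; [lra|exact: hv'].
Qed.

Lemma flux_bounded_window_vavg s U a b f : elip f ->
  flux_bounded s (window U a b) f ->
  flux_bounded (s + eta / 2) (window U a (b + eta)) (V f).
Proof.
move=> lf; apply: flux_bounded_vavg; [exact: eta_gt0|exact: elip_continuous|].
move=> x u Wx /andP[u0 u1] v v' hv /andP[v0 v1] /=.
rewrite -addrA; apply: Wx; [exact: hv|lra].
Qed.

Lemma mollified_field t (U U' : set (R * R)) Phi : elip Phi -> 0 <= t ->
  flux_bounded t U Phi ->
  (forall x u v, U' x -> 0 <= u <= eta + eta -> 0 <= v <= eta + eta -> U (x.1 + u, x.2 + v)) ->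
  exists F1 F2 g, [/\ exists g', partials F1 (fun x => 1 / 2 + g x) g',
    exists g', partials F2 g' (fun x => 1 / 2 - g x) &
    forall x, (forall d, exists2 h0, 0 < h0 & forall h, 0 <= h < h0 -> U' (x + h *: d)) ->
      enorm (F1 x, F2 x) <= t + (eta + eta)].
Proof.
move=> lP t0 gP hU.
have lH := elip_havg; have lV := elip_vavg; have cl := elip_continuous.
have HV f : elip f -> H (V f) = V (H f) by move=> lf; apply: havg_vavg => //; exact: cl.
have cP : continuous Phi := cl _ lP.
have lVH : elip (V (H Phi)) := lV _ (lH _ lP).
have e1 : V (V (H Phi)) = H (V (V Phi)).
  by rewrite (HV _ (lV _ lP)) (HV _ lP).
(* A first derivative of [Psi] is a difference quotient of a function with one average left in its
   own direction and two in the other, so it can be differentiated once more in both. *)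
pose Psi := H (H (V (V Phi))).
have pPsi : partials Psi (hdiff eta (H (V (V Phi)))) (vdiff eta (H (V (H Phi)))).
  have := partials_havg_vavg lVH; rewrite e1; exact.
have p2 : partials (vdiff eta (H (V (H Phi)))) (vdiff eta (hdiff eta (V (H Phi))))
  (vdiff eta (vdiff eta (H (H Phi)))).
  exact: partials_vdiff (partials_havg_vavg (lH _ lP)).
have p1 : partials (hdiff eta (H (V (V Phi)))) (hdiff eta (hdiff eta (V (V Phi))))
  (hdiff eta (vdiff eta (H (V Phi)))).
  exact: partials_hdiff (partials_havg_vavg (lV _ lP)).
have mixed x : hdiff eta (vdiff eta (H (V Phi))) x = vdiff eta (hdiff eta (V (H Phi))) x.
  by rewrite (HV _ lP) hdiff_vdiff.
have g0 : flux_bounded t (window U 0 0) Phi.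
  apply: flux_bounded_sub gP => x /(_ 0 0); rewrite lexx !addr0 => /(_ isT isT).
  by rewrite -surjective_pairing.
have gPsi : flux_bounded (t + (eta + eta)) U' Psi.
  have g1 := flux_bounded_window_vavg lP g0.
  have g2 := flux_bounded_window_vavg (lV _ lP) g1.
  have g3 := flux_bounded_window_havg (lV _ (lV _ lP)) g2.
  have g4 := flux_bounded_window_havg (lH _ (lV _ (lV _ lP))) g3.
  have -> : t + (eta + eta) = t + eta / 2 + eta / 2 + eta / 2 + eta / 2 by field.
  apply: flux_bounded_sub g4 => x U'x u v hu hv.
  by apply: hU; [exact: U'x|move: hu; rewrite add0r|move: hv; rewrite add0r].
exists (fun x => x.1 / 2 + vdiff eta (H (V (H Phi))) x),
  (fun x => x.2 / 2 + - 1 * hdiff eta (H (V (V Phi))) x),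
  (vdiff eta (hdiff eta (V (H Phi)))).
have pc (c : R) : partials (fun=> c) (fun=> 0) (fun=> 0) := partials_cst c.
split.
- have := partialsD (partialsM partials_fst (pc 2^-1)) p2.
  move=> h; eexists; congr (partials _ _ _): h.
  by apply/funext => x; rewrite mulr0 addr0.
- have := partialsD (partialsM partials_snd (pc 2^-1)) (partialsM (pc (-1)) p1).
  move=> h; eexists; congr (partials _ _ _): h.
  by apply/funext => x; rewrite mixed; ring.
- move=> x hx.
  have l1 : elip (hdiff eta (H (V (V Phi)))) := elip_hdiff (lH _ (lV _ (lV _ lP))).
  have l2 : elip (vdiff eta (H (V (H Phi)))) := elip_vdiff (lH _ lVH).
  have := flux_bounded_gradient pPsi l1 l2 _ gPsi hx.
  rewrite mulN1r; apply; have e0 := eta_gt0; lra.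
Qed.

End Mollify.

(** * Cutoff functions of class C1 and compactness of disks *)

Section Cutoff.
Context {R : realType}.
Implicit Types (x y a : R * R) (S : seq (R * R)).

(** The square of the positive part, a function of class C1 that vanishes exactly on a half line;
    all cutoffs are built from it. *)
Definition pos_sqr (u : R) : R := Num.max 0 u ^+ 2.

Lemma continuous_max0 : continuous (Num.max 0 : R -> R).
Proof.
have -> : (Num.max 0 : R -> R) = (fun u => (u + `|u|) / 2).
  by apply/funext => u; rewrite maxr_absE add0r sub0r normrN.
move=> u; apply: cvgM; last exact: cvg_cst.
by apply: cvgD; [exact: cvg_id|apply: cvg_norm; exact: cvg_id].
Qed.

Lemma is_derive_pos_sqr (u : R) : is_derive u 1 pos_sqr (2 * Num.max 0 u).
Proof.
have [u0|u0|->] := ltgtP u 0.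
- rewrite mulr0; have := is_derive_cst (0 : R) u (1 : R).
  apply: near_eq_is_derive; near=> v; rewrite /pos_sqr max_l ?expr0n//.
  by apply: ltW; near: v; exact: lt_nbhsl.
- have d : is_derive u 1 (fun v : R => v ^+ 2) (2 * u).
    have -> : (fun v : R => v ^+ 2) = id * id by apply/funext => v; rewrite expr2.
    by apply: is_derive_eq; rewrite /GRing.scale /=; ring.
  apply: near_eq_is_derive d; near=> v; rewrite /pos_sqr max_r//.
  by apply: ltW; near: v; exact: lt_nbhsr.
- have m0 : Num.max 0 0 = 0 :> R by rewrite max_l.
  rewrite mulr0.
  have q : (fun h : R => h^-1 *: ((pos_sqr \o shift 0) (h *: 1) - pos_sqr 0)) = Num.max 0.
    apply/funext => h; rewrite /pos_sqr /= m0 expr0n /= subr0 addr0 /GRing.scale /= mulr1.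
    have [h0|h0|->] := ltgtP h 0; [by rewrite expr0n mulr0| |by rewrite invr0 mul0r].
    by rewrite expr2 mulKf// gt_eqF.
  have c : (Num.max 0 : R -> R) @ 0^' --> (0 : R).
    apply: cvg_trans; first by apply: cvg_app; exact: nbhs_dnbhs.
    by have := @continuous_max0 0; rewrite /continuous_at max_l.
  apply: DeriveDef.
    by rewrite /derivable q; apply/cvg_ex; exists 0.
  by rewrite /derive q; apply: cvg_lim c.
Unshelve. all: by end_near. Qed.

Lemma partials_pos_sqr f f1 f2 : partials f f1 f2 ->
  partials (fun x => pos_sqr (f x)) (fun x => 2 * Num.max 0 (f x) * f1 x)
    (fun x => 2 * Num.max 0 (f x) * f2 x).
Proof.
apply: (@partials_comp R pos_sqr (fun u => 2 * Num.max 0 u)); first exact: is_derive_pos_sqr.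
by move=> u; apply: cvgM; [exact: cvg_cst|exact: continuous_max0].
Qed.

(** The function is [pos_sqr (1 - pos_sqr d)], where [d] is the excess of the squared distance over
    [w ^+ 2] in units of [k]. Its derivatives vanish on the closed disk, so multiplying a field by
    it leaves the divergence there unchanged. *)
Lemma disk_bump a (w k : R) : 0 < k -> exists z z1 z2, [/\ partials z z1 z2,
  forall x, 0 <= z x <= 1, forall x, dot (x - a) (x - a) <= w ^+ 2 ->
    [/\ z x = 1, z1 x = 0 & z2 x = 0] &
  forall x, z x != 0 -> dot (x - a) (x - a) < w ^+ 2 + k].
Proof.
move=> k0.
pose d x := (dot (x - a) (x - a) - w ^+ 2) / k.
have [d1 [d2 pd]] : exists d1 d2, partials d d1 d2.
  have pX := partialsD (@partials_fst R) (partials_cst (- a.1)).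
  have pY := partialsD (@partials_snd R) (partials_cst (- a.2)).
  have := partialsM (partialsD (partialsD (partialsM pX pX) (partialsM pY pY))
     (partials_cst (- w ^+ 2))) (partials_cst k^-1).
  by move=> h; do 2 eexists; exact: h.
have := partials_pos_sqr (partialsD (partials_cst 1) (partialsM (partials_cst (-1))
  (partials_pos_sqr pd))).
set z := (X in partials X) => pz; exists z; do 2 eexists; split; first exact: pz.
- move=> x; rewrite /z /pos_sqr exprn_ge0 ?le_max ?lexx//=.
  rewrite exprn_ile1 ?le_max ?lexx// ge_max ler01 /= mulN1r gerBl.
  by rewrite exprn_ge0// le_max lexx.
- move=> x h; have d0 : d x <= 0.
    by rewrite /d pmulr_lle0 ?invr_gt0// subr_le0.
  by rewrite /z /pos_sqr (max_l d0) expr0n /= !(mulr0, mul0r, add0r, addr0) max_r// expr1n.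
- move=> x; rewrite ltNge; apply: contraNN => h; rewrite /z /pos_sqr.
  have d1x : 1 <= d x by rewrite /d ler_pdivlMr// mul1r; lra.
  rewrite [Num.max 0 (d x)]max_r; last lra.
  by rewrite max_l ?expr0n//; nra.
Qed.

Lemma ball_intersection_bump S (w k : R) : 0 < k -> exists z z1 z2, [/\ partials z z1 z2,
  forall x, 0 <= z x <= 1, forall x, (forall a, a \in S -> dot (x - a) (x - a) <= w ^+ 2) ->
    [/\ z x = 1, z1 x = 0 & z2 x = 0] &
  forall x a, z x != 0 -> a \in S -> dot (x - a) (x - a) < w ^+ 2 + k].
Proof.
move=> k0; elim: S => [|a S [z [z1 [z2 [pz z01 zT zN]]]]].
  exists (fun=> 1), (fun=> 0), (fun=> 0); split=> //; first exact: partials_cst.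
  by move=> x; rewrite ler01 lexx.
have [y [y1 [y2 [py y01 yT yN]]]] := disk_bump a w k0.
exists (fun x => y x * z x); do 2 eexists; split; first exact: partialsM py pz.
- move=> x; have /andP[? ?] := z01 x; have /andP[? ?] := y01 x.
  by rewrite mulr_ge0//= mulr_ile1.
- move=> x h; have [-> -> ->] := yT x (h a (mem_head _ _)).
  have [|-> -> ->] := zT x; first by move=> c cS; apply: h; rewrite in_cons cS orbT.
  by rewrite !mulr0 !mul0r !addr0 mulr1.
- move=> x c; rewrite mulf_eq0 negb_or => /andP[yx zx].
  by rewrite in_cons => /orP[/eqP->|]; [exact: yN|exact: zN].
Qed.

Lemma continuous_edist a : continuous (fun x => edist x a).
Proof.
apply: (@elipschitz_continuous R 1) => // x y.
rewrite mul1r ler_norml.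
have := edist_triangle y x a; have := edist_triangle x y a.
by rewrite [edist y x]edistC => h1 h2; apply/andP; split; lra.
Qed.

Lemma closed_closed_disk a (r : R) : closed (closed_disk a r).
Proof.
have -> : closed_disk a r = (fun x => edist x a) @^-1` [set u | u <= r].
  by apply/seteqP; split => x; rewrite /closed_disk /= edistC.
apply: closed_comp; last exact: closed_le.
by move=> x _; exact: continuous_edist.
Qed.

Lemma closed_disk_sub_box a (r : R) :
  closed_disk a r `<=` `[a.1 - r, a.1 + r] `*` `[a.2 - r, a.2 + r].
Proof.
move=> x; rewrite /closed_disk /= => h.
have := abs_le_enorm1 (a - x); have := abs_le_enorm2 (a - x).
rewrite /edist in h; move=> h2 h1; have := le_trans h1 h; have := le_trans h2 h.
rewrite !ler_norml /= !in_itv /= => /andP[? ?] /andP[? ?].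
by split; apply/andP; split; lra.
Qed.

Lemma compact_closed_disk a (r : R) : compact (closed_disk a r).
Proof.
apply: subclosed_compact (@closed_disk_sub_box a r); first exact: closed_closed_disk.
by apply: compact_setX; exact: segment_compact.
Qed.

End Cutoff.

Section Calibration.
Context {R : realType}.
Local Notation RR := (measurableTypeR R * measurableTypeR R)%type.
Implicit Types (x y a : R * R) (S : seq (R * R)).

Definition balls S (w : R) : set (R * R) :=
  [set x | forall a, a \in S -> edist x a <= w].

Lemma area_closed_disk_lty a (r : R) (E : set RR) : measurable E ->
  E `<=` closed_disk a r -> (area E < +oo)%E.
Proof.
move=> mE hE.
pose B : set RR := `[a.1 - r, a.1 + r] `*` `[a.2 - r, a.2 + r].
apply: (@le_lt_trans _ _ (area B)).
  apply: le_measure; rewrite ?inE//; first exact: measurableX.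
  exact: subset_trans hE (@closed_disk_sub_box R a r).
rewrite /area product_measure1E//= !lebesgue_measure_itv /=.
by case: ifP => _; case: ifP => _; rewrite ?mul0e ?mule0 -?EFinB -?EFinM ltry.
Qed.

(** On a bounded set the flux inequality already contains a Lipschitz bound, because
    [wedge x y = wedge x (y - x)] is at most the norm of [x] times the distance. *)
Lemma flux_bounded_elip S p (w t : R) Phi : 0 <= t -> p \in S -> balls S w !=set0 ->
  flux_bounded t (balls S w) Phi ->
  exists2 f, elip f & flux_bounded t (balls S w) f.
Proof.
move=> t0 pS T0 gP; pose M := enorm p + `|w|.
have TM x : balls S w x -> enorm x <= M.
  move=> /(_ p pS) h; rewrite -[x](subrK p) addrC; apply: le_trans (enormD _ _) _.
  by rewrite lerD2l; apply: le_trans h (ler_norm _).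
have [|x y Tx Ty|f Lf fP] := @mcshane R (balls S w) Phi (t + M / 2) _ T0.
- by rewrite addr_ge0// divr_ge0// addr_ge0 ?enorm_ge0.
- have := gP y x Ty Tx; have := wedge_le x (y - x).
  have -> : wedge x (y - x) = - wedge y x by rewrite /wedge /=; ring.
  have := ler_wpM2r (enorm_ge0 (y - x)) (TM x Tx); rewrite -!/(edist _ _) [edist y x]edistC.
  lra.
- exists f; first by exists (t + M / 2); rewrite // addr_ge0// divr_ge0// addr_ge0 ?enorm_ge0.
  exact: flux_bounded_eq fP gP.
Qed.

(** A test field must have norm at most 1 on the whole plane, so the calibrating field has to be
    controlled on a neighbourhood of the body. Composing it with the contraction of ratio [l] about
    [O] moves a neighbourhood into the body, at the price of divergence [l] in place of 1. *)
Lemma calibration_shrunk S O p (w r t l : R) Phi (E : set RR) : 0 < t -> p \in S ->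
  0 < l < 1 -> (forall a, a \in S -> edist O a <= r) -> 0 <= r < w -> elip Phi ->
  flux_bounded t (balls S w) Phi -> measurable E -> E `<=` balls S w ->
  ((l / (t + (1 - l) * (w - r)))%:E * area E <= perimeter E)%E.
Proof.
move=> t0 pS /andP[l0 l1] hO /andP[r0 rw] lP gP mE ET.
(* The contraction gains [(1 - l) * (w - r) = 2 * del] in the distance to every centre: one [del]
   pays for the enlarged disks, the other for the shifts made by averaging and by the short steps
   [h *: d]. *)
pose del := (1 - l) * (w - r) / 2; have del0 : 0 < del by rewrite divr_gt0// mulr_gt0; lra.
pose eta := del / 8; have eta0 : 0 < eta by rewrite divr_gt0.
pose t' := t + (eta + eta).
pose k := (w + del) ^+ 2 - w ^+ 2.
have k0 : 0 < k by rewrite /k sqrrD addrAC [X in X - _]addrC -!addrA addNKr; nra.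
pose P x := l *: (x - (1 - l^-1) *: O).
have PE x : P x = O + l *: (x - O).
  rewrite /P !scalerBr scalerA mulrBr mulr1 divff ?gt_eqF// scalerBl scale1r.
  by rewrite opprB addrCA.
have inT x v a : a \in S -> edist x a <= w + del -> enorm v <= del -> edist (P x + v) a <= w.
  move=> aS hx hv; rewrite /edist.
  have -> : P x + v - a = l *: (x - a) + (1 - l) *: (O - a) + v.
    by rewrite PE; apply: plane_eq; rewrite /= /GRing.scale /=; ring.
  apply: le_trans (enormD _ _) _; apply: le_trans (lerD (enormD _ _) (lexx _)) _.
  rewrite !enormZ gtr0_norm// gtr0_norm; last lra.
  have h1 : l * enorm (x - a) <= l * (w + del) by rewrite ler_pM2l.
  have h2 : (1 - l) * enorm (O - a) <= (1 - l) * r by rewrite ler_wpM2l ?hO//; lra.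
  have h3 : l * del <= del by nra.
  have h4 : (1 - l) * (w - r) = 2 * del by rewrite /del; field.
  lra.
pose U' x := forall u v : R, 0 <= u <= eta + eta -> 0 <= v <= eta + eta ->
  balls S w (x.1 + u, x.2 + v).
have [F1 [F2 [g [[g1 pF1] [g2 pF2] hF]]]] :=
  @mollified_field R eta eta0 t (balls S w) U' Phi lP (ltW t0) gP (fun x u v h => h u v).
have boundF x : (forall a, a \in S -> edist x a <= w + del) -> enorm (F1 (P x), F2 (P x)) <= t'.
  move=> hx; apply: hF => d.
  have d0 : 0 < enorm d + 1 by have := enorm_ge0 d; lra.
  exists (del / 4 / (enorm d + 1)); first by apply: divr_gt0 => //; exact: divr_gt0.
  move=> h /andP[h0]; rewrite ltr_pdivlMr// => h1 u v /andP[u0 u1] /andP[v0 v1] a aS.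
  have -> : ((P x + h *: d).1 + u, (P x + h *: d).2 + v) = P x + (h *: d + (u, v)).
    by rewrite [RHS]surjective_pairing /= !addrA.
  apply: inT => //; first exact: hx.
  apply: le_trans (enormD _ _) _; rewrite enormZ ger0_norm//.
  have := enorm_le_sum (u, v); rewrite /= !ger0_norm//.
  have : h * enorm d <= del / 4 by nra.
  rewrite /eta in u1 v1; lra.
have [z [z1 [z2 [pz z01 zT zN]]]] := ball_intersection_bump S w k0.
have t'0 : 0 < t' by rewrite /t'; lra.
pose phi x := (z x * (t'^-1 * F1 (P x)), z x * (t'^-1 * F2 (P x))).
have pA := partials_affine l ((1 - l^-1) *: O).
have pphi1 := partialsM pz (partialsM (partials_cst t'^-1) (pA _ _ _ pF1)).
have pphi2 := partialsM pz (partialsM (partials_cst t'^-1) (pA _ _ _ pF2)).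
have zD x a : z x != 0 -> a \in S -> edist x a <= w + del.
  move=> zx aS; have := zN x a zx aS.
  rewrite /edist enorm_le; last by lra.
  by rewrite /k; lra.
have test : test_field phi.
  split.
  - exact: partials_C1 pphi1.
  - exact: partials_C1 pphi2.
  - apply: (@subclosed_compact _ _ (closed_disk p (w + del))).
    + exact: closed_closure.
    + exact: compact_closed_disk.
    + rewrite [X in _ `<=` X](closure_id _).1; last exact: closed_closed_disk.
      apply: closureS => x /= h.
      rewrite /closed_disk /= edistC; apply: zD => //; apply/eqP => zx; apply: h.
      by rewrite /phi zx !mul0r.
  - move=> x; rewrite /phi.
    have [->|zx] := eqVneq (z x) 0; first by rewrite !mul0r enorm0.
    have -> : (z x * (t'^-1 * F1 (P x)), z x * (t'^-1 * F2 (P x))) =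
      (z x / t') *: (F1 (P x), F2 (P x)).
      by rewrite [RHS]surjective_pairing /= /GRing.scale /= !mulrA.
    have /andP[z0 zle1] := z01 x.
    rewrite enormZ ger0_norm; last by rewrite divr_ge0// ltW.
    rewrite mulrAC ler_pdivrMr// mul1r; apply: le_trans (boundF x _); last first.
      by move=> a; exact: zD.
    by rewrite ler_piMl// enorm_ge0.
have divE x : balls S w x -> divergence phi x = l / t'.
  move=> Tx; rewrite /divergence.
  rewrite (partials_D1 x pphi1) (partials_D2 x pphi2).
  have [|-> -> ->] := zT x.
    by move=> a aS; have := Tx a aS; rewrite /edist enorm_le//; lra.
  rewrite -!/(P x); field; exact: lt0r_neq0.
apply: (@le_trans _ _ ((l / t')%:E * area E)%E).
  apply: lee_wpmul2r => //; rewrite lee_fin ler_pM2l// lef_pV2 ?posrE//.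
    by rewrite /t' /eta /del; nra.
  by rewrite addr_gt0// mulr_gt0; lra.
apply: (@le_trans _ _ (\int[area]_(x in E) (divergence phi x)%:E)%E); last first.
  by apply: ereal_sup_ubound; exists phi.
rewrite [leRHS](_ : _ = (l / t')%:E * area E)%E// -integral_cst//.
by apply: eq_integral => x; rewrite inE => /ET Tx; rewrite divE.
Qed.

Lemma calibration S O p (w r t : R) Phi (E : set RR) : 0 < t -> p \in S ->
  (forall a, a \in S -> edist O a <= r) -> 0 <= r < w ->
  flux_bounded t (balls S w) Phi -> measurable E -> E `<=` balls S w ->
  (0 < area E)%E -> (t^-1%:E <= perimeter E / area E)%E.
Proof.
move=> t0 pS hO rw gP mE ET E0.
have T0 : balls S w !=set0.
  by exists O => a aS; apply: le_trans (hO a aS) _; lra.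
have [f lf gf] := flux_bounded_elip (ltW t0) pS T0 gP.
have hs l : 0 < l < 1 -> ((l / (t + (1 - l) * (w - r)))%:E * area E <= perimeter E)%E.
  by move=> l01; exact: (@calibration_shrunk S O p w r t l f).
have Ep : (area E < +oo)%E.
  by apply: (@area_closed_disk_lty p w) => // x /ET/(_ p pS); rewrite /closed_disk /= edistC.
have [A EA] : exists A, area E = A%:E.
  by exists (fine (area E)); rewrite fineK// ge0_fin_numE.
rewrite EA lte_fin in E0 hs *.
have hs' l : 0 < l < 1 -> ((l / (t + (1 - l) * (w - r)) * A)%:E <= perimeter E)%E.
  by move=> /hs; rewrite EFinM.
case: (perimeter E) hs' => [P hP| _|hP].
- rewrite inver gt_eqF// -EFinM lee_fin ler_pdivlMr// mulrC ler_pdivrMr//.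
  rewrite leNgt; apply/negP => lt.
  pose D := `|P| * (w - r) + A; have wr : 0 < w - r by lra.
  have D0 : 0 < D by rewrite ltr_wpDl// mulr_ge0// ltW.
  (* The limit [l -> 1] made explicit: for [l = 1 - e], with [e * D] at most half of [A - P * t],
     the bound for [l] contradicts [P * t < A]. *)
  pose e := Num.min (1 / 2) ((A - P * t) / (2 * D)).
  have e0 : 0 < e by rewrite lt_min !divr_gt0 ?subr_gt0// mulr_gt0.
  have e1 : e <= 1 / 2 by rewrite ge_min lexx.
  have eD : e * D <= (A - P * t) / 2.
    have -> : (A - P * t) / 2 = (A - P * t) / (2 * D) * D by field; rewrite gt_eqF.
    by rewrite ler_pM2r// ge_min lexx orbT.
  have := hP (1 - e); rewrite lee_fin; have -> : 0 < 1 - e < 1 by lra.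
  have -> : 1 - (1 - e) = e by ring.
  have T0' : 0 < t + e * (w - r) by rewrite addr_gt0// mulr_gt0.
  rewrite mulrAC ler_pdivrMr// => /(_ isT) h.
  have hPn : P * (e * (w - r)) <= `|P| * (e * (w - r)).
    by apply: ler_wpM2r (ler_norm P); apply: mulr_ge0; exact: ltW.
  move: h hPn eD lt; rewrite /D; clear; lra.
- by rewrite inver gt_eqF// gt0_mulye ?leey// lte_fin invr_gt0.
- by have := hP (1 / 2); rewrite leeNy_eq => /(_ ltac:(lra)).
Qed.

End Calibration.

(** * Transfer to a Reuleaux triangle in general position *)

Section ReuleauxTransfer.
Context {R : realType}.
Local Notation q := (Num.sqrt 3 : R).
Implicit Types (a b c x y : R * R).

(** Areas scale by [w ^+ 2] and lengths by [w], whence the constant [w * t]; the term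
    [wedge z O / 2] corrects for [wedge] being taken about the origin instead of [O]. *)
Lemma flux_bounded_similar (w t : R) (f1 O : R * R) (U U' : set (R * R)) Phi : 0 < w ->
  dot f1 f1 = 1 ->
  let N z : R * R := (w^-1 * dot f1 (z - O), w^-1 * wedge f1 (z - O)) in
  (forall z, U z -> U' (N z)) -> flux_bounded t U' Phi ->
  flux_bounded (w * t) U (fun z => w ^+ 2 * Phi (N z) + wedge z O / 2).
Proof.
move=> w0 f11 N hN gP x y Ux Uy.
have := gP _ _ (hN _ Ux) (hN _ Uy).
have -> : edist (N x) (N y) = w^-1 * edist x y.
  rewrite /edist; apply: enorm_eq; first by rewrite mulr_ge0 ?enorm_ge0// invr_ge0 ltW.
  rewrite exprMn enorm_sqr -[X in _ = _ * X]mul1r -f11 /N /dot /wedge /=; ring.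
have -> : wedge (N x) (N y) = w^-1 ^+ 2 * wedge (x - O) (y - O).
  rewrite -[X in _ = _ * X]mul1r -f11 /N /dot /wedge /=; ring.
move=> h; have {}h : w ^+ 2 * (Phi (N y) - Phi (N x) + w^-1 ^+ 2 * wedge (x - O) (y - O) / 2) <=
    w ^+ 2 * (t * (w^-1 * edist x y)) by rewrite ler_pM2l// exprn_gt0.
have w_neq0 : w != 0 by rewrite gt_eqF.
have e1 : w ^+ 2 * (t * (w^-1 * edist x y)) = w * t * edist x y by field.
have e2 : w ^+ 2 * (Phi (N y) - Phi (N x) + w^-1 ^+ 2 * wedge (x - O) (y - O) / 2) =
  w ^+ 2 * Phi (N y) + wedge y O / 2 - (w ^+ 2 * Phi (N x) + wedge x O / 2) + wedge x y / 2.
  by rewrite /wedge /=; field.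
by rewrite -e1 -e2.
Qed.

Lemma dot_sub_edist a b c : dot (b - a) (c - a) =
  (edist a b ^+ 2 + edist c a ^+ 2 - edist b c ^+ 2) / 2.
Proof. by rewrite /edist !enorm_sqr /dot /=; field. Qed.

Lemma reuleaux_flux (w : R) a b c (t : R) Phi : 0 < w ->
  edist a b = w -> edist b c = w -> edist c a = w ->
  0 <= wedge (b - a) (c - a) ->
  flux_bounded t (std_reuleaux q) Phi ->
  exists Phi' O, flux_bounded (w * t) (balls [:: a; b; c] w) Phi' /\
    (forall p, p \in [:: a; b; c] -> edist O p <= 3 / 4 * w).
Proof.
move=> w0 ab bc ca or gP.
have q2 : q ^+ 2 = 3 by exact: sqrt3_sqr.
have q0 : 0 < q by exact: sqrt3_gt0.
have qb := sqrt3_itv q2 q0.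
have [u uE] : exists u, u = b - a by eexists.
have [v vE] : exists v, v = c - a by eexists.
have uu : dot u u = w ^+ 2.
  by rewrite uE -enorm_sqr -/(edist b a) edistC ab.
have uv : dot u v = w ^+ 2 / 2.
  by rewrite uE vE dot_sub_edist ab bc ca; ring.
have vv : dot v v = w ^+ 2 by rewrite vE -enorm_sqr -/(edist c a) ca.
rewrite -uE -vE in or.
have uwv : wedge u v = q / 2 * w ^+ 2.
  apply/eqP; rewrite -(@eqrXn2 _ 2)//; last by rewrite !mulr_ge0 ?invr_ge0 ?exprn_ge0// ltW.
  have := dot_wedge u v; rewrite uu uv vv => h.
  apply/eqP; rewrite exprMn expr_div_n q2; lra.
have w_neq0 : w != 0 by rewrite gt_eqF.
have v1 : v.1 = u.1 / 2 - q / 2 * u.2.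
  apply: (mulfI (expf_neq0 2 w_neq0)); rewrite -{1}uu.
  transitivity (dot u v * u.1 - wedge u v * u.2); first by rewrite /dot /wedge; ring.
  by rewrite uv uwv; ring.
have v2 : v.2 = u.2 / 2 + q / 2 * u.1.
  apply: (mulfI (expf_neq0 2 w_neq0)); rewrite -{1}uu.
  transitivity (dot u v * u.2 + wedge u v * u.1); first by rewrite /dot /wedge; ring.
  by rewrite uv uwv; ring.
pose O := 3^-1 *: (a + b + c).
(* The unit vector from the centroid [O] towards [a]: the side [u - v = b - c] turned clockwise by a
   right angle and normalised. *)
pose f1 : R * R := (w^-1 * (u - v).2, - (w^-1 * (u - v).1)).
have f11 : dot f1 f1 = 1.
  have -> : dot f1 f1 = w^-1 ^+ 2 * (dot u u - 2 * dot u v + dot v v).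
    by rewrite /dot /f1 /=; ring.
  by rewrite uu uv vv; field.
pose N z : R * R := (w^-1 * dot f1 (z - O), w^-1 * wedge f1 (z - O)).
have bE : b = a + u by rewrite uE addrC subrK.
have cE : c = a + v by rewrite vE addrC subrK.
have u2 : u.1 ^+ 2 + u.2 ^+ 2 = w ^+ 2 by rewrite -uu /dot !expr2.
have NE z p : edist (N z) (N p) = edist z p / w.
  rewrite /edist; apply: enorm_eq; first by rewrite divr_ge0 ?enorm_ge0// ltW.
  rewrite exprMn enorm_sqr -[X in _ = X * _]mul1r -f11 /N /dot /wedge /=; ring.
have Na : N a = (q / 3, 0).
  apply: plane_eq; rewrite /N /O bE cE /f1 /dot /wedge /= v1 v2 /GRing.scale /=.
    transitivity (q / 3 * ((u.1 ^+ 2 + u.2 ^+ 2) / w ^+ 2)); first by field.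
    by rewrite u2; field.
  transitivity ((q ^+ 2 - 3) * (u.1 ^+ 2 + u.2 ^+ 2) / (12 * w ^+ 2)); first by field.
  by rewrite q2 subrr !mul0r.
have Nb : N b = (- (q / 6), 1 / 2).
  apply: plane_eq; rewrite /N /O bE cE /f1 /dot /wedge /= v1 v2 /GRing.scale /=.
    transitivity (- (q / 6) * ((u.1 ^+ 2 + u.2 ^+ 2) / w ^+ 2)); first by field.
    by rewrite u2; field.
  transitivity ((3 + q ^+ 2) / 12 * ((u.1 ^+ 2 + u.2 ^+ 2) / w ^+ 2)); first by field.
  by rewrite q2 u2; field.
have Nc : N c = (- (q / 6), - (1 / 2)).
  apply: plane_eq; rewrite /N /O bE cE /f1 /dot /wedge /= v1 v2 /GRing.scale /=.
    transitivity (- (q / 6) * ((u.1 ^+ 2 + u.2 ^+ 2) / w ^+ 2)); first by field.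
    by rewrite u2; field.
  transitivity (- (q ^+ 2 / 6 * ((u.1 ^+ 2 + u.2 ^+ 2) / w ^+ 2))); first by field.
  by rewrite q2 u2; field.
have NO : N O = 0.
  by apply: plane_eq; rewrite /N /dot /wedge /= !subrr; ring.
exists (fun z => w ^+ 2 * Phi (N z) + wedge z O / 2), O; split.
  apply: flux_bounded_similar gP => // z hz.
  have hN p : p \in [:: a; b; c] -> edist (N z) (N p) <= 1.
    by move=> /hz h; rewrite NE ler_pdivrMr// mul1r.
  split.
  - by rewrite -Na; apply: hN; rewrite !inE eqxx.
  - by rewrite -Nb; apply: hN; rewrite !inE eqxx !orbT.
  - by rewrite -Nc; apply: hN; rewrite !inE eqxx !orbT.
(* In units of [w] the circumradius is the square root of [1 / 3], which is below [3 / 4]. *)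
have key p : p \in [:: a; b; c] -> dot (N p) (N p) = 1 / 3.
  rewrite !inE => /or3P[]/eqP ->; rewrite ?Na ?Nb ?Nc /dot /=; move: q2; lra.
move=> p hp; have h : edist O p = edist (N O) (N p) * w by rewrite NE mulfVK.
rewrite h ler_pM2r// NO edistC /edist subr0 enorm_le ?key//; lra.
Qed.

Lemma cheeger_reuleaux (b s t mu w : R) (T : set (R * R)) : 0 < w ->
  0 < b <= pi / 4 -> t = 1 - s -> mu = pi / 3 - b -> s * sin b = 1 / 2 ->
  1 / 2 <= s ^+ 2 -> 0 < s <= (3 + q) / 6 ->
  s ^+ 2 * mu - q / 3 * s * sin mu = pi / 3 * t ^+ 2 ->
  reuleaux_triangle w T -> (((w * t)^-1)%:E <= cheeger T)%E.
Proof.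
move=> w0 hb ht hmu hs hs2 hsi hE [a [b' [c [ab bc ca ->]]]].
have q2 : q ^+ 2 = 3 by exact: sqrt3_sqr.
have q0 : 0 < q by exact: sqrt3_gt0.
have qb := sqrt3_itv q2 q0.
have t0 : 0 < t by rewrite ht; lra.
have gP := flux_bounded_reuleaux q2 q0 hb ht hmu hs hs2 hsi hE.
have [Phi [P0 [gPhi hO]]] : exists Phi O,
    flux_bounded (w * t) (balls [:: a; b'; c] w) Phi /\
    (forall p, p \in [:: a; b'; c] -> edist O p <= 3 / 4 * w).
  have [or|or] := leP 0 (wedge (b' - a) (c - a)); first exact: reuleaux_flux gP.
  (* A clockwise labelling becomes counterclockwise on exchanging [b'] and [c]. *)
  have or' : 0 <= wedge (c - a) (b' - a).
    by move: or; rewrite /wedge => or; lra.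
  have [Phi [P0 [gPhi hO]]] := reuleaux_flux w0 (etrans (edistC _ _) ca)
     (etrans (edistC _ _) bc) (etrans (edistC _ _) ab) or' gP.
  exists Phi, P0; split; first apply: flux_bounded_sub gPhi.
    move=> x hx p; rewrite !inE => hp; apply: hx; rewrite !inE.
    by case/or3P: hp => ->; rewrite ?orbT.
  move=> p hp; apply: hO; move: hp; rewrite !inE.
  by case/or3P => ->; rewrite ?orbT.
apply: le_ereal_inf_tmp => _ [E [mE ET E0] <-].
apply: (@calibration R [:: a; b'; c] P0 a w (3 / 4 * w)) gPhi mE _ E0 => //.
- by rewrite mulr_gt0.
- by rewrite !inE eqxx.
- lra.
move=> x /ET; rewrite /closed_disk /= => -[[h1 h2] h3] p.
by rewrite !inE edistC => /or3P[]/eqP ->.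
Qed.

End ReuleauxTransfer.

(** * The divergence theorem on triangles *)

Section AffineChange.
Context {R : realType}.
Local Notation mu := (@lebesgue_measure R).
Local Notation RR := (measurableTypeR R * measurableTypeR R)%type.

Let continuous_line (a b : R) : continuous (fun u : R => a * u + b).
Proof.
move=> u; apply: cvgD; last exact: cvg_cst.
by apply: cvgM; [exact: cvg_cst|exact: cvg_id].
Qed.

Let measurable_line (a b : R) : measurable_fun [set: measurableTypeR R]
  (fun u : R => a * u + b : measurableTypeR R).
Proof. by apply: continuous_measurable_fun; exact: continuous_line. Qed.

Lemma continuous_pair (f g : R * R -> R) : continuous f -> continuous g ->
  continuous (fun x => (f x, g x)).
Proof.
move=> cf cg x.
have := @cvg_pair (R * R)%type R R (nbhs x) (nbhs (f x)) (nbhs (g x)) _ _ _ f g (cf x) (cg x).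
exact.
Qed.

Lemma scaled_pushforward d1 d2 (T1 : measurableType d1) (T2 : measurableType d2)
    (m : {measure set T1 -> \bar R}) (f : T1 -> T2) (c : R) :
  measurable_fun [set: T1] f -> 0 <= c ->
  exists nu : {measure set T2 -> \bar R}, forall A, nu A = (c%:E * m (f @^-1` A))%E.
Proof.
move=> mf c0; unshelve eexists.
  unshelve refine (mscale (NngNum c0) (pushforward m f) : {measure set T2 -> \bar R}).
  exact: mf.
by [].
Qed.

(** The left side is a measure in [X], so by uniqueness it is enough to compare on half-open
    intervals; for negative [a] the preimage is closed at the other end. *)
Lemma lebesgue_affine (a b : R) (X : set (measurableTypeR R)) : a != 0 ->
  measurable X -> (`|a|%:E * mu ((fun u : R => (a * u + b)%R) @^-1` X) = mu X)%E.
Proof.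
move=> a0 mX; have [m mE] := scaled_pushforward mu (measurable_line a b) (normr_ge0 a).
rewrite -mE; apply/esym/lebesgue_measure_unique => // _ [[x y] /= _ <-].
rewrite mE lebesgue_measure_itv/= lte_fin.
have [ap|an] : 0 < a \/ a < 0.
  by move: a0; rewrite neq_lt => /orP[?|?]; [right|left].
  have -> : (fun u : R => a * u + b) @^-1` `]x, y] = `](x - b) / a, (y - b) / a]%classic.
    apply/seteqP; split => u /=; rewrite !in_itv/= ltr_pdivrMr// ler_pdivlMr// mulrC;
      by move=> /andP[? ?]; apply/andP; split; lra.
  rewrite lebesgue_measure_itv/= lte_fin ltr_pM2r ?invr_gt0// ltrD2r gtr0_norm//.
  case: ifP => _; last by rewrite mule0.
  by rewrite -!EFinB -EFinM; congr EFin; field.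
have -> : (fun u : R => a * u + b) @^-1` `]x, y] = `[(y - b) / a, (x - b) / a[%classic.
  apply/seteqP; split => u /=; rewrite !in_itv/= ltr_ndivlMr// ler_ndivrMr// mulrC;
    by move=> /andP[? ?]; apply/andP; split; lra.
rewrite lebesgue_measure_itv/= lte_fin ltr_nM2r ?invr_lt0// ltrD2r ltr0_norm//.
case: ifP => _; last by rewrite mule0.
by rewrite -!EFinB -EFinM; congr EFin; field.
Qed.

(** For an affine map [c] is the absolute value of the determinant. The formulation through
    preimages composes directly and is what a pushforward of measures uses. *)
Definition scales_area (L : R * R -> R * R) (c : R) : Prop :=
  [/\ continuous L, 0 <= c &
    forall B : set RR, measurable B -> (c%:E * area (L @^-1` B) = area B)%E].

Lemma continuous_measurable_map (L : R * R -> R * R) : continuous L ->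
  measurable_fun [set: RR] (L : RR -> RR).
Proof.
move=> cL; have -> : L = (fun x => ((L x).1, (L x).2)).
  by apply/funext => x; rewrite -surjective_pairing.
apply: measurable_fun_pair; apply: continuous_measurable_plane => x.
  by apply: continuous_comp; [exact: cL|exact: cvg_fst].
by apply: continuous_comp; [exact: cL|exact: cvg_snd].
Qed.

Lemma scales_area_comp L L' c c' : scales_area L c -> scales_area L' c' ->
  scales_area (L' \o L) (c' * c).
Proof.
move=> [cL c0 aL] [cL' c'0 aL']; split; first by move=> x; apply: continuous_comp; [exact: cL|exact: cL'].
  exact: mulr_ge0.
move=> B mB; rewrite EFinM -muleA comp_preimage aL ?aL'//.
rewrite -[X in measurable X]setTI; exact: (continuous_measurable_map cL').
Qed.

Lemma area_ysection (B : set RR) : measurable B ->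
  area B = (\int[mu]_y mu (ysection B y))%E.
Proof.
move=> mB; apply: (@product_measure_unique _ _ _ _ _ mu mu (mu \x^ mu)%E) => // A1 A2 m1 m2.
by have := @product_measure2E _ _ _ _ R mu mu A1 A2 m1 m2.
Qed.

Lemma scales_area_vert (a : R) (k : R -> R) : a != 0 -> continuous k ->
  scales_area (fun x => (x.1, a * x.2 + k x.1)) `|a|.
Proof.
move=> a0 ck; have cL : continuous (fun x : R * R => (x.1, a * x.2 + k x.1)).
  apply: continuous_pair => x; first exact: cvg_fst.
  apply: cvgD; first by apply: cvgM; [exact: cvg_cst|exact: cvg_snd].
  by apply: (@continuous_comp _ _ _ fst k); [exact: cvg_fst|exact: ck].
split=> // B mB; rewrite /area /product_measure1 -ge0_integralZl//; last first.
  apply: measurable_fun_xsection; rewrite -[X in measurable X]setTI.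
  exact: (continuous_measurable_map cL).
apply: eq_integral => x _ /=; rewrite -(lebesgue_affine (k x) a0 (measurable_xsection x mB)).
congr (_ * mu _)%E; apply/seteqP; split => y; rewrite /xsection /= !inE//.
Qed.

Lemma scales_area_horiz (a : R) (k : R -> R) : a != 0 -> continuous k ->
  scales_area (fun x => (a * x.1 + k x.2, x.2)) `|a|.
Proof.
move=> a0 ck; have cL : continuous (fun x : R * R => (a * x.1 + k x.2, x.2)).
  apply: continuous_pair => x; last exact: cvg_snd.
  apply: cvgD; first by apply: cvgM; [exact: cvg_cst|exact: cvg_fst].
  by apply: (@continuous_comp _ _ _ snd k); [exact: cvg_snd|exact: ck].
split=> // B mB.
have mLB : measurable ((fun x : RR => (a * x.1 + k x.2, x.2)) @^-1` B : set RR).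
  rewrite -[X in measurable X]setTI; exact: (continuous_measurable_map cL).
rewrite !area_ysection// -ge0_integralZl//; last first.
  exact: measurable_fun_ysection.
apply: eq_integral => x _ /=; rewrite -(lebesgue_affine (k x) a0 (measurable_ysection x mB)).
congr (_ * mu _)%E; apply/seteqP; split => y; rewrite /ysection /= !inE//.
Qed.

Definition affine (O P Q : R * R) (z : R * R) : R * R := O + (z.1 *: P + z.2 *: Q).

(** If [P.1 != 0], the map is one that acts on the first coordinate followed by one that acts on the
    second, and each is handled line by line. If [P.1 = 0], a preliminary shear replaces [P] by
    [P - Q], whose first coordinate is nonzero. *)
Lemma scales_area_affine O P Q : wedge P Q != 0 ->
  scales_area (affine O P Q) `|wedge P Q|.
Proof.
have ca (a b : R) : continuous (fun u : R => a * u + b) by exact: continuous_line.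
have gen P' : P'.1 != 0 -> wedge P' Q != 0 -> scales_area (affine O P' Q) `|wedge P' Q|.
  move=> P10 D0.
  have h1 := scales_area_horiz P10 (ca Q.1 O.1).
  have h2 : scales_area (fun x => (x.1, wedge P' Q / P'.1 * x.2 + (P'.2 / P'.1 * x.1 + (O.2 - P'.2 * O.1 / P'.1))))
     `|wedge P' Q / P'.1|.
    apply: (@scales_area_vert _ (fun u => P'.2 / P'.1 * u + (O.2 - P'.2 * O.1 / P'.1))).
      by rewrite mulf_neq0// invr_eq0.
    exact: ca.
  have := scales_area_comp h1 h2.
  have -> : `|wedge P' Q / P'.1| * `|P'.1| = `|wedge P' Q| by rewrite -normrM mulfVK.
  congr scales_area; apply/funext => z; apply: plane_eq; rewrite /affine /=.
    by rewrite /GRing.scale /=; ring.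
  by rewrite /GRing.scale /= /wedge /=; field.
move=> D0; have [P10|] := eqVneq P.1 0; last by move=> P10; exact: gen.
have Q10 : Q.1 != 0.
  by apply: contraNneq D0 => Q1; rewrite /wedge P10 Q1 mul0r mulr0 subrr.
have h1 := scales_area_vert (oner_neq0 R) (ca 1 0).
have wE : wedge (P - Q) Q = wedge P Q by rewrite /wedge /=; ring.
have h2 := gen (P - Q); rewrite wE /= P10 sub0r oppr_eq0 in h2.
have := scales_area_comp h1 (h2 Q10 D0); rewrite normr1 mulr1.
congr scales_area; apply/funext => z; apply: plane_eq; rewrite /affine /= /GRing.scale /=; ring.
Qed.

Lemma ge0_integral_scales_area L c (B : set RR) (g : RR -> \bar R) : scales_area L c ->
  measurable B -> measurable_fun [set: RR] g -> (forall x, (0 <= g x)%E) ->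
  (\int[area]_(x in B) g x = c%:E * \int[area]_(z in L @^-1` B) g (L z))%E.
Proof.
move=> [cL c0 aL] mB mg g0; have mL := continuous_measurable_map cL.
have mLB : measurable (L @^-1` B : set RR) by rewrite -[X in measurable X]setTI; exact: mL.
pose nu := @pushforward _ _ RR RR R (mscale (NngNum c0) area) L.
rewrite (@eq_measure_integral _ RR R B nu); last first.
  by move=> A mA _; apply/esym; exact: aL.
rewrite ge0_integral_pushforward//; last exact: measurable_funTS.
have mgL : measurable_fun (L @^-1` B : set RR) (g \o L).
  by apply: measurable_funTS; exact: (measurableT_comp mg mL).
by apply: ge0_integral_mscale => // z _; exact: g0.
Qed.

Lemma Rintegral_scales_area L c (B : set RR) (f : R * R -> R) : scales_area L c ->
  0 < c -> measurable B -> continuous f -> area.-integrable B (EFin \o f) ->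
  (\int[area]_(x in B) f x = c * \int[area]_(z in L @^-1` B) f (L z))%R.
Proof.
move=> sL cp mB cf If.
have mf : measurable_fun [set: RR] (EFin \o f).
  by apply/measurable_EFinP; exact: continuous_measurable_plane.
have hp := ge0_integral_scales_area sL mB (measurable_funepos mf) (funepos_ge0 _).
have hn := ge0_integral_scales_area sL mB (measurable_funeneg mf) (funeneg_ge0 _).
have fp := integral_funepos_lt_pinfty mB If; have fn := integral_funeneg_lt_pinfty mB If.
have fin (X : \bar R) : (0 <= X)%E -> (c%:E * X < +oo)%E -> exists x, X = x%:E.
  case: X => [x _ _|_|//]; first by exists x.
  by rewrite gt0_muley ?lte_fin.
rewrite hp in fp; rewrite hn in fn.
have [x xE] := fin _ (integral_ge0 _ (fun z _ => funepos_ge0 _ _)) fp.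
have [y yE] := fin _ (integral_ge0 _ (fun z _ => funeneg_ge0 _ _)) fn.
have e1 := integralE area B (EFin \o f); rewrite hp hn xE yE in e1.
have e2 := integralE area (L @^-1` B) (EFin \o (f \o L)).
have xE' : (\int[area]_(z in L @^-1` B) (EFin \o (f \o L))^\+ z = x%:E)%E.
  by rewrite -xE; apply: eq_integral => z _; rewrite !funeposE.
have yE' : (\int[area]_(z in L @^-1` B) (EFin \o (f \o L))^\- z = y%:E)%E.
  by rewrite -yE; apply: eq_integral => z _; rewrite !funenegE.
rewrite xE' yE' in e2.
transitivity (fine (c%:E * x%:E - c%:E * y%:E)); first by rewrite -e1.
transitivity (c * fine (x%:E - y%:E)); last by rewrite -e2.
by rewrite /=; ring.
Qed.

End AffineChange.

(** * Directional derivatives from continuous partial derivatives *)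

Section ChainRule.
Context {R : realType}.
Implicit Types (f : R * R -> R) (x d : R * R).

Lemma is_derive_slice1 f x : derivable f x e1 ->
  is_derive x.1 1 (fun u : R => f (u, x.2)) ('D_e1 f x).
Proof.
move=> df.
have e : (fun h : R => h^-1 *: ((f \o shift x) (h *: e1) - f x)) =
  (fun h : R => h^-1 *: (((fun u : R => f (u, x.2)) \o shift x.1) (h *: 1) - f (x.1, x.2))).
  apply/funext => h /=; rewrite -surjective_pairing; congr (_ *: (f _ - _)).
  by apply: plane_eq; rewrite /= /GRing.scale /= ?mulr0 ?add0r.
apply: DeriveDef; first by move: df; rewrite /derivable e.
by rewrite /derive e.
Qed.

Lemma is_derive_slice2 f x : derivable f x e2 ->
  is_derive x.2 1 (fun u : R => f (x.1, u)) ('D_e2 f x).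
Proof.
move=> df.
have e : (fun h : R => h^-1 *: ((f \o shift x) (h *: e2) - f x)) =
  (fun h : R => h^-1 *: (((fun u : R => f (x.1, u)) \o shift x.2) (h *: 1) - f (x.1, x.2))).
  apply/funext => h /=; rewrite -surjective_pairing; congr (_ *: (f _ - _)).
  by apply: plane_eq; rewrite /= /GRing.scale /= ?mulr0 ?add0r.
apply: DeriveDef; first by move: df; rewrite /derivable e.
by rewrite /derive e.
Qed.

Lemma mean_value (g dg : R -> R) (a k : R) : (forall u : R, is_derive u 1 g (dg u)) ->
  exists2 l, 0 <= l <= 1 & g (a + k) - g a = k * dg (a + l * k).
Proof.
move=> dg1.
have mv (p q : R) : p < q -> exists2 c, p < c < q & g q - g p = dg c * (q - p).
  move=> pq; have [|c] := @MVT R g dg p q pq (fun u _ => dg1 u).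
    by apply: derivable_within_continuous => u _; have [] := dg1 u.
  by rewrite in_itv /=; exists c.
have [k0|k0|->] := ltgtP k 0.
- have [|c /andP[c1 c2] h] := mv (a + k) a; first lra.
  exists ((c - a) / k); last by rewrite mulfVK ?lt_eqF// subrKC; lra.
  by rewrite ler_ndivlMr// ler_ndivrMr// mul0r mul1r; apply/andP; split; lra.
- have [|c /andP[c1 c2] h] := mv a (a + k); first lra.
  exists ((c - a) / k); last by rewrite mulfVK ?gt_eqF// subrKC; lra.
  by rewrite ler_pdivlMr// ler_pdivrMr// mul0r mul1r; apply/andP; split; lra.
- by exists 0; rewrite ?lexx ?ler01// addr0 mul0r subrr.
Qed.

(** [C1] speaks only of the coordinate directions. The increment is split into a vertical and a
    horizontal one, the mean value theorem is applied to each, and continuity of the partial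
    derivatives gives the limit. *)
Lemma is_derive_C1_0 f x d : C1 f ->
  is_derive (0 : R) 1 (fun h : R => f (x + h *: d)) (d.1 * 'D_e1 f x + d.2 * 'D_e2 f x).
Proof.
move=> C1f; have [df1 cf1] := C1f e1 (or_introl erefl).
have [df2 cf2] := C1f e2 (or_intror erefl).
set l := (_ + _).
suff cl : (fun h : R => h^-1 *: (((fun h : R => f (x + h *: d)) \o shift 0) (h *: 1) -
    f (x + 0 *: d))) h @[h --> 0^'] --> l.
  apply: DeriveDef; first by apply/cvg_ex; exists l.
  exact: cvg_lim cl.
apply/cvgrPdist_le => e e0.
pose M := `|d.1| + `|d.2| + 1; have M0 : 0 < M.
  by rewrite /M; have := normr_ge0 d.1; have := normr_ge0 d.2; lra.
have e'0 : 0 < e / M by exact: divr_gt0.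
have /cvgrPdist_le/(_ _ e'0)/nbhs_ballP[r1 /= r10 h1] := cf1 x.
have /cvgrPdist_le/(_ _ e'0)/nbhs_ballP[r2 /= r20 h2] := cf2 x.
near=> h.
have hn0 : h != 0 by near: h; exact: nbhs_dnbhs_neq.
have hr : `|h| < Num.min r1 r2 / M.
  by near: h; apply: dnbhs0_lt; rewrite divr_gt0// lt_min r10.
have hd (c : R) : `|c| <= M -> `|h * c| < Num.min r1 r2.
  move=> cM; rewrite normrM; apply: (@le_lt_trans _ _ (`|h| * M)).
    exact: ler_wpM2l.
  by rewrite -ltr_pdivlMr.
have d1M : `|d.1| <= M by rewrite /M; have := normr_ge0 d.2; lra.
have d2M : `|d.2| <= M by rewrite /M; have := normr_ge0 d.1; lra.
have [a1 /andP[a10 a11] E1] := @mean_value (fun u => f (u, x.2 + h * d.2))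
  (fun u => 'D_e1 f (u, x.2 + h * d.2)) x.1 (h * d.1)
  (fun u => is_derive_slice1 (df1 (u, x.2 + h * d.2))).
have [a2 /andP[a20 a21] E2] := @mean_value (fun u => f (x.1, u))
  (fun u => 'D_e2 f (x.1, u)) x.2 (h * d.2)
  (fun u => is_derive_slice2 (df2 (x.1, u))).
rewrite /= in E1 E2.
have small a (c : R) : 0 <= a -> a <= 1 -> `|c| <= M -> `|a * (h * c)| < Num.min r1 r2.
  move=> a0 al cM; rewrite normrM ger0_norm//; apply: le_lt_trans (hd c cM).
  by rewrite ler_piMl.
have B1 : `|'D_e1 f x - 'D_e1 f (x.1 + a1 * (h * d.1), x.2 + h * d.2)| <= e / M.
  apply: h1; split; rewrite /ball /= opprD addNKr normrN.
    by have := small a1 d.1 a10 a11 d1M; rewrite lt_min => /andP[].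
  by have := hd d.2 d2M; rewrite lt_min => /andP[].
have B2 : `|'D_e2 f x - 'D_e2 f (x.1, x.2 + a2 * (h * d.2))| <= e / M.
  apply: h2; split; rewrite /ball /=; first by rewrite subrr normr0.
  rewrite opprD addNKr normrN.
  by have := small a2 d.2 a20 a21 d2M; rewrite lt_min => /andP[].
rewrite /= scale0r !addr0 /GRing.scale /= mulr1.
have -> : x + h *: d = (x.1 + h * d.1, x.2 + h * d.2) by [].
have -> : f (x.1 + h * d.1, x.2 + h * d.2) - f x =
   h * (d.1 * 'D_e1 f (x.1 + a1 * (h * d.1), x.2 + h * d.2) +
        d.2 * 'D_e2 f (x.1, x.2 + a2 * (h * d.2))).
  by move: E1 E2; rewrite -surjective_pairing; lra.
rewrite mulKf// /l.
set A1 := 'D_e1 f (_, _) in B1 *; set A2 := 'D_e2 f (_, _) in B2 *.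
have -> : d.1 * 'D_e1 f x + d.2 * 'D_e2 f x - (d.1 * A1 + d.2 * A2) =
   d.1 * ('D_e1 f x - A1) + d.2 * ('D_e2 f x - A2) by ring.
apply: le_trans (ler_normD _ _) _; rewrite !normrM.
apply: (@le_trans _ _ (`|d.1| * (e / M) + `|d.2| * (e / M))).
  by apply: lerD; exact: ler_wpM2l.
rewrite -mulrDl mulrA ler_pdivrMr// mulrC ler_pM2l// /M; lra.
Unshelve. all: by end_near. Qed.

Lemma is_derive_C1 f x d (h : R) : C1 f ->
  is_derive h 1 (fun h : R => f (x + h *: d))
    (d.1 * 'D_e1 f (x + h *: d) + d.2 * 'D_e2 f (x + h *: d)).
Proof.
move=> C1f; have d0 := is_derive_C1_0 (x + h *: d) d C1f.
have d1 := is_derive_addr (- h) h; rewrite -(subrr h) in d0.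
have := @is_derive1_comp R _ _ h _ _ d0 d1; rewrite mulr1.
congr (is_derive _ _ _ _); apply/funext => u /=.
by congr f; rewrite -addrA -scalerDl subrKC.
Qed.

End ChainRule.

(** * Integrals of partial derivatives over the unit simplex *)

Section Simplex.
Context {R : realType}.
Local Notation mu := (@lebesgue_measure R).
Local Notation RR := (measurableTypeR R * measurableTypeR R)%type.

Lemma integrable_continuous_plane (f : R * R -> R) (E B : set RR) : continuous f ->
  measurable E -> compact (B : set (R * R)) -> E `<=` B -> (area E < +oo)%E ->
  area.-integrable E (EFin \o f).
Proof.
move=> cf mE cB EB Efin; apply: measurable_bounded_integrable => //.
  exact: measurable_funTS (continuous_measurable_plane cf).
have := compact_bounded (continuous_compact (continuous_subspaceT cf) cB).
move=> [M [Mr MP]]; exists M; split => // x Mx y Ey.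
by apply: MP => //; exists y => //; exact: EB.
Qed.

Definition simplex : set (R * R) := [set z | [/\ 0 < z.1, 0 < z.2 & z.1 + z.2 < 1]].

Lemma open_gt0_affine (a b c : R) : open [set z : R * R | 0 < a * z.1 + b * z.2 + c].
Proof.
have cf : continuous (fun z : R * R => a * z.1 + b * z.2 + c).
  move=> z; apply: cvgD; last exact: cvg_cst.
  apply: cvgD; apply: cvgM; try exact: cvg_cst; [exact: cvg_fst|exact: cvg_snd].
have := @open_comp _ _ (fun z : R * R => a * z.1 + b * z.2 + c) [set u | 0 < u]
  (fun z _ => cf z) (@open_gt R 0).
exact.
Qed.

Lemma measurable_simplex : @measurable _ RR simplex.
Proof.
apply: open_measurable_plane.
have -> : simplex = [set z | 0 < 1 * z.1 + 0 * z.2 + 0] `&`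
   [set z | 0 < 0 * z.1 + 1 * z.2 + 0] `&` [set z | 0 < -1 * z.1 + -1 * z.2 + 1].
  apply/seteqP; split => z; rewrite /simplex /=.
    by move=> [h1 h2 h3]; split; [split|]; lra.
  by move=> [[h1 h2] h3]; split; lra.
by apply: openI; [apply: openI|]; exact: open_gt0_affine.
Qed.

Local Notation II := (`[0%R, 1%R] `*` `[0%R, 1%R] : set (R * R)).

Lemma simplex_sub : simplex `<=` II.
Proof.
by move=> z [h1 h2 h3]; split; rewrite /= in_itv /=; apply/andP; split; lra.
Qed.

Lemma area_simplex_fin (E : set RR) : measurable E -> E `<=` II -> (area E < +oo)%E.
Proof.
move=> mE EI; apply: (@le_lt_trans _ _ (area (II : set RR))).
  by apply: le_measure; rewrite ?inE//; exact: measurableX.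
by rewrite /area product_measure1E//= !lebesgue_measure_itv /= lte_fin ltr01 -EFinB -EFinM ltry.
Qed.

Let integral_simplex_slice (g dg : R -> R) (v : R) : v < 1 ->
  (forall u : R, is_derive u 1 g (dg u)) -> continuous dg ->
  (\int[mu]_(u in `]0%R, (1 - v)%R[) (dg u)%:E = (g (1 - v) - g 0)%:E)%E.
Proof.
move=> v1 dg1 cdg.
have cg : continuous g.
  by move=> u; apply: differentiable_continuous; apply/derivable1_diffP; have [] := dg1 u.
rewrite -(@integral_itv_bndoo R 0 (1 - v) (EFin \o dg) true false); last first.
  by apply/measurable_EFinP; apply: measurable_funTS; exact: continuous_measurable_fun.
rewrite (@continuous_FTC2 R dg g)//; first by lra.
- exact: continuous_subspaceT.
- split.
  + by move=> u _; have [] := dg1 u.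
  + by apply: cvg_at_right_filter; exact: cg.
  + by apply: cvg_at_left_filter; exact: cg.
- by move=> u _; rewrite derive1E; have [_ ->] := dg1 u.
Qed.

Let measurable_slices (g : R -> R) : continuous g ->
  measurable_fun (`]0%R, 1%R[ : set (measurableTypeR R)) (EFin \o g).
Proof.
move=> cg; apply/measurable_EFinP; apply: measurable_funTS.
exact: continuous_measurable_fun.
Qed.

Let integrable_simplex (G1 : R * R -> R) : continuous G1 ->
  area.-integrable [set: RR] ((EFin \o G1) \_ simplex).
Proof.
move=> cG1; have mS := measurable_simplex.
have cII : compact II by apply: compact_setX; exact: segment_compact.
apply/(@integrable_mkcond _ _ _ _ _ _ mS).
apply: (integrable_continuous_plane cG1 mS cII simplex_sub).
exact: area_simplex_fin simplex_sub.
Qed.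

Lemma integral_simplex1 (G G1 : R * R -> R) : continuous G1 ->
  (forall z : R * R, is_derive z.1 1 (fun u : R => G (u, z.2)) (G1 z)) ->
  continuous (fun v : R => G (1 - v, v) - G (0, v)) ->
  (\int[area]_(z in simplex) G1 z =
   \int[mu]_(v in `[0%R, 1%R]) (G ((1 - v)%R, v) - G (0%R, v)))%R.
Proof.
move=> cG1 dG cg; rewrite /Rintegral; congr fine; rewrite integral_mkcond.
have <- := integral21_prod_meas1 (integrable_simplex cG1).
rewrite (@integral_itv_bndoo R 0 1 _ true false); last exact: measurable_slices.
rewrite [RHS]integral_mkcond; apply: eq_integral => v _.
rewrite [RHS]patchE; case: ifPn => vI.
  move: vI; rewrite inE /= in_itv /= => /andP[v0 v1].
  have hs := @integral_simplex_slice (fun u => G (u, v)) (fun u => G1 (u, v)) v v1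
    (fun u => dG (u, v)) (@continuous_slice2 R G1 v cG1).
  rewrite /= in hs; rewrite -hs.
  - rewrite [RHS]integral_mkcond; apply: eq_integral => u _; rewrite !patchE.
    congr (if _ then _ else _); apply/idP/idP; rewrite !inE /simplex /= in_itv /=.
      by move=> [h1 h2 h3]; apply/andP; split; lra.
    by move=> /andP[h1 h2]; split => //; lra.
apply: integral0_eq => u _; rewrite patchE; case: ifPn => //.
rewrite inE => -[/= h1 h2 h3]; move: vI; rewrite notin_setE /= in_itv /=.
by case; apply/andP; split; lra.
Qed.

Lemma integral_simplex2 (G G2 : R * R -> R) : continuous G2 ->
  (forall z : R * R, is_derive z.2 1 (fun u : R => G (z.1, u)) (G2 z)) ->
  continuous (fun v : R => G (v, 1 - v) - G (v, 0)) ->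
  (\int[area]_(z in simplex) G2 z =
   \int[mu]_(v in `[0%R, 1%R]) (G (v, (1 - v)%R) - G (v, 0%R)))%R.
Proof.
move=> cG2 dG cg; rewrite /Rintegral; congr fine; rewrite integral_mkcond.
have <- := integral12_prod_meas1 (integrable_simplex cG2).
rewrite (@integral_itv_bndoo R 0 1 _ true false); last exact: measurable_slices.
rewrite [RHS]integral_mkcond; apply: eq_integral => v _.
rewrite [RHS]patchE; case: ifPn => vI.
  move: vI; rewrite inE /= in_itv /= => /andP[v0 v1].
  have hs := @integral_simplex_slice (fun u => G (v, u)) (fun u => G2 (v, u)) v v1
    (fun u => dG (v, u)) (@continuous_slice1 R G2 v cG2).
  rewrite /= in hs; rewrite -hs.
  - rewrite [RHS]integral_mkcond; apply: eq_integral => u _; rewrite !patchE.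
    congr (if _ then _ else _); apply/idP/idP; rewrite !inE /simplex /= in_itv /=.
      by move=> [h1 h2 h3]; apply/andP; split; lra.
    by move=> /andP[h1 h2]; split => //; lra.
apply: integral0_eq => u _; rewrite patchE; case: ifPn => //.
rewrite inE => -[/= h1 h2 h3]; move: vI; rewrite notin_setE /= in_itv /=.
by case; apply/andP; split; lra.
Qed.

Lemma area_simplex : area simplex = (1 / 2)%:E.
Proof.
have fS := area_simplex_fin measurable_simplex simplex_sub.
have cl : continuous (fun v : R => (1 - v : R) - 0).
  by move=> v; apply: cvgB; [apply: cvgB; [exact: cvg_cst|exact: cvg_id]|exact: cvg_cst].
have : (\int[area]_(z in simplex) (1 : R) = 1 / 2)%R.
  rewrite (@integral_simplex1 (fun z => z.1) (fun=> 1))//=; last first.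
    by move=> x; first [exact: cvg_cst|exact: is_derive_id].
  rewrite /Rintegral (@continuous_FTC2 R (fun v : R => (1 - v) - 0) (fun v : R => v - v * v / 2))//=.
  - by rewrite !mulr0 !mul0r mul1r; lra.
  - exact: continuous_subspaceT.
  - have cF : continuous (fun v : R => v - v * v / 2).
      move=> v; apply: cvgB; first exact: cvg_id.
      by apply: cvgM; [apply: cvgM; exact: cvg_id|exact: cvg_cst].
    split.
    + move=> u _; by apply: derivableB => //; apply: derivableM => //; apply: derivableM.
    + by apply: cvg_at_right_filter; exact: cF.
    + by apply: cvg_at_left_filter; exact: cF.
  - move=> u _; rewrite derive1E.
    have d : is_derive u 1 (fun v : R => v - v * v / 2) (1 - u - 0).
      have -> : (fun v : R => v - v * v / 2) = id - 2^-1 \*: (id * id).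
        by apply/funext => v; rewrite /= mulrC.
      by apply: is_derive_eq; rewrite /GRing.scale /=; field.
    by have [_ ->] := d.
rewrite Rintegral_cst//; last exact: measurable_simplex.
rewrite mul1r => <-; rewrite fineK// ge0_fin_numE//.
Qed.

End Simplex.

Lemma continuous_lin2 (R : realType) (T : topologicalType) (f g : T -> R) (a b : R) :
  continuous f -> continuous g -> continuous (fun z => a * f z + b * g z).
Proof.
move=> cf cg z; apply: cvgD; apply: cvgM; try exact: cvg_cst; [exact: cf|exact: cg].
Qed.

Section Triangle.
Context {R : realType}.
Local Notation mu := (@lebesgue_measure R).
Local Notation RR := (measurableTypeR R * measurableTypeR R)%type.
Implicit Types (O P Q x : R * R) (phi : R * R -> R * R).

(* The open triangle [O, O + P, O + Q], for a positively oriented pair [(P, Q)]. *)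
Definition triangle O P Q : set (R * R) :=
  [set x | [/\ 0 < wedge (x - O) Q, 0 < wedge P (x - O) &
    wedge (x - O) Q + wedge P (x - O) < wedge P Q]].

Lemma affine_triangle O P Q : 0 < wedge P Q ->
  affine O P Q @^-1` triangle O P Q = simplex.
Proof.
move=> D0; apply/seteqP; rewrite /triangle /simplex.
have h1 z : wedge (affine O P Q z - O) Q = wedge P Q * z.1.
  by rewrite /affine /wedge /= /GRing.scale /=; ring.
have h2 z : wedge P (affine O P Q z - O) = wedge P Q * z.2.
  by rewrite /affine /wedge /= /GRing.scale /=; ring.
have h3 z : (wedge P Q * (z.1 + z.2) < wedge P Q) = (z.1 + z.2 < 1).
  by rewrite -[X in _ < X]mulr1 ltr_pM2l.
by split => z /=; rewrite !h1 !h2 -mulrDr !(pmulr_rgt0 _ D0) h3.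
Qed.

Lemma measurable_triangle O P Q : @measurable _ RR (triangle O P Q).
Proof.
apply: open_measurable_plane.
have -> : triangle O P Q =
   [set z | 0 < Q.2 * z.1 + (- Q.1) * z.2 + (O.2 * Q.1 - O.1 * Q.2)] `&`
   [set z | 0 < (- P.2) * z.1 + P.1 * z.2 + (P.2 * O.1 - P.1 * O.2)] `&`
   [set z | 0 < (P.2 - Q.2) * z.1 + (Q.1 - P.1) * z.2 +
     (P.1 * Q.2 - P.2 * Q.1 + O.1 * (Q.2 - P.2) - O.2 * (Q.1 - P.1))].
  apply/seteqP; split => z; rewrite /triangle /wedge /=.
    by move=> [h1 h2 h3]; split; [split|]; lra.
  by move=> [[h1 h2] h3]; split; lra.
by apply: openI; [apply: openI|]; exact: open_gt0_affine.
Qed.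

Lemma area_triangle O P Q : 0 < wedge P Q ->
  area (triangle O P Q) = (wedge P Q / 2)%:E.
Proof.
move=> D0; have [_ _ <-] := scales_area_affine O (lt0r_neq0 D0).
  by rewrite affine_triangle// area_simplex gtr0_norm// -EFinM mul1r.
exact: measurable_triangle.
Qed.

(** The flux of [phi] across the segment from [O] to [O + P]. In a fan of triangles every inner
    segment occurs twice, with opposite signs. *)
Definition ray_flux phi O P : R := (\int[mu]_(v in `[0%R, 1%R]) wedge (phi (O + v *: P)) P)%R.

Definition edge_flux phi O P Q : R :=
  (\int[mu]_(v in `[0%R, 1%R]) wedge (phi (O + P + v *: (Q - P))) (Q - P))%R.

Lemma continuous_C1_line f x d : C1 f -> continuous (fun h : R => f (x + h *: d)).
Proof.
move=> C1f h; apply: differentiable_continuous; apply/derivable1_diffP.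
by have [] := is_derive_C1 x d h C1f.
Qed.

Lemma integrable_continuous_01 (g : R -> R) : continuous g ->
  mu.-integrable `[0%R, 1%R] (EFin \o g).
Proof.
move=> cg; apply: continuous_compact_integrable; first exact: segment_compact.
exact: continuous_subspaceT.
Qed.

Variable phi : R * R -> R * R.
Hypothesis C1_1 : C1 (fun x => (phi x).1).
Hypothesis C1_2 : C1 (fun x => (phi x).2).

Lemma continuous_divergence : continuous (divergence phi).
Proof.
move=> x; apply: cvgD.
  by have [_ c] := C1_1 (or_introl erefl); exact: c.
by have [_ c] := C1_2 (or_intror erefl); exact: c.
Qed.

Lemma integrable_divergence (E : set RR) : measurable E -> (area E < +oo)%E ->
  (exists2 B, compact (B : set (R * R)) & E `<=` B) ->
  area.-integrable E (EFin \o divergence phi).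
Proof.
move=> mE fE [B cB EB]; exact: integrable_continuous_plane continuous_divergence mE cB EB fE.
Qed.

Lemma continuous_wedge_line x d P : continuous (fun h : R => wedge (phi (x + h *: d)) P).
Proof.
move=> h; apply: cvgB; apply: cvgM; try exact: cvg_cst.
  exact: (@continuous_C1_line (fun x => (phi x).1) x d C1_1 h).
exact: (@continuous_C1_line (fun x => (phi x).2) x d C1_2 h).
Qed.

Lemma triangle_bounded O P Q : 0 < wedge P Q ->
  exists2 B, compact (B : set (R * R)) & triangle O P Q `<=` B.
Proof.
move=> D0; exists (closed_disk O (enorm P + enorm Q)); first exact: compact_closed_disk.
move=> x [h1 h2 h3]; rewrite /closed_disk /= edistC /edist.
have -> : x - O = (wedge (x - O) Q / wedge P Q) *: P + (wedge P (x - O) / wedge P Q) *: Q.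
  have D1 : wedge P Q != 0 by rewrite gt_eqF.
  move: (x - O) D1 => z D1; apply: plane_eq; rewrite /= /GRing.scale /= /wedge /=;
    rewrite /wedge in D1; field; exact: D1.
apply: le_trans (enormD _ _) _; rewrite !enormZ.
have le1 a : 0 < a -> a < wedge P Q -> `|a / wedge P Q| <= 1.
  by move=> a0 a1; rewrite gtr0_norm ?divr_gt0// ler_pdivrMr// mul1r ltW.
by apply: lerD; apply: ler_piMl; rewrite ?enorm_ge0//; apply: le1 => //; lra.
Qed.

(** Pulled back to the simplex by [A], the divergence times the determinant is the derivative of
    [wedge (phi (A z)) Q] in the first variable plus that of [wedge P (phi (A z))] in the second.
    Each summand integrates along one family of parallel segments. *)
Lemma triangle_divergence O P Q : 0 < wedge P Q ->
  (\int[area]_(x in triangle O P Q) divergence phi x)%R =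
  ray_flux phi O P + edge_flux phi O P Q - ray_flux phi O Q.
Proof.
move=> D0; set A := affine O P Q.
have sA : scales_area A (wedge P Q).
  by have := scales_area_affine O (lt0r_neq0 D0); rewrite gtr0_norm.
have mT := measurable_triangle O P Q.
have cdiv := continuous_divergence.
rewrite (Rintegral_scales_area sA D0 mT cdiv); last first.
  apply: integrable_divergence => //; last exact: triangle_bounded.
  by rewrite area_triangle// ltry.
rewrite affine_triangle//.
have cA : continuous A by case: sA.
have [d11 c11] := C1_1 (or_introl erefl); have [d12 c12] := C1_1 (or_intror erefl).
have [d21 c21] := C1_2 (or_introl erefl); have [d22 c22] := C1_2 (or_intror erefl).
pose f1 x := (phi x).1; pose f2 x := (phi x).2.
pose G z := wedge (phi (A z)) Q.
pose G1 z := Q.2 * (P.1 * 'D_e1 f1 (A z) + P.2 * 'D_e2 f1 (A z)) +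
             - Q.1 * (P.1 * 'D_e1 f2 (A z) + P.2 * 'D_e2 f2 (A z)).
pose H z := wedge P (phi (A z)).
pose H2 z := P.1 * (Q.1 * 'D_e1 f2 (A z) + Q.2 * 'D_e2 f2 (A z)) +
             - P.2 * (Q.1 * 'D_e1 f1 (A z) + Q.2 * 'D_e2 f1 (A z)).
have cD (f : R * R -> R) : continuous f -> continuous (fun z => f (A z)).
  by move=> cf z; apply: continuous_comp; [exact: cA|exact: cf].
have b1 := cD _ c11; have b2 := cD _ c12; have b3 := cD _ c21; have b4 := cD _ c22.
have cG1 : continuous G1.
  exact: (continuous_lin2 (continuous_lin2 b1 b2) (continuous_lin2 b3 b4)).
have cH2 : continuous H2.
  exact: (continuous_lin2 (continuous_lin2 b3 b4) (continuous_lin2 b1 b2)).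
have dG (z : R * R) : is_derive z.1 1 (fun u : R => G (u, z.2)) (G1 z).
  have AE (u : R) : A (u, z.2) = (O + z.2 *: Q) + u *: P.
    by rewrite /A /affine /= [u *: P + _]addrC addrA.
  have := is_derive_C1 (O + z.2 *: Q) P z.1 C1_1.
  have := is_derive_C1 (O + z.2 *: Q) P z.1 C1_2.
  rewrite -!AE -surjective_pairing => k2 k1.
  have -> : (fun u => G (u, z.2)) = Q.2 \*: (fun u : R => f1 (O + z.2 *: Q + u *: P)) -
       Q.1 \*: (fun u : R => f2 (O + z.2 *: Q + u *: P)).
    apply/funext => u; transitivity (Q.2 * f1 (O + z.2 *: Q + u *: P) - Q.1 * f2 (O + z.2 *: Q + u *: P)).
      by rewrite /G AE /wedge /f1 /f2; ring.
    by [].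
  by apply: is_derive_eq; rewrite /G1 /GRing.scale /= /f1 /f2; ring.
have dH (z : R * R) : is_derive z.2 1 (fun u : R => H (z.1, u)) (H2 z).
  have AE (u : R) : A (z.1, u) = (O + z.1 *: P) + u *: Q by rewrite /A /affine /= addrA.
  have := is_derive_C1 (O + z.1 *: P) Q z.2 C1_1.
  have := is_derive_C1 (O + z.1 *: P) Q z.2 C1_2.
  rewrite -!AE -surjective_pairing => k2 k1.
  have -> : (fun u => H (z.1, u)) = P.1 \*: (fun u : R => f2 (O + z.1 *: P + u *: Q)) -
       P.2 \*: (fun u : R => f1 (O + z.1 *: P + u *: Q)).
    by apply/funext => u; rewrite /H AE.
  by apply: is_derive_eq; rewrite /H2 /GRing.scale /= /f1 /f2; ring.
have k1 : continuous (fun v : R => wedge (phi (O + P + v *: (Q - P))) Q).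
  exact: continuous_wedge_line.
have k2 : continuous (fun v : R => wedge (phi (O + v *: Q)) Q) by exact: continuous_wedge_line.
have k3 : continuous (fun v : R => wedge (phi (O + Q + v *: (P - Q))) P).
  exact: continuous_wedge_line.
have k4 : continuous (fun v : R => wedge (phi (O + v *: P)) P) by exact: continuous_wedge_line.
have k5 : continuous (fun v : R => wedge (phi (O + P + v *: (Q - P))) P).
  exact: continuous_wedge_line.
have A1 (v : R) : A (1 - v, v) = O + P + v *: (Q - P).
  by apply: plane_eq; rewrite /A /affine /= /GRing.scale /=; ring.
have A2 (v : R) : A (0, v) = O + v *: Q.
  by apply: plane_eq; rewrite /A /affine /= /GRing.scale /=; ring.
have A3 (v : R) : A (v, 1 - v) = O + Q + v *: (P - Q).
  by apply: plane_eq; rewrite /A /affine /= /GRing.scale /=; ring.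
have A4 (v : R) : A (v, 0) = O + v *: P.
  by apply: plane_eq; rewrite /A /affine /= /GRing.scale /=; ring.
have wC x y : wedge x y = - wedge y x by rewrite /wedge; ring.
have gE : (fun v : R => G (1 - v, v) - G (0, v)) =
   (fun v : R => wedge (phi (O + P + v *: (Q - P))) Q - wedge (phi (O + v *: Q)) Q).
  by apply/funext => v; rewrite /G A1 A2.
have hE : (fun v : R => H (v, 1 - v) - H (v, 0)) =
   (fun v : R => wedge (phi (O + v *: P)) P - wedge (phi (O + Q + v *: (P - Q))) P).
  by apply/funext => v; rewrite /H A3 A4 wC [wedge P (phi (O + v *: P))]wC opprK addrC.
have iG := integral_simplex1 cG1 dG.
have iH := integral_simplex2 cH2 dH.
rewrite gE in iG; rewrite hE in iH.
have {}iG := iG ltac:(move=> v; apply: cvgB; [exact: k1|exact: k2]).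
have {}iH := iH ltac:(move=> v; apply: cvgB; [exact: k4|exact: k3]).
have mS := @measurable_simplex R.
have intS (f : R * R -> R) : continuous f -> area.-integrable simplex (EFin \o f).
  move=> cf; have cII : compact (`[0%R, 1%R] `*` `[0%R, 1%R] : set (R * R)).
    by apply: compact_setX; exact: segment_compact.
  apply: (integrable_continuous_plane cf mS cII (@simplex_sub R)).
  by rewrite area_simplex ltry.
rewrite -RintegralZl//; last exact: intS (cD _ cdiv).
have -> : (\int[area]_(z in simplex) (wedge P Q * divergence phi (A z)) =
    \int[area]_(z in simplex) G1 z + \int[area]_(z in simplex) H2 z)%R.
  rewrite -RintegralD//; [|exact: intS..].
  apply: eq_Rintegral => z _.
  by rewrite /divergence /G1 /H2 /wedge /f1 /f2; ring.
rewrite iG iH.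
have mI : measurable (`[0%R, 1%R] : set (measurableTypeR R)) by [].
have i01 := @integrable_continuous_01.
rewrite (RintegralB mI (i01 _ k1) (i01 _ k2)) (RintegralB mI (i01 _ k4) (i01 _ k3)).
(* The two summands traverse the outer side in opposite directions. *)
have -> : (\int[mu]_(v in `[0%R, 1%R]) wedge (phi (O + Q + v *: (P - Q))) P =
    \int[mu]_(v in `[0%R, 1%R]) wedge (phi (O + P + v *: (Q - P))) P)%R.
  rewrite Rintegration_by_substitution_onem ?ler01 ?lexx//; last exact: continuous_subspaceT.
  rewrite unstable.onem1; apply: eq_Rintegral => v _; congr (wedge (phi _) _).
  by apply: plane_eq; rewrite /= /GRing.scale /= /unstable.onem; ring.
have -> : edge_flux phi O P Q =
   (\int[mu]_(v in `[0%R, 1%R]) wedge (phi (O + P + v *: (Q - P))) Q -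
   \int[mu]_(v in `[0%R, 1%R]) wedge (phi (O + P + v *: (Q - P))) P)%R.
  rewrite -(RintegralB mI (i01 _ k1) (i01 _ k5)).
  by apply: eq_Rintegral => v _; rewrite /wedge /=; ring.
by rewrite /ray_flux; ring.
Qed.

Lemma edge_flux_le O P Q : (forall x, enorm (phi x) <= 1) ->
  edge_flux phi O P Q <= edist Q P.
Proof.
move=> phi1.
have h : (\int[mu]_(v in `[0%R, 1%R]) wedge (phi (O + P + v *: (Q - P))) (Q - P) <=
    \int[mu]_(v in `[0%R, 1%R]) (edist Q P))%R.
  apply: le_Rintegral => //.
  - apply: integrable_continuous_01; exact: continuous_wedge_line.
  - by apply: integrable_continuous_01 => v; exact: cvg_cst.
  - move=> v _; apply: le_trans (wedge_le _ _) _.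
    by rewrite ler_piMl ?enorm_ge0.
apply: le_trans h _; rewrite Rintegral_cst//= lebesgue_measure_itv /= lte_fin ltr01.
by rewrite -EFinB /= subr0 mulr1.
Qed.

End Triangle.

(** * Polygonal fans *)

Lemma wedge_decomposition (R : realType) (p q z : R * R) : wedge p q != 0 ->
  z = (wedge z q / wedge p q) *: p + (wedge p z / wedge p q) *: q.
Proof.
move=> D1; apply: plane_eq; rewrite /= /GRing.scale /= /wedge /=;
  rewrite /wedge in D1; field; exact: D1.
Qed.

Section Fan.
Context {R : realType}.
Local Notation RR := (measurableTypeR R * measurableTypeR R)%type.
Implicit Types (a b c L A : R) (p q x : R * R).
Variables (O : R * R) (Om : set (R * R)).
Hypothesis cOm : compact Om.
Hypothesis sOm : segment_closed Om.
Hypothesis OmO : Om O.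

(** Open, so that consecutive sectors are disjoint and areas add; the rays left out have area 0. *)
Definition sector a b : set (R * R) :=
  [set x | exists r u, [/\ 0 < r, a < u < b & x = O + r *: dir u]].

(* The flux inequality says that [E] is bounded by the segments from [O] to [O + p]
   and to [O + q] and by a curve of length at most [L], without mentioning a boundary. *)
Definition fan a b p q L A : Prop := exists E : set RR,
  [/\ measurable E, E `<=` Om, E `<=` sector a b, (A%:E <= area E)%E &
    forall phi, test_field phi ->
      (\int[area]_(x in E) divergence phi x)%R <= ray_flux phi O p + L - ray_flux phi O q].

Lemma fan_weaken a b p q L A L' A' : L <= L' -> A' <= A ->
  fan a b p q L A -> fan a b p q L' A'.
Proof.
move=> LL' AA' [E [mE EOm Es EA hE]]; exists E; split => //.
  by apply: le_trans EA; rewrite lee_fin.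
by move=> phi tphi; apply: le_trans (hE phi tphi) _; rewrite lerB// lerD2l.
Qed.

Lemma fan_empty a p : fan a a p p 0 0.
Proof.
exists set0; split; [exact: measurable0|exact: sub0set|exact: sub0set|by rewrite measure0|].
by move=> phi _; rewrite Rintegral_set0 addr0 subrr.
Qed.

Let integrable_div phi (E : set RR) : test_field phi -> measurable E -> E `<=` Om ->
  area.-integrable E (EFin \o divergence phi).
Proof.
move=> [C11 C12 _ _] mE EOm; apply: integrable_divergence => //; last by exists Om.
have [M [_ MP]] := compact_bounded cOm.
pose r := `|M| + 1; pose B : set RR := `[- r, r] `*` `[- r, r].
apply: (@le_lt_trans _ _ (area B)); last first.
  rewrite /area product_measure1E//= !lebesgue_measure_itv /=.
  by case: ifP => _; rewrite ?mul0e -?EFinB -?EFinM ltry.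
apply: le_measure; rewrite ?inE//; first exact: measurableX.
move=> x /EOm Ox; have := MP r _ x Ox.
have -> : M < r by rewrite /r; have := ler_norm M; lra.
move=> /(_ isT) /=; rewrite /Num.norm /= ge_max !ler_norml => /andP[/andP[? ?] /andP[? ?]].
by split; rewrite /= in_itv /=; apply/andP; split.
Qed.

Lemma sector_disjoint a b c : c <= a + 2 * pi -> sector a b `&` sector b c = set0.
Proof.
move=> ca; apply/seteqP; split => // x [[r [u [r0 /andP[au ub] xE]]] [r' [u' [r'0 /andP[bu' u'c] xE']]]].
have e : r *: dir u = r' *: dir u' by apply: (addrI O); rewrite -xE.
have rr' : r = r'.
  have := congr1 enorm e; rewrite !enormZ !enorm_dir !mulr1 !gtr0_norm//.
have {}e : dir u = dir u'.
  by move: e; rewrite rr' => /(congr1 (fun z => r'^-1 *: z)); rewrite !scalerA mulVf ?gt_eqF// !scale1r.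
have : cos (u' - u) = 1 by rewrite -dot_dir2 e dot_dir.
have -> : u' - u = (u' - u) / 2 + (u' - u) / 2 by field.
rewrite cosD => h; have h' := cos2Dsin2 ((u' - u) / 2).
have : 0 < sin ((u' - u) / 2) by apply: sin_gt0_pi; apply/andP; split; lra.
have : sin ((u' - u) / 2) ^+ 2 = 0 by lra.
by move=> /eqP; rewrite sqrf_eq0 => /eqP ->; rewrite ltxx.
Qed.

Lemma sector_sub a b a' b' : a' <= a -> b <= b' -> sector a b `<=` sector a' b'.
Proof.
move=> aa' bb' x [r [u [r0 /andP[au ub] xE]]]; exists r, u; split => //.
by apply/andP; split; lra.
Qed.

(** The fluxes along the common ray cancel. *)
Lemma fan_cat a b c p q s L A L' A' : a <= b -> b <= c -> c <= a + 2 * pi ->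
  fan a b p q L A -> fan b c q s L' A' -> fan a c p s (L + L') (A + A').
Proof.
move=> ab bc ca [E [mE EOm Es EA hE]] [E' [mE' E'Om E's E'A hE']].
have EE' : E `&` E' = set0.
  apply/seteqP; split => // x [/Es h /E's h'].
  by rewrite -(sector_disjoint b ca); split.
exists (E `|` E'); split.
- exact: measurableU.
- by rewrite subUset.
- rewrite subUset; split; apply: subset_trans; [exact: Es|exact: sector_sub|exact: E's|exact: sector_sub].
- by rewrite measureU// EFinD; exact: leeD.
- move=> phi tphi; rewrite Rintegral_setU//.
  + by have := hE phi tphi; have := hE' phi tphi; lra.
  + by apply: integrable_div => //; [exact: measurableU|rewrite subUset].
  + exact/disj_set2P.
Qed.

(** After a full turn the first and last rays coincide, so their fluxes cancel too and [L] bounds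
    the integral of every divergence, as the perimeter demands. *)
Lemma fan_close a p L A : fan a (a + 2 * pi) p p L A ->
  exists E : set RR, [/\ measurable E, E `<=` Om, (A%:E <= area E)%E &
    (perimeter E <= L%:E)%E].
Proof.
move=> [E [mE EOm _ EA hE]]; exists E; split => //.
apply: ub_ereal_sup => _ [phi tphi <-].
have i := integrable_div tphi mE EOm.
have -> : (\int[area]_(x in E) (divergence phi x)%:E =
    (\int[area]_(x in E) divergence phi x)%:E)%E.
  by rewrite /Rintegral fineK//; exact: integrable_fin_num.
by rewrite lee_fin; have := hE phi tphi; lra.
Qed.

Lemma dir_between a b x : a < b < a + pi -> 0 < wedge (dir a) x -> 0 < wedge x (dir b) ->
  exists r u, [/\ 0 < r, a < u < b & x = r *: dir u].
Proof.
move=> /andP[ab bpi] wa wb; have [u0 xE] := polar_exists x.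
have r0 : 0 < enorm x.
  rewrite lt_neqAle enorm_ge0 andbT eq_sym; apply: contraTneq wa => /enorm_eq0 ->.
  by rewrite /wedge /= !mulr0 subrr ltxx.
set r := enorm x in xE r0.
have s0 : 0 < sin (u0 - a).
  move: wa; rewrite xE; have -> : wedge (dir a) (r *: dir u0) = r * wedge (dir a) (dir u0).
    by rewrite /wedge /= /GRing.scale /=; ring.
  by rewrite pmulr_rgt0// wedge_dir.
have c1 : -1 <= cos (u0 - a) <= 1 by rewrite cos_geN1 cos_le1.
pose v := acos (cos (u0 - a)).
have v0 : 0 <= v by exact: acos_ge0.
have vpi : v <= pi by exact: acos_lepi.
have cv : cos v = cos (u0 - a) by rewrite acosK// in_itv.
have sv : sin v = sin (u0 - a).
  have h : sin v ^+ 2 = sin (u0 - a) ^+ 2 by rewrite !sin2cos2 cv.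
  have sv0 : 0 <= sin v by apply: sin_ge0_pi; rewrite v0 vpi.
  by apply/eqP; rewrite -(@eqrXn2 _ 2)// ?h// ltW.
exists r, (a + v); rewrite r0.
have xE' : x = r *: dir (a + v).
  rewrite xE; congr (_ *: _); rewrite -[in LHS](subrK a u0) addrC.
  by rewrite /dir (cosD a v) (sinD a v) cv sv -cosD -sinD.
have vpos : 0 < v.
  rewrite lt_neqAle v0 andbT eq_sym; apply: contraTneq s0 => vE.
  by rewrite -sv vE sin0 ltxx.
split => //; apply/andP; split; first by rewrite ltrDl.
rewrite ltNge; apply/negP => bv; move: wb; rewrite xE'.
have -> : wedge (r *: dir (a + v)) (dir b) = r * wedge (dir (a + v)) (dir b).
  by rewrite /wedge /= /GRing.scale /=; ring.
rewrite pmulr_rgt0// wedge_dir => sb.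
have : 0 <= sin (a + v - b) by apply: sin_ge0_pi; apply/andP; split; lra.
by rewrite -opprB sinN => h; lra.
Qed.

Lemma fan_triangle a b r r' : a < b < a + pi -> 0 < r -> 0 < r' ->
  Om (O + r *: dir a) -> Om (O + r' *: dir b) ->
  fan a b (r *: dir a) (r' *: dir b) (edist (r' *: dir b) (r *: dir a))
    (wedge (r *: dir a) (r' *: dir b) / 2).
Proof.
move=> abpi r0 r'0; set p := r *: dir a; set q := r' *: dir b => Op Oq.
have wpq : wedge p q = r * r' * sin (b - a).
  by rewrite -wedge_dir /wedge /p /q /= /GRing.scale /=; ring.
have D0 : 0 < wedge p q.
  rewrite wpq !mulr_gt0//; apply: sin_gt0_pi.
  by case/andP: abpi => ? ?; apply/andP; split; lra.
have mT := measurable_triangle O p q.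
exists (triangle O p q); split => //.
- move=> x [h1 h2 h3].
  set s := wedge (x - O) q / wedge p q; set t := wedge p (x - O) / wedge p q.
  have s0 : 0 < s by exact: divr_gt0.
  have t0 : 0 < t by exact: divr_gt0.
  have st1 : s + t < 1 by rewrite /s /t -mulrDl ltr_pdivrMr// mul1r.
  (* Convexity is available for segments only, so [x] is reached in two steps: a point of the outer
     side, then a point between [O] and it. *)
  have xE : x = O + (s + t) *: ((O + p) + (t / (s + t)) *: ((O + q) - (O + p)) - O).
    have : x - O = s *: p + t *: q.
      by apply: wedge_decomposition; rewrite gt_eqF.
    move=> e; rewrite -[LHS](subrK O) e; apply: plane_eq; rewrite /= /GRing.scale /=;
      field; rewrite gt_eqF//; lra.
  rewrite xE; apply: sOm => //; first by apply/andP; split; lra.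
  have st0 := addr_gt0 s0 t0; apply: sOm => //; apply/andP; split.
    by apply: divr_ge0; exact: ltW.
  by rewrite ler_pdivrMr// mul1r; lra.
- move=> x [h1 h2 h3].
  have k2 : 0 < wedge (dir a) (x - O).
    move: h2; have -> : wedge p (x - O) = r * wedge (dir a) (x - O).
      by rewrite /wedge /p /= /GRing.scale /=; ring.
    by rewrite pmulr_rgt0.
  have k1 : 0 < wedge (x - O) (dir b).
    move: h1; have -> : wedge (x - O) q = r' * wedge (x - O) (dir b).
      by rewrite /wedge /q /= /GRing.scale /=; ring.
    by rewrite pmulr_rgt0.
  have [ro [u [ro0 uab xE]]] := dir_between abpi k2 k1.
  by exists ro, u; split => //; rewrite -xE addrC subrK.
- by rewrite area_triangle.
- move=> phi [C11 C12 _ phi1]; rewrite triangle_divergence// lerB// lerD2l.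
  exact: edge_flux_le.
Qed.

(** [L] and [A] are cumulative values, which makes the sums over the pieces telescope. *)
Lemma fan_iter (th L A : nat -> R) (p : nat -> R * R) n :
  (forall i, (i < n)%N -> th i <= th i.+1) -> th n <= th 0%N + 2 * pi ->
  (forall i, (i < n)%N -> fan (th i) (th i.+1) (p i) (p i.+1) (L i.+1 - L i) (A i.+1 - A i)) ->
  fan (th 0%N) (th n) (p 0%N) (p n) (L n - L 0%N) (A n - A 0%N).
Proof.
elim: n => [_ _ _|n IH mth thn hf]; first by rewrite !subrr; exact: fan_empty.
have mono m : (m <= n.+1)%N -> th 0%N <= th m.
  elim: m => // m IHm mn; apply: le_trans (IHm (ltnW mn)) (mth m mn).
have -> : L n.+1 - L 0%N = (L n - L 0%N) + (L n.+1 - L n) by ring.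
have -> : A n.+1 - A 0%N = (A n - A 0%N) + (A n.+1 - A n) by ring.
apply: (@fan_cat _ (th n)); [exact: mono|exact: mth|exact: thn| |exact: hf].
apply: IH => [i ni| |i ni]; [apply: mth|apply: le_trans thn; exact: mth|apply: hf];
  exact: ltnW.
Qed.

End Fan.

Lemma cos_ge_quad (R : realType) (x : R) : 0 <= x -> 1 - x ^+ 2 / 2 <= cos x.
Proof.
move=> x0; have -> : x = x / 2 + x / 2 by field.
rewrite cosD; have := cos2Dsin2 (x / 2).
have x20 : 0 <= x / 2 by rewrite divr_ge0.
have h := sin_le_id x20.
have [s0|s0] := leP 0 (sin (x / 2)).
  have : sin (x / 2) ^+ 2 <= (x / 2) ^+ 2 by rewrite ler_sqr ?nnegrE.
  by rewrite !expr2; lra.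
have hx : x / 2 > pi.
  rewrite ltNge; apply/negP => hpi; have : 0 <= sin (x / 2) by apply: sin_ge0_pi; rewrite x20 hpi.
  lra.
have p2 := @pi_ge2 R; have s1 : sin (x / 2) ^+ 2 <= 1 by rewrite sin2cos2 gerBl sqr_ge0.
have : 1 <= (x / 2) ^+ 2 by rewrite expr_ge1//; lra.
by move: s1; rewrite !expr2; lra.
Qed.

Lemma sin_ge_cubic (R : realType) (x : R) : 0 <= x -> x - x ^+ 3 / 2 <= sin x.
Proof.
move=> x0; rewrite -subr_ge0.
pose F (y : R) := sin y - (y - y ^+ 3 / 2).
suff : F 0 <= F x by rewrite /F sin0 expr0n /= mul0r !subr0.
have dF (y : R) : is_derive y 1 F (cos y - (1 - 3 / 2 * y ^+ 2)).
  have -> : F = sin - (id - 2^-1 \*: (id * (id * id))).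
    by apply/funext => z; rewrite /F /= !exprS expr0 mulr1 mulrC.
  by apply: is_derive_eq; rewrite /GRing.scale /= -[(id * id) y]/(y * y); field.
apply: (@ger0_increasing _ _ (fun y => cos y - (1 - 3 / 2 * y ^+ 2))) => //.
- move=> y; apply: continuous_subspaceT => z.
  by apply: differentiable_continuous; apply/derivable1_diffP; have [] := dF z.
- move=> y /andP[y0 _]; have := cos_ge_quad y0; have := sqr_ge0 y; lra.
Qed.

Lemma edist_dir_le (R : realType) (a b : R) : a <= b -> edist (dir b) (dir a) <= b - a.
Proof.
move=> ab; have ba0 : 0 <= b - a by rewrite subr_ge0.
rewrite /edist enorm_le//.
have -> : dot (dir b - dir a) (dir b - dir a) = dot (dir b) (dir b) + dot (dir a) (dir a) - 2 * dot (dir a) (dir b).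
  by rewrite /dot /=; ring.
by rewrite !dot_dir dot_dir2; have := cos_ge_quad ba0; lra.
Qed.

Section ArcFan.
Context {R : realType}.
Variables (O : R * R) (Om : set (R * R)).
Hypothesis cOm : compact Om.
Hypothesis sOm : segment_closed Om.
Hypothesis OmO : Om O.

(** An inscribed polygon with [n] equal steps [h]: chords are no longer than their arcs, and the
    area lost, [rho ^+ 2 * n * (h - sin h) / 2], is at most [rho ^+ 2 * n * h ^+ 3 / 4]. The
    function [ang] is any determination of the polar angle about [O] along the arc. *)
Lemma fan_arc (c : R * R) (rho f1 f2 : R) (ang : R -> R) (eta eps : R) :
  0 < rho -> f1 <= f2 -> 0 < eta -> 0 < eps ->
  (forall f, f1 <= f <= f2 -> exists2 r, 0 < r & c + rho *: dir f = r *: dir (ang f)) ->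
  (forall f f', f1 <= f -> f < f' < f + eta -> f' <= f2 -> ang f < ang f' < ang f + pi) ->
  ang f2 <= ang f1 + 2 * pi ->
  (forall f, f1 <= f <= f2 -> Om (O + (c + rho *: dir f))) ->
  fan O Om (ang f1) (ang f2) (c + rho *: dir f1) (c + rho *: dir f2) (rho * (f2 - f1))
    ((rho * (wedge c (dir f2) - wedge c (dir f1)) + rho ^+ 2 * (f2 - f1)) / 2 - eps).
Proof.
move=> rho0 f12 eta0 eps0 polar mono ang2 inOm.
move: f12; rewrite le_eqVlt => /predU1P[f12|f12].
  rewrite -f12 !subrr !mulr0 addr0 mul0r sub0r.
  by apply: fan_weaken (fan_empty O Om _ _); [exact: lexx|rewrite oppr_le0 ltW].
pose del := f2 - f1; have del0 : 0 < del by rewrite subr_gt0.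
have K0 : 0 < rho ^+ 2 * del by rewrite mulr_gt0// exprn_gt0.
(* Three constraints on the step: it is short enough for [ang] to increase, at most 1, and small
   enough for the area lost to stay below [eps]. *)
pose kap := Num.min (Num.min eta 1) (4 * eps / (rho ^+ 2 * del)).
have kap0 : 0 < kap by rewrite !lt_min eta0 ltr01 divr_gt0// mulr_gt0.
pose n := (Num.bound (del / kap)).+1.
have n0 : 0 < n%:R :> R by rewrite ltr0n.
have hn : del / n%:R < kap.
  rewrite ltr_pdivrMr// mulrC -ltr_pdivrMr//.
  apply: lt_le_trans (archi_boundP _) _; first by rewrite divr_ge0// ltW.
  by rewrite ler_nat /n.
pose h := del / n%:R; have h0 : 0 < h by exact: divr_gt0.
have nh : n%:R * h = del by rewrite /h mulrC divfK// gt_eqF.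
have [heta h1 heps] : [/\ h < eta, h <= 1 & rho ^+ 2 * del * h <= 4 * eps].
  move: hn; rewrite -/h !lt_min => /andP[/andP[-> k1] k2]; split => //; first exact: ltW.
  by move: k2; rewrite ltr_pdivlMr// mulrC => /ltW.
pose f i := f1 + i%:R * h.
have fS i : f i.+1 = f i + h by rewrite /f -natr1; ring.
have fn : f n = f2 by rewrite /f nh /del addrC subrK.
have f0 : f 0%N = f1 by rewrite /f mul0r addr0.
have fle i : f1 <= f i by rewrite /f lerDl mulr_ge0// ltW.
have fge i : (i <= n)%N -> f i <= f2.
  by move=> ilen; rewrite -fn /f lerD2l ler_pM2r// ler_nat.
(* The area swept from [O]: the part that involves the centre [c] telescopes, and each chord
   contributes [rho ^+ 2 * sin h / 2]. *)
pose A i := (rho * wedge c (dir (f i)) + i%:R * (rho ^+ 2 * sin h)) / 2.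
have mang i : (i < n)%N -> ang (f i) < ang (f i.+1) < ang (f i) + pi.
  move=> ilen; apply: mono => //; first by rewrite fS; apply/andP; split; lra.
  exact: fge.
have := @fan_iter _ O Om cOm (fun i => ang (f i)) (fun i => i%:R * (rho * h)) A
  (fun i => c + rho *: dir (f i)) n.
rewrite fn f0; move=> step; apply: fan_weaken (step _ _ _) => //.
- by rewrite mul0r subr0 mulrCA nh.
- rewrite /A fn f0 mul0r addr0.
  have hs := sin_ge_cubic (ltW h0).
  have : n%:R * (rho ^+ 2 * (h - h ^+ 3 / 2)) <= n%:R * (rho ^+ 2 * sin h).
    by rewrite ler_pM2l// ler_pM2l// exprn_gt0.
  have -> : n%:R * (rho ^+ 2 * (h - h ^+ 3 / 2)) = rho ^+ 2 * (n%:R * h) - rho ^+ 2 * (n%:R * h) * h * h / 2.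
    by ring.
  rewrite nh => k1.
  have : rho ^+ 2 * del * h * h <= 4 * eps * 1.
    by apply: ler_pM => //; rewrite ltW// mulr_gt0.
  rewrite -/del; lra.
- by move=> i /mang /andP[/ltW].
- move=> i ilen.
  have f1i : f1 <= f i <= f2 by rewrite fle fge// ltnW.
  have f1S : f1 <= f i.+1 <= f2 by rewrite fle fge.
  have [r r0 E] := polar _ f1i; have [r' r'0 E'] := polar _ f1S.
  have Or := inOm _ f1i; have Or' := inOm _ f1S; rewrite E in Or; rewrite E' in Or'.
  have := fan_triangle sOm OmO (mang i ilen) r0 r'0 Or Or'.
  rewrite -E -E'; apply: fan_weaken.
    have -> : i.+1%:R * (rho * h) - i%:R * (rho * h) = rho * (f i.+1 - f i).
      by rewrite fS -natr1; ring.
    have -> : edist (c + rho *: dir (f i.+1)) (c + rho *: dir (f i)) = rho * edist (dir (f i.+1)) (dir (f i)).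
      rewrite /edist -[rho in RHS](gtr0_norm rho0) -enormZ scalerBr; congr enorm.
      by rewrite opprD addrACA subrr add0r.
    by rewrite ler_pM2l//; apply: edist_dir_le; rewrite fS; lra.
  have -> : wedge (c + rho *: dir (f i)) (c + rho *: dir (f i.+1)) =
     rho * wedge c (dir (f i.+1)) - rho * wedge c (dir (f i)) + rho ^+ 2 * wedge (dir (f i)) (dir (f i.+1)).
    by rewrite /wedge /= /GRing.scale /=; ring.
  rewrite wedge_dir fS (_ : f i + h - f i = h); last by ring.
  by rewrite /A fS -natr1; lra.
Qed.

End ArcFan.

(** * Bodies of constant width *)

Section ConstantWidth.
Context {R : realType}.
Implicit Types (x y z p u : R * R) (K : set (R * R)).

Lemma convex_segment_closed K : convex_set K -> segment_closed K.
Proof.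
move=> cK x y l /andP[l0 l1] Kx Ky.
have := cK y x (Itv01 l0 l1) (mem_set Ky) (mem_set Kx).
rewrite inE; congr K; apply: plane_eq; rewrite /conv /= /GRing.scale /= /unstable.onem; ring.
Qed.

Lemma continuous_dot u : continuous (dot u).
Proof.
move=> x; apply: cvgD; apply: cvgM; try exact: cvg_cst; [exact: cvg_fst|exact: cvg_snd].
Qed.

Lemma plane_EVT_max K (f : R * R -> R) : K !=set0 -> compact K -> continuous f ->
  exists2 x, K x & forall y, K y -> f y <= f x.
Proof.
move=> K0 cK cf; have [x /set_mem Kx h] := compact_EVT_max K0 cK (continuous_subspaceT cf).
by exists x => // y /mem_set; exact: h.
Qed.

Lemma plane_EVT_min K (f : R * R -> R) : K !=set0 -> compact K -> continuous f ->
  exists2 x, K x & forall y, K y -> f x <= f y.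
Proof.
move=> K0 cK cf; have [x /set_mem Kx h] := compact_EVT_min K0 cK (continuous_subspaceT cf).
by exists x => // y /mem_set; exact: h.
Qed.

Lemma dotN u x : dot (- u) x = - dot u x.
Proof. by rewrite /dot /=; ring. Qed.

Lemma dotB u x y : dot u (x - y) = dot u x - dot u y.
Proof. by rewrite /dot /=; ring. Qed.

(** Passes from the distance between two lines to two support points. The distance is attained by
    moving from [x] along the common normal [u]. *)
Lemma constant_width_support w K u : constant_width_body w K -> enorm u = 1 ->
  exists x y, [/\ K x, K y, dot u x - dot u y = w &
    forall z, K z -> dot u y <= dot u z <= dot u x].
Proof.
move=> [cK _ iK wK] u1.
have K0 : K !=set0 by have [x /interior_subset Kx] := iK; exists x.
have [x Kx xmax] := plane_EVT_max K0 cK (@continuous_dot u).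
have [y Ky ymin] := plane_EVT_min K0 cK (@continuous_dot u).
exists x, y; split => //; last by move=> z Kz; rewrite ymin// xmax.
have Nu1 : enorm (- u) = 1 by rewrite enormN.
rewrite -(wK u u1 [set z | dot u z = dot u x] [set z | dot (- u) z = dot (- u) y]).
- set a := dot u x - dot u y; rewrite /set_dist.
  have a0 : 0 <= a by rewrite subr_ge0 xmax.
  have lbE : lbound [set edist p.1 p.2 | p in [set z | dot u z = dot u x] `*` [set z | dot (- u) z = dot (- u) y]] a.
    move=> _ [[p q] /= [pE qE] <-].
    have {}qE : dot u q = dot u y by move: qE; rewrite !dotN => /oppr_inj.
    have := dot_le u (p - q); rewrite u1 mul1r dotB pE qE; exact.
  have inE : [set edist p.1 p.2 | p in [set z | dot u z = dot u x] `*` [set z | dot (- u) z = dot (- u) y]] a.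
    exists (x, x - a *: u); last first.
      by rewrite /= /edist subKr enormZ u1 mulr1 ger0_norm.
    split => //=; rewrite !dotN dotB.
    have -> : dot u (a *: u) = a * dot u u by rewrite /dot /= /GRing.scale /=; ring.
    by rewrite -enorm_sqr u1 expr1n /a; ring.
  apply/eqP; rewrite eq_le; apply/andP; split.
    by apply: lb_le_inf; [exists a|exact: lbE].
  by apply: ge_inf; [exists a|].
- exists (dot u x); split => //; last by exists x.
- exists (dot (- u) y); split => //; last by exists y.
  by move=> z Kz /=; rewrite !dotN lerN2 ymin.
Qed.

Lemma constant_width_diam w K x y : constant_width_body w K -> K x -> K y -> edist x y <= w.
Proof.
move=> wK Kx Ky; have [e0|e0] := eqVneq (edist x y) 0.
  rewrite e0.
  have u1 : enorm (1, 0 : R) = 1 by apply: enorm_eq => //; rewrite /dot /=; ring.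
  have [X [Y [_ _ <- h]]] := constant_width_support wK u1.
  by have := h x Kx; lra.
have e1 : 0 < edist x y by rewrite lt_neqAle eq_sym e0 enorm_ge0.
pose u := (edist x y)^-1 *: (x - y).
have u1 : enorm u = 1 by rewrite enormZ gtr0_norm ?invr_gt0// mulVf.
have [X [Y [_ _ <- h]]] := constant_width_support wK u1.
have := h x Kx; have := h y Ky.
have : dot u x - dot u y = edist x y.
  rewrite -dotB; have -> : dot u (x - y) = (edist x y)^-1 * dot (x - y) (x - y).
    by rewrite /u /dot /= /GRing.scale /=; ring.
  by rewrite -enorm_sqr -/(edist x y) expr2 mulKf.
lra.
Qed.

(** Let [z] be the point of [K] nearest to [p]. If [p] is not in [K], the line through [z] normal to
    [p - z] supports [K], and the opposite support point is at distance at least [w + edist z p]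
    from [p]. *)
Lemma constant_width_complete w K p : constant_width_body w K ->
  (forall x, K x -> edist p x <= w) -> K p.
Proof.
move=> wK hp; have [cK cvK iK _] := wK.
have K0 : K !=set0 by have [x /interior_subset Kx] := iK; exists x.
have [z Kz zmin] := plane_EVT_min K0 cK (@continuous_edist R p).
have [e0|e0] := eqVneq (edist z p) 0.
  by have := enorm_eq0 e0 => /eqP; rewrite subr_eq0 => /eqP <-.
have e1 : 0 < edist z p by rewrite lt_neqAle eq_sym e0 enorm_ge0.
pose u := (edist z p)^-1 *: (p - z).
have u1 : enorm u = 1 by rewrite enormZ gtr0_norm ?invr_gt0// -[enorm (p - z)]/(edist p z) [edist p z]edistC mulVf.
have upz : dot u (p - z) = edist z p.
  have -> : dot u (p - z) = (edist z p)^-1 * dot (p - z) (p - z).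
    by rewrite /u /dot /= /GRing.scale /=; ring.
  by rewrite -enorm_sqr -/(edist p z) [edist p z]edistC expr2 mulKf.
have obtuse x : K x -> dot u x <= dot u z.
  move=> Kx; rewrite -subr_le0 -dotB.
  have -> : dot u (x - z) = (edist z p)^-1 * dot (p - z) (x - z).
    by rewrite /u /dot /= /GRing.scale /=; ring.
  rewrite pmulr_rle0 ?invr_gt0// leNgt; apply/negP => d0.
  set d := dot (p - z) (x - z) in d0.
  pose D := dot (x - z) (x - z); have D0 : 0 <= D by exact: dot_ge0.
  have D1 : 0 < D + d by lra.
  (* Chosen so that [l * D < d]: moving from [z] towards [x] by the fraction [l] would then bring it
     closer to [p]. *)
  pose l := d / (D + d).
  have l0 : 0 < l by exact: divr_gt0.
  have l1 : l <= 1 by rewrite ler_pdivrMr// mul1r; lra.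
  have lD : l * D < d.
    have -> : l * D = d - l * d by rewrite /l; field; rewrite gt_eqF.
    by rewrite ltrBlDr ltrDl mulr_gt0.
  have Ky : K (z + l *: (x - z)).
    by apply: convex_segment_closed => //; rewrite l1 ltW.
  have := zmin _ Ky; rewrite /edist enorm_ge ?enorm_ge0// enorm_sqr.
  have -> : dot (z + l *: (x - z) - p) (z + l *: (x - z) - p) =
     dot (z - p) (z - p) - l * (2 * d - l * D).
    by rewrite /d /D /dot /= /GRing.scale /=; ring.
  have h : 0 < l * (2 * d - l * D) by rewrite mulr_gt0//; lra.
  by lra.
have [X [Y [KX KY wE h]]] := constant_width_support wK u1.
have := h z Kz; have := obtuse X KX; have := hp Y KY.
have := dot_le u (p - Y); rewrite u1 mul1r -/(edist p Y).
have -> : dot u (p - Y) = dot u (p - z) + dot u z - dot u Y by rewrite !dotB; ring.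
rewrite upz; lra.
Qed.

Lemma farthest_point K : K !=set0 -> compact K ->
  exists2 far : R * R -> R * R, (forall y, K (far y) /\ forall x, K x -> edist x y <= edist (far y) y) &
    continuous (fun y => edist (far y) y).
Proof.
move=> K0 cK.
have h y : exists x, K x /\ forall z, K z -> edist z y <= edist x y.
  by have [x Kx hx] := plane_EVT_max K0 cK (@continuous_edist R y); exists x.
have [far farP] := choice h; exists far => //.
have le y y' : edist (far y) y - edist (far y') y' <= edist y y'.
  have [Ky _] := farP y; have [_ /(_ _ Ky)] := farP y'.
  move=> h1; rewrite lerBlDr; apply: le_trans (edist_triangle y' _ _) _.
  by rewrite addrC [edist y' y]edistC lerD2l.
apply: (@elipschitz_continuous R 1) => // y y'; rewrite mul1r ler_norml.
have := le y y'; have := le y' y; rewrite [edist y' y]edistC => h1 h2.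
by apply/andP; split; lra.
Qed.

(* If a half plane missed the contact set, moving the centre would shrink the disk. *)
Lemma smallest_enclosing_disk w K : constant_width_body w K ->
  exists O r, [/\ w <= 2 * r, forall x, K x -> edist x O <= r &
    forall u, enorm u = 1 -> exists x, [/\ K x, edist x O = r & dot u (x - O) <= 0]].
Proof.
move=> wK; have [cK _ iK _] := wK.
have K0 : K !=set0 by have [x /interior_subset Kx] := iK; exists x.
have [far farP cfar] := farthest_point K0 cK.
have [x0 Kx0] := K0.
have w0 : 0 <= w by have := constant_width_diam wK Kx0 Kx0; rewrite /edist subrr enorm0.
have D0 : closed_disk x0 w !=set0 by exists x0; rewrite /closed_disk /= /edist subrr enorm0.
have [c0 Dc Omin] := plane_EVT_min D0 (@compact_closed_disk R x0 w) cfar.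
move: c0 Dc Omin => O DO Omin; set r := edist (far O) O.
have hO x : K x -> edist x O <= r by have [_] := farP O; exact.
(* Outside the disk about [x0] the point [x0] itself is farther than [w], so the minimum over the
   disk is global. *)
have glob y : r <= edist (far y) y.
  have [Dy|Dy] := leP (edist x0 y) w; first exact: Omin.
  have h0 : r <= edist (far x0) x0 by apply: Omin; rewrite /closed_disk /= /edist subrr enorm0.
  have [Kf _] := farP x0; have := constant_width_diam wK Kf Kx0.
  by have [_ /(_ _ Kx0)] := farP y; lra.
exists O, r; split => //.
  have u1 : enorm (1, 0 : R) = 1 by apply: enorm_eq => //; rewrite /dot /=; ring.
  have [X [Y [KX KY <- _]]] := constant_width_support wK u1.
  have := hO X KX; have := hO Y KY; have := dot_le (1, 0) (X - Y).
  have := edist_triangle O X Y; rewrite u1 mul1r dotB [edist O Y]edistC /edist; lra.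
move=> u u1.
(* [f x <= 0] describes a contact point in the required half plane. If the minimum of [f] were
   [2 * e > 0], the point of [K] farthest from [O + e *: u] would have [f] at most [e]; the factor 2
   gives both entries that same bound. *)
pose f x := Num.max (2 * dot u (x - O)) (r - edist x O).
have cf : continuous f.
  move=> x; apply: (@continuous_max _ _ (fun x => 2 * dot u (x - O)) (fun x => r - edist x O)).
    apply: cvgM; first exact: cvg_cst.
    apply: (@continuous_comp _ _ _ (fun x => x - O) (dot u)); last exact: continuous_dot.
    by apply: cvgB; [exact: cvg_id|exact: cvg_cst].
  by apply: cvgB; [exact: cvg_cst|exact: continuous_edist].
have [x Kx xmin] := plane_EVT_min K0 cK cf.
have fx0 : f x <= 0.
  rewrite leNgt; apply/negP => fx; pose e := f x / 2; have e0 : 0 < e by rewrite divr_gt0.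
  have [Ky _] := farP (O + e *: u); set y := far (O + e *: u) in Ky.
  have := glob (O + e *: u); rewrite -/y => hy.
  have hyO := hO y Ky.
  have r0 : 0 <= r by exact: enorm_ge0.
  have fy : f y <= e.
    rewrite /f ge_max; apply/andP; split.
      move: hy; rewrite {1}/edist enorm_ge//.
      have -> : dot (y - (O + e *: u)) (y - (O + e *: u)) =
        dot (y - O) (y - O) - 2 * e * dot u (y - O) + e ^+ 2 * dot u u.
        by rewrite /dot /= /GRing.scale /=; ring.
      rewrite -[dot u u]enorm_sqr u1 -[dot (y - O) _]enorm_sqr -/(edist y O) expr1n mulr1 => h.
      have : edist y O ^+ 2 <= r ^+ 2 by rewrite ler_sqr ?nnegrE ?enorm_ge0.
      move=> h2; have : e * (2 * dot u (y - O)) <= e * e by rewrite -expr2; lra.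
      by rewrite ler_pM2l.
    have := edist_triangle O y (O + e *: u).
    have -> : edist O (O + e *: u) = e.
      by rewrite edistC /edist addrC addKr enormZ u1 mulr1 gtr0_norm.
    lra.
  by have := xmin y Ky; rewrite /e in fy e0 *; lra.
move: fx0; rewrite /f ge_max => /andP[h1 h2].
exists x; split => //; last lra.
by apply/eqP; rewrite eq_le hO//=; lra.
Qed.

Lemma polar_of_cos (e p : R * R) (al r g : R) : 0 <= r -> e = dir al ->
  dot e p = r * cos g -> wedge e p = r * sin g -> p = r *: dir (al + g).
Proof.
move=> r0 -> hd hw.
have c := cos2Dsin2 al.
apply: plane_eq; rewrite /= /GRing.scale /= ?cosD ?sinD.
  transitivity (dot (dir al) p * cos al - wedge (dir al) p * sin al).
    by rewrite /dot /wedge /= -[LHS]mul1r -c; ring.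
  by rewrite hd hw; ring.
transitivity (dot (dir al) p * sin al + wedge (dir al) p * cos al).
  by rewrite /dot /wedge /= -[LHS]mul1r -c; ring.
by rewrite hd hw; ring.
Qed.

Let cos_lt (x y : R) : 0 <= x -> x < y -> y <= pi -> cos y < cos x.
Proof.
move=> x0 xy ypi; rewrite ltr_cos// ?in_itv/=; apply/andP; split; lra.
Qed.

Let gap_le (g tau : R) : 0 <= g < pi / 2 -> pi / 2 <= tau <= 3 * pi / 2 ->
  cos (2 * g) <= cos (tau - g) -> tau - g <= 2 * g.
Proof.
move=> /andP[g0 gpi] /andP[t1 t2] h; rewrite leNgt; apply/negP => lt.
have [le|gt] := leP (tau - g) pi.
  by have := @cos_lt (2 * g) (tau - g) _ lt le; lra.
have e : cos (tau - g) = cos (2 * pi - (tau - g)).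
  have -> : 2 * pi - (tau - g) = - (tau - g) + pi *+ 2 by rewrite -mulr_natl; ring.
  by rewrite cosD2pi cosN.
have := @cos_lt (2 * g) (2 * pi - (tau - g)) _ _ _; rewrite -e; lra.
Qed.

(* The first two points are a farthest pair of contact points, and the third lies on
   the side of [O] opposite to their midpoint. *)
Lemma contact_points (w r : R) O K : compact K -> 0 < w -> w < 2 * r ->
  (forall x y, K x -> K y -> edist x y <= w) ->
  (forall x, K x -> edist x O <= r) ->
  (forall u, enorm u = 1 -> exists x, [/\ K x, edist x O = r & dot u (x - O) <= 0]) ->
  exists psi a1 a2 a3 : R, [/\ 0 < psi <= pi / 6, 2 * r * cos psi = w,
    [/\ K (O + r *: dir a1), K (O + r *: dir a2) & K (O + r *: dir a3)] &
    [/\ a1 + 4 * psi <= a2, a2 + 4 * psi <= a3 & a3 + 4 * psi <= a1 + 2 * pi]].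
Proof.
move=> cK w0 wr hw hO hu; have r0 : 0 < r by lra.
have p0 := @pi_gt0 R.
pose C := K `&` [set x | r <= edist x O].
have Cr x : C x -> edist x O = r.
  by move=> [Kx rx]; apply/eqP; rewrite eq_le hO.
have cC : compact C.
  apply: (subclosed_compact _ cK); last by move=> x [].
  apply: closedI; first exact: compact_closed (@norm_hausdorff _ _) cK.
  apply: (@closed_comp _ _ (fun x => edist x O) [set u | r <= u]); last exact: closed_ge.
  by move=> x _; exact: continuous_edist.
have C0 : C !=set0.
  have [|x [Kx xr _]] := hu (1, 0); first by apply: enorm_eq => //; rewrite /dot /=; ring.
  by exists x; split => //=; rewrite xr.
have [far farP cfar] := farthest_point C0 cC.
have [y Cy ymax] := plane_EVT_max C0 cC cfar.
have [Cf _] := farP y.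
have [x1 [x2 [Cx1 Cx2 wg dmax]]] : exists x1 x2, [/\ C x1, C x2,
    0 <= wedge (x1 - O) (x2 - O) & forall x x', C x -> C x' -> edist x x' <= edist x1 x2].
  have dm x x' : C x -> C x' -> edist x x' <= edist (far y) y.
    by move=> Cx Cx'; have [_ h] := farP x'; apply: le_trans (h x Cx) (ymax x' Cx').
  have [h|h] := leP 0 (wedge (far y - O) (y - O)); first by exists (far y), y.
  exists y, (far y); split => //; last by move=> x x' Cx Cx'; rewrite [leRHS]edistC; exact: dm.
  by move: h; rewrite /wedge; lra.
pose p1 := x1 - O; pose p2 := x2 - O.
have pr x : C x -> dot (x - O) (x - O) = r ^+ 2.
  by move=> Cx; rewrite -enorm_sqr -/(edist x O) Cr.
have dotd x x' : C x -> C x' -> dot (x - O) (x' - O) = r ^+ 2 - edist x x' ^+ 2 / 2.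
  move=> Cx Cx'; rewrite /edist enorm_sqr.
  have := pr x Cx; have := pr x' Cx'; rewrite /dot /=; lra.
set d := edist x1 x2.
have d0 : 0 <= d by exact: enorm_ge0.
have dw : d <= w by apply: hw; [case: Cx1|case: Cx2].
have d2r : d ^+ 2 < (2 * r) ^+ 2 by rewrite ltr_sqr ?nnegrE; lra.
have d12 : dot p1 p2 = r ^+ 2 - d ^+ 2 / 2 by exact: dotd.
(* Twice the distance from [O] to the midpoint of [x1] and [x2], positive because [d <= w < 2 * r].
   Thus [p1] and [p2] lie at angles [- g] and [g] from the direction [al] of the midpoint. *)
pose m := enorm (p1 + p2).
have m2 : m ^+ 2 = 4 * r ^+ 2 - d ^+ 2.
  rewrite enorm_sqr; have -> : dot (p1 + p2) (p1 + p2) = dot p1 p1 + dot p2 p2 + 2 * dot p1 p2.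
    by rewrite /dot /=; ring.
  by rewrite d12 [dot p1 p1]pr// [dot p2 p2]pr//; field.
have m0 : 0 < m.
  rewrite lt_neqAle enorm_ge0 andbT eq_sym -sqrf_eq0 m2 gt_eqF//.
  by move: d2r; rewrite exprMn; lra.
have [al eE] := polar_exists (p1 + p2); rewrite -/m in eE.
have eE' : dir al = m^-1 *: (p1 + p2) by rewrite eE scalerA mulVf ?scale1r// gt_eqF.
have de z : dot (dir al) z = m^-1 * (dot p1 z + dot p2 z).
  by rewrite eE' /dot /= /GRing.scale /=; ring.
have we z : wedge (dir al) z = m^-1 * (wedge p1 z + wedge p2 z).
  by rewrite eE' /wedge /= /GRing.scale /=; ring.
have p11 : dot p1 p1 = r ^+ 2 by exact: pr.
have p22 : dot p2 p2 = r ^+ 2 by exact: pr.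
have m1 : m != 0 by rewrite gt_eqF.
have de2 : dot (dir al) p2 = m / 2.
  rewrite de p22 d12; apply: (mulfI m1); rewrite mulrA divff// mul1r.
  by rewrite mulrA -expr2 m2; field.
have de1 : dot (dir al) p1 = m / 2.
  have dC : dot p2 p1 = dot p1 p2 by rewrite /dot; ring.
  rewrite de p11 dC d12; apply: (mulfI m1); rewrite mulrA divff// mul1r.
  by rewrite mulrA -expr2 m2; field.
have w22 : wedge p2 p2 = 0 by rewrite /wedge; ring.
have w11 : wedge p1 p1 = 0 by rewrite /wedge; ring.
have w21 : wedge p2 p1 = - wedge p1 p2 by rewrite /wedge; ring.
have we2 : wedge (dir al) p2 = m^-1 * wedge p1 p2 by rewrite we w22 addr0.
have we1 : wedge (dir al) p1 = - (m^-1 * wedge p1 p2) by rewrite we w11 w21 add0r mulrN.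
pose g := acos (m / (2 * r)).
have r20 : 0 < 2 * r by lra.
have mr : m <= 2 * r.
  have h : m ^+ 2 <= (2 * r) ^+ 2.
    have -> : (2 * r) ^+ 2 = 4 * r ^+ 2 by ring.
    by rewrite m2 gerBl sqr_ge0.
  by move: h; rewrite ler_sqr// nnegrE ltW.
have c01 : 0 < m / (2 * r) <= 1 by rewrite divr_gt0//= ler_pdivrMr// mul1r.
have cg : cos g = m / (2 * r).
  by rewrite /g acosK// in_itv /=; case/andP: c01 => ? ->; rewrite andbT; lra.
have g0 : 0 <= g by apply: acos_ge0; case/andP: c01 => ? ->; rewrite andbT; lra.
have gpi : g <= pi by apply: acos_lepi; case/andP: c01 => ? ->; rewrite andbT; lra.
have gpi2 : g < pi / 2.
  rewrite ltNge; apply/negP => h; have : cos g <= cos (pi / 2).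
    move: h; rewrite le_eqVlt => /predU1P[<- //|h].
    by apply: ltW; apply: cos_lt => //; lra.
  by rewrite cos_pihalf cg; case/andP: c01 => ? _; lra.
have sg0 : 0 <= sin g by apply: sin_ge0_pi; rewrite g0 gpi.
have sg : 2 * r * sin g = d.
  have s2 : 0 <= 2 * r * sin g by apply: mulr_ge0 => //; exact: ltW.
  apply/eqP; rewrite -(@eqrXn2 _ 2)//.
  have -> : d ^+ 2 = 4 * r ^+ 2 - m ^+ 2 by rewrite m2; ring.
  by apply/eqP; rewrite exprMn sin2cos2 cg; field; rewrite gt_eqF.
have mE : m / 2 = r * cos g by rewrite cg; field; rewrite gt_eqF.
have we2' : wedge (dir al) p2 = r * sin g.
  apply/eqP; rewrite -(@eqrXn2 _ 2)//; last 2 first.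
  - by rewrite we2 mulr_ge0// invr_ge0 ltW.
  - by rewrite mulr_ge0// ltW.
  have := dot_wedge (dir al) p2; rewrite dot_dir p22 mul1r de2 => h.
  by move: h; rewrite mE !exprMn sin2cos2 => h; apply/eqP; lra.
have p2E : p2 = r *: dir (al + g).
  by apply: (polar_of_cos (ltW r0) erefl) => //; rewrite de2.
have p1E : p1 = r *: dir (al + - g).
  apply: (polar_of_cos (ltW r0) erefl); first by rewrite cosN de1.
  by rewrite sinN mulrN -we2' we2 we1.
have [x3 [Kx3 x3r dx3]] := hu (dir al) (enorm_dir al).
pose p3 := x3 - O.
have Cx3 : C x3 by split => //=; rewrite x3r.
have [tau [t1 t2 p3E]] : exists tau, [/\ pi / 2 <= tau, tau <= 3 * pi / 2 & p3 = r *: dir (al + tau)].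
  pose q := dot (dir al) p3 / r.
  have q0 : q <= 0 by rewrite /q pmulr_lle0// invr_gt0.
  have q1 : -1 <= q.
    rewrite /q ler_pdivlMr// mulN1r lerNl -dotN; apply: le_trans (dot_le _ _) _.
    by rewrite enormN enorm_dir mul1r -/(edist x3 O) x3r.
  have q11 : -1 <= q <= 1 by apply/andP; split; lra.
  have ca : cos (acos q) = q by rewrite acosK// in_itv.
  have a0 := acos_ge0 q11; have api := acos_lepi q11.
  have a2 : pi / 2 <= acos q.
    rewrite leNgt; apply/negP => h; have : cos (pi / 2) < cos (acos q).
      by apply: cos_lt => //; lra.
    by rewrite cos_pihalf ca; lra.
  have dq : dot (dir al) p3 = r * q by rewrite /q mulrC divfK// gt_eqF.
  have sa0 : 0 <= sin (acos q) by apply: sin_ge0_pi; rewrite a0 api.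
  have w2 : wedge (dir al) p3 ^+ 2 = (r * sin (acos q)) ^+ 2.
    have := dot_wedge (dir al) p3; rewrite dot_dir mul1r [dot p3 p3]pr// dq => h.
    by rewrite exprMn sin2cos2 ca; move: h; rewrite exprMn; lra.
  have [wp|wn] := leP 0 (wedge (dir al) p3).
    exists (acos q); split => //; first lra.
    apply: (polar_of_cos (ltW r0) erefl); first by rewrite ca.
    by apply/eqP; rewrite -(@eqrXn2 _ 2)// ?w2// mulr_ge0// ltW.
  exists (- acos q + pi *+ 2); split.
  - by rewrite -mulr_natl; lra.
  - by rewrite -mulr_natl; lra.
  - apply: (polar_of_cos (ltW r0) erefl); first by rewrite cosD2pi cosN ca.
    rewrite sinD2pi sinN mulrN -[LHS]opprK; congr (- _).
    by apply/eqP; rewrite -(@eqrXn2 _ 2)// ?sqrrN ?w2//; [lra|rewrite mulr_ge0// ltW].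
have dotr A B : dot (r *: dir A) (r *: dir B) = r ^+ 2 * cos (B - A).
  by rewrite -dot_dir2 /dot /= /GRing.scale /=; ring.
have far3 x : C x -> r ^+ 2 * cos (2 * g) <= dot (x - O) p3.
  move=> Cx; have -> : r ^+ 2 * cos (2 * g) = dot p1 p2.
    by rewrite p1E p2E dotr; congr (_ * cos _); ring.
  rewrite [dot (x - O) p3]dotd// d12.
  have : edist x x3 ^+ 2 <= d ^+ 2.
    by rewrite ler_sqr ?nnegrE ?enorm_ge0//; exact: dmax.
  lra.
have r2 : 0 < r ^+ 2 by exact: exprn_gt0.
(* As [x1] and [x2] are farthest apart, neither of the other two arcs between contact directions
   exceeds the arc [2 * g] between them. *)
have gap2 : tau - g <= 2 * g.
  apply: gap_le; [by rewrite g0|by rewrite t1|].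
  have := far3 x2 Cx2; rewrite -/p2 p2E p3E dotr ler_pM2l//.
  by have -> : al + tau - (al + g) = tau - g by ring.
have gap3 : 2 * pi - tau - g <= 2 * g.
  apply: gap_le; [by rewrite g0|by apply/andP; split; lra|].
  have := far3 x1 Cx1; rewrite -/p1 p1E p3E dotr ler_pM2l//.
  have -> : al + tau - (al + - g) = - (2 * pi - tau - g) + pi *+ 2 by rewrite -mulr_natl; ring.
  by rewrite cosD2pi cosN.
have c1 : w / (2 * r) < 1 by rewrite ltr_pdivrMr// mul1r.
have c0 : 0 < w / (2 * r) by exact: divr_gt0.
have c11 : -1 <= w / (2 * r) <= 1 by apply/andP; split; lra.
pose psi := acos (w / (2 * r)).
have cpsi : cos psi = w / (2 * r) by rewrite /psi acosK// in_itv.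
have psi0 : 0 <= psi by exact: acos_ge0.
have psipi : psi <= pi by exact: acos_lepi.
have psip : 0 < psi.
  rewrite lt_neqAle psi0 andbT; apply/eqP => h.
  by move: cpsi; rewrite -h cos0; lra.
(* From [sin g = d / (2 * r) <= w / (2 * r) = cos psi]. Hence all three arcs are at most
   [pi - 2 * psi], and each, being a full turn minus the other two, is at least [4 * psi]. *)
have gpsi : g <= pi / 2 - psi.
  rewrite leNgt; apply/negP => h; have : cos psi < cos (pi / 2 - g).
    by apply: cos_lt => //; lra.
  rewrite cosB cos_pihalf sin_pihalf mul0r add0r mul1r cpsi ltr_pdivrMr// [sin g * _]mulrC sg; lra.
exists psi, (al - g), (al + g), (al + tau); split.
- by rewrite psip /=; lra.
- by rewrite cpsi mulrC divfK// gt_eqF.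
- have OE x : O + (x - O) = x by rewrite addrC subrK.
  split; rewrite -?p1E -?p2E -?p3E OE//; [by case: Cx1|by case: Cx2].
- by split; lra.
Qed.

End ConstantWidth.

(** * The upper bound *)

Section Profile.
Context {R : realType}.
Local Notation q := (Num.sqrt 3 : R).
Variables (b s t mu : R).
Hypothesis b_itv : 0 < b <= pi / 4.
Hypothesis tE : t = 1 - s.
Hypothesis muE : mu = pi / 3 - b.
Hypothesis ssb : s * sin b = 1 / 2.
Hypothesis s2 : 1 / 2 <= s ^+ 2.
Hypothesis s_itv : 0 < s <= (3 + q) / 6.
Hypothesis tileE : s ^+ 2 * mu - q / 3 * s * sin mu = pi / 3 * t ^+ 2.

Let q2 : q ^+ 2 = 3. Proof. exact: sqrt3_sqr. Qed.
Let q_itv : 17 / 10 < q < 7 / 4.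
Proof. by apply: sqrt3_itv; [exact: q2|exact: sqrt3_gt0]. Qed.
Let s7 : 7 / 10 < s.
Proof. by rewrite ltNge; apply/negP => h; move: s2 s_itv; nra. Qed.
Let s8 : s < 4 / 5.
Proof. by move: s_itv q_itv; lra. Qed.

(* In width 1 and circumradius [1 / (2 cos psi)] the competitor has
   [area - t * perimeter = 3 * (profile psi - pi / 3 * t ^+ 2)], see [profileE]; through
   [quarter_area] the derivative contains no inverse function. *)
Definition profile (psi : R) : R := 2 * s ^+ 2 * psi - 2 * quarter_area s (sin psi) +
  sin psi * cos psi - sin psi / cos psi / 2 + (pi / 3 - 2 * psi) * (s - (2 * cos psi)^-1) ^+ 2.

Lemma cos_ge_sqrt3 (psi : R) : 0 <= psi <= pi / 6 -> q / 2 <= cos psi.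
Proof.
move=> /andP[h0 h1]; have [_ <-] := sin_pi6_cos_pi6 R; have p0 := @pi_gt0 R.
move: h1; rewrite le_eqVlt => /predU1P[-> //|h1].
by apply: ltW; rewrite ltr_cos// in_itv/=; apply/andP; split; lra.
Qed.

Lemma sin_le_half (psi : R) : 0 <= psi <= pi / 6 -> 0 <= sin psi <= 1 / 2.
Proof.
move=> h; have c := cos_ge_sqrt3 h; have p0 := @pi_gt0 R.
have s0 : 0 <= sin psi by apply: sin_ge0_pi; move: h; lra.
rewrite s0 /=; have := cos2Dsin2 psi; have := q_itv; have := q2 => h1 h2 h3.
by rewrite leNgt; apply/negP => h4; nra.
Qed.

Lemma is_derive_profile (psi : R) : - (pi / 4) < psi < pi / 4 ->
  is_derive psi 1 profile (2 * s ^+ 2 - 2 * (Num.sqrt (s ^+ 2 - sin psi ^+ 2) * cos psi) +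
    (cos psi ^+ 2 - sin psi ^+ 2) - (1 + sin psi ^+ 2 / cos psi ^+ 2) / 2 -
    2 * (s - (2 * cos psi)^-1) ^+ 2 -
    (pi / 3 - 2 * psi) * (s - (2 * cos psi)^-1) * (sin psi / cos psi ^+ 2)).
Proof.
move=> /andP[h1 h2]; have ss := s7; have hs2 := s2.
have p0 := @pi_gt0 R.
have c0 : 0 < cos psi by apply: cos_gt0_pihalf; apply/andP; split; lra.
have cn0 : cos psi != 0 by rewrite gt_eqF.
have s0 : 0 < s by lra.
have sa : `|sin psi| < s.
  have : 0 < cos (psi + psi) by apply: cos_gt0_pihalf; apply/andP; split; lra.
  rewrite cosD; have := cos2Dsin2 psi => cs cc.
  by rewrite -ltr_sqr ?nnegrE// ?real_normK ?num_real//; [lra|exact: ltW].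
have dq := @is_derive1_comp R (quarter_area s) sin psi _ _ (is_derive_quarter_area s0 sa) (is_derive_sin psi).
have dinv : is_derive psi 1 (fun y : R => (cos y)^-1) (sin psi / cos psi ^+ 2).
  have := @is_deriveV _ cos psi (- sin psi) _ cn0 (is_derive_cos psi).
  by move/is_derive_eq; apply; rewrite /GRing.scale /=; field.
have -> : profile = (2 * s ^+ 2) \*: id - 2 \*: (quarter_area s \o sin) + sin * cos -
   2^-1 \*: (sin * (fun y => (cos y)^-1)) +
   (cst (pi / 3) - 2 \*: id) * ((cst s - 2^-1 \*: (fun y => (cos y)^-1)) * (cst s - 2^-1 \*: (fun y => (cos y)^-1))).
  apply/funext => y; rewrite /profile expr2 invfM.
  transitivity (2 * s ^+ 2 * y - 2 * quarter_area s (sin y) + sin y * cos y - 2^-1 * (sin y * (cos y)^-1) +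
   (pi / 3 - 2 * y) * ((s - 2^-1 * (cos y)^-1) * (s - 2^-1 * (cos y)^-1))); last by [].
  by ring.
apply: is_derive_eq; rewrite /GRing.scale /=.
pose B := s - 2^-1 * (cos psi)^-1.
rewrite -[(cst (pi / 3) - 2 \*: id) psi]/(pi / 3 - 2 * psi).
rewrite -[((cst s - 2^-1 \*: (fun y : R => (cos y)^-1)) * (cst s - 2^-1 \*: (fun y : R => (cos y)^-1))) psi]/(B * B).
rewrite -[(cst s - 2^-1 \*: (fun y : R => (cos y)^-1)) psi]/B /B.
by set X := Num.ExtraDef.sqrtr _; field.
Qed.

(** Here [c] is [cos psi], [S] is [sin psi ^+ 2] and [k] the square root in the derivative. The
    expression is [- (2 / c) * S] times [c + 1 / (2 * c) - k - 1 / (s + k)]. The value of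
    [u + 1 / (2 * u)] at [s] separates the two halves: it increases for [u >= s] because
    [s ^+ 2 >= 1 / 2], and at [s] it dominates [k + 1 / (s + k)]. *)
Lemma slope_le (k c S : R) : 0 <= k <= s -> 1 <= s + k -> s <= c -> 0 <= S -> k ^+ 2 = s ^+ 2 - S ->
  c ^+ 2 = 1 - S ->
  2 * s ^+ 2 - 2 * (k * c) + (c ^+ 2 - S) - (1 + S / c ^+ 2) / 2 - 2 * (s - (2 * c)^-1) ^+ 2 <= 0.
Proof.
move=> /andP[k0 ks] sk sc S0 kE cE; have s0 := s7; have hs := s2.
have c0 : 0 < c by lra.
have c_neq0 : c != 0 by rewrite gt_eqF.
have -> : 2 * s ^+ 2 - 2 * (k * c) + (c ^+ 2 - S) - (1 + S / c ^+ 2) / 2 - 2 * (s - (2 * c)^-1) ^+ 2 =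
   2 / c * (s - c ^+ 2 * k) - 2 * S - S / c ^+ 2.
  have -> : S / c ^+ 2 = 1 / c ^+ 2 - 1 by rewrite -[S](subKr 1) -cE; field.
  have SE : S = 1 - c ^+ 2 by lra.
  by rewrite SE; field.
have -> : 2 / c * (s - c ^+ 2 * k) - 2 * S - S / c ^+ 2 =
   - (2 / c) * (S * (c + 1 / (2 * c)) - (s - c ^+ 2 * k)) by field.
rewrite mulNr oppr_le0; apply: mulr_ge0; first by rewrite divr_ge0// ltW.
have sk0 : s + k != 0 by rewrite gt_eqF//; lra.
have -> : s - c ^+ 2 * k = S * ((s + k)^-1 + k).
  have -> : S = (s - k) * (s + k) by rewrite -subr_sqr; lra.
  have -> : c ^+ 2 = 1 - (s - k) * (s + k) by rewrite -subr_sqr; lra.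
  by field.
rewrite -mulrBr; apply: mulr_ge0 => //.
have h1 : 0 <= (s - k) * (1 - (2 * s * (s + k))^-1).
  apply: mulr_ge0; first lra; rewrite subr_ge0 invf_le1; nra.
have h2 : 0 <= (c - s) * (1 - (2 * s * c)^-1).
  apply: mulr_ge0; first lra; rewrite subr_ge0 invf_le1; nra.
have sn0 : s != 0 by rewrite gt_eqF//; lra.
have e1 : (s - k) * (1 - (2 * s * (s + k))^-1) = s + 1 / (2 * s) - k - (s + k)^-1.
  by field; rewrite ?sn0 ?sk0 ?c_neq0.
have e2 : (c - s) * (1 - (2 * s * c)^-1) = c + 1 / (2 * c) - s - 1 / (2 * s).
  by field; rewrite ?sn0 ?sk0 ?c_neq0.
lra.
Qed.

(** The part of the derivative not covered by [slope_le] is minus a product of nonnegative factors,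
    the essential one being [s - (2 * cos y)^-1]: the circumradius stays below [s]. *)
Lemma profile_decreasing (psi : R) : 0 <= psi <= pi / 6 -> profile (pi / 6) <= profile psi.
Proof.
move=> /andP[p0 p6]; have pp := @pi_gt0 R.
pose F y := - profile y.
pose dF (y : R) := - (2 * s ^+ 2 - 2 * (Num.sqrt (s ^+ 2 - sin y ^+ 2) * cos y) +
    (cos y ^+ 2 - sin y ^+ 2) - (1 + sin y ^+ 2 / cos y ^+ 2) / 2 -
    2 * (s - (2 * cos y)^-1) ^+ 2 -
    (pi / 3 - 2 * y) * (s - (2 * cos y)^-1) * (sin y / cos y ^+ 2)).
suff : F psi <= F (pi / 6) by rewrite /F lerN2.
apply: (@ger0_increasing R F dF psi (pi / 6) p6).
- move=> y /andP[y0 y1]; apply: is_deriveN; apply: is_derive_profile.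
  by apply/andP; split; lra.
- apply: derivable_within_continuous => y; rewrite in_itv /= => /andP[? ?].
  have [|d _] := @is_derive_profile y; first by apply/andP; split; lra.
  exact: derivableN.
move=> y /andP[y0 y1].
have y6 : 0 <= y <= pi / 6 by apply/andP; split; lra.
have c0 := cos_ge_sqrt3 y6; have /andP[sn0 sn1] := sin_le_half y6; have qq := q_itv; have ss := s7.
have hs8 := s8; have hs2 := s2; have hsi := s_itv.
have S1 : sin y ^+ 2 <= 1 / 4 by rewrite expr2; nra.
have k0 : 0 <= s ^+ 2 - sin y ^+ 2 by lra.
set k := Num.sqrt (s ^+ 2 - sin y ^+ 2).
have kE : k ^+ 2 = s ^+ 2 - sin y ^+ 2 by rewrite sqr_sqrtr.
have kp : 0 <= k by exact: sqrtr_ge0.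
have ks : k <= s.
  rewrite -ler_sqr ?nnegrE//; last lra.
  by rewrite kE gerBl sqr_ge0.
have k2 : 1 / 2 <= k by rewrite leNgt; apply/negP => h; nra.
have sk : 1 <= s + k by lra.
have sc : s <= cos y by lra.
have := @slope_le k (cos y) (sin y ^+ 2) _ sk sc (sqr_ge0 _) kE (cos2sin2 y).
rewrite kp ks => /(_ isT) h.
rewrite /dF oppr_ge0 -/k.
have cp : 0 < cos y by lra.
have Rs : 0 <= s - (2 * cos y)^-1.
  by rewrite subr_ge0 -[_^-1]mul1r ler_pdivrMr ?mulr_gt0//; nra.
have : 0 <= (pi / 3 - 2 * y) * (s - (2 * cos y)^-1) * (sin y / cos y ^+ 2).
  apply: mulr_ge0; last by rewrite divr_ge0// sqr_ge0.
  by apply: mulr_ge0 => //; lra.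
lra.
Qed.

Lemma profileE (psi be : R) : 0 <= psi <= pi / 6 -> be = asin (sin psi / s) ->
  profile psi = s ^+ 2 * (2 * psi - be) - s * (2 * cos psi)^-1 * sin (2 * psi - be) +
    (pi / 3 - 2 * psi) * (s - (2 * cos psi)^-1) ^+ 2.
Proof.
move=> h ->; have c0 := cos_ge_sqrt3 h; have sh := sin_le_half h; have qq := q_itv; have ss := s7.
have cn0 : cos psi != 0 by rewrite gt_eqF//; lra.
have s0 : 0 < s by lra.
have sn0 : s != 0 by rewrite gt_eqF.
have a1 : -1 <= sin psi / s <= 1.
  by rewrite ler_pdivlMr// ler_pdivrMr// mul1r; apply/andP; split; lra.
have sb : sin (asin (sin psi / s)) = sin psi / s by rewrite asinK// in_itv.
have k0 : 0 <= s ^+ 2 - sin psi ^+ 2 by nra.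
have cb : cos (asin (sin psi / s)) = Num.sqrt (s ^+ 2 - sin psi ^+ 2) / s.
  have -> : cos (asin (sin psi / s)) = Num.sqrt ((s ^+ 2 - sin psi ^+ 2) * s^-1 ^+ 2).
    by rewrite cos_asin//; congr Num.sqrt; field.
  by rewrite sqrtrM// sqrtr_sqr gtr0_norm// invr_gt0.
rewrite /profile /quarter_area sinB sb cb.
have -> : sin (2 * psi) = 2 * sin psi * cos psi by rewrite mulr_natl mulr2n sinD; ring.
have -> : cos (2 * psi) = 2 * cos psi ^+ 2 - 1.
  by rewrite mulr_natl mulr2n cosD; have := cos2Dsin2 psi; lra.
set X := Num.ExtraDef.sqrtr _; set a := asin _.
by field; rewrite ?sn0 ?cn0.
Qed.

(** At [psi = pi / 6] the angle [be] is [b], the circumradius is [q / 3], and [profile] is the left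
    side of [tileE]. *)
Lemma profile_ge (psi : R) : 0 <= psi <= pi / 6 -> pi / 3 * t ^+ 2 <= profile psi.
Proof.
move=> h; apply: le_trans (profile_decreasing h).
have pp := @pi_gt0 R; have ss := s7; have sn0 : s != 0 by rewrite gt_eqF//; lra.
have [s6 c6] := sin_pi6_cos_pi6 R.
have bE : b = asin (sin (pi / 6) / s).
  rewrite s6 -ssb mulrC mulKf// sinK// in_itv /=.
  by move: b_itv => /andP[? ?]; apply/andP; split; lra.
rewrite (profileE _ bE); last by apply/andP; split; lra.
have -> : 2 * (pi / 6) = pi / 3 :> R by field.
rewrite subrr mul0r addr0 -muE -tileE c6.
have qn0 : q != 0 by rewrite gt_eqF//; have := q_itv; lra.
have -> : (2 * (q / 2))^-1 = q / 3.
  have -> : 2 * (q / 2) = q by field.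
  by apply: (mulfI qn0); rewrite divff// mulrA -expr2 q2 divff.
lra.
Qed.

(** The value at [psi = 0] belongs to the disk of diameter 1: it gives [t <= s - 1 / 2], that is
    [2 * t <= 1 / 2]. *)
Lemma t_le_quarter : t <= 1 / 4.
Proof.
have pp := @pi_gt0 R; have ss := s7; have hs8 := s8.
have h0 : 0 <= (0 : R) <= pi / 6 by rewrite lexx divr_ge0// ltW.
have := profile_ge h0.
have aE : 0 = asin (sin 0 / s) by rewrite sin0 mul0r asin0.
rewrite (profileE h0 aE) mulr0 subrr sin0 !mulr0 subrr add0r subr0 cos0 mulr1.
rewrite ler_pM2l ?divr_gt0// => h.
have : t <= s - 2^-1 by rewrite -ler_sqr ?nnegrE//; rewrite ?tE; lra.
rewrite tE; lra.
Qed.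

End Profile.

(** * Polar angles along circular arcs *)

Section Angle.
Context {R : realType}.
Implicit Types (p x : R * R).

Lemma edist_addl x p : edist (x + p) x = enorm p.
Proof. by rewrite /edist addrC addKr. Qed.

(** The branch of the polar angle with values within [pi / 2] of [al], meaningful where
    [dot (dir al) p] is positive. *)
Definition angle_from (al : R) p : R := al + atan (wedge (dir al) p / dot (dir al) p).

Lemma angle_from_polar al p : 0 < dot (dir al) p ->
  exists2 r, 0 < r & p = r *: dir (angle_from al p).
Proof.
move=> d0; set d := dot (dir al) p in d0 *; pose g := atan (wedge (dir al) p / d).
have g1 : - (pi / 2) < g by exact: atan_gtNpi2.
have g2 : g < pi / 2 by exact: atan_ltpi2.
have c0 : 0 < cos g by apply: cos_gt0_pihalf; rewrite g1 g2.
have tg : sin g / cos g = wedge (dir al) p / d by rewrite -/(tan g) atanK.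
exists (d / cos g); first exact: divr_gt0.
apply: (@polar_of_cos _ (dir al)) => //; first by rewrite divr_ge0// ltW.
  by rewrite divfK// gt_eqF.
by rewrite mulrAC -mulrA tg mulrC divfK// gt_eqF.
Qed.

Lemma angle_from_dir al r u : 0 < r -> - (pi / 2) < u < pi / 2 ->
  angle_from al (r *: dir (al + u)) = al + u.
Proof.
move=> r0 hu; congr (_ + _).
have c0 : 0 < cos u by exact: cos_gt0_pihalf.
have -> : wedge (dir al) (r *: dir (al + u)) = r * sin u.
  have -> : wedge (dir al) (r *: dir (al + u)) = r * wedge (dir al) (dir (al + u)).
    by rewrite /wedge /= /GRing.scale /=; ring.
  by rewrite wedge_dir addrC addKr.
have -> : dot (dir al) (r *: dir (al + u)) = r * cos u.
  have -> : dot (dir al) (r *: dir (al + u)) = r * dot (dir al) (dir (al + u)).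
    by rewrite /dot /= /GRing.scale /=; ring.
  by rewrite dot_dir2 addrC addKr.
have -> : r * sin u / (r * cos u) = tan u by rewrite /tan; field; rewrite !gt_eqF.
by rewrite tanK// in_itv.
Qed.

Lemma angle_from_lt al p p' : 0 < dot (dir al) p -> 0 < dot (dir al) p' ->
  0 < wedge p p' -> angle_from al p < angle_from al p' < angle_from al p + pi.
Proof.
move=> d0 d0' w0; apply/andP; split.
  rewrite /angle_from ltrD2l; apply: lt_atan.
  rewrite ltr_pdivrMr// mulrAC ltr_pdivlMr//.
  rewrite -subr_gt0.
  have -> : wedge (dir al) p' * dot (dir al) p - wedge (dir al) p * dot (dir al) p' =
      dot (dir al) (dir al) * wedge p p' by rewrite /wedge /dot; ring.
  by rewrite dot_dir mul1r.
have h1 := atan_gtNpi2 (wedge (dir al) p / dot (dir al) p).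
have h2 := atan_ltpi2 (wedge (dir al) p' / dot (dir al) p').
rewrite /angle_from; lra.
Qed.

(** In terms of the midpoint and half-length of a piece of arc, the sign of the last factor decides
    whether the polar angle increases along it. *)
Lemma wedge_arc (c : R * R) (rho f f' : R) :
  wedge (c + rho *: dir f) (c + rho *: dir f') = 2 * rho * sin ((f' - f) / 2) *
    (dot c (dir ((f + f') / 2)) + rho * cos ((f' - f) / 2)).
Proof.
set m := (f + f') / 2; set h := (f' - f) / 2.
have -> : f = m - h by rewrite /m /h; field.
have -> : f' = m + h by rewrite /m /h; field.
rewrite /wedge /dot /dir /= /GRing.scale /= !cosB !sinB !cosD !sinD.
have c1 := cos2Dsin2 m; have c2 := cos2Dsin2 h.
transitivity (2 * rho * sin h * (c.1 * cos m + c.2 * sin m) + 2 * rho ^+ 2 * sin h * cos h * (cos m ^+ 2 + sin m ^+ 2)).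
  by ring.
by rewrite c1; ring.
Qed.

Lemma dot_arc al (c : R * R) (rho f : R) :
  dot (dir al) (c + rho *: dir f) = dot (dir al) c + rho * cos (f - al).
Proof. by rewrite -dot_dir2 /dot /= /GRing.scale /=; ring. Qed.

(** For a point of the circle about [C], being within [w] of [x] is the condition
    [D <= 2 * w * dot z (dir g)], linear in [dir g]. Now [dir f] is a combination of [dir f1] and
    [dir f2] with nonnegative coefficients of sum at least 1, and [D >= 0]. *)
Lemma spindle (C x : R * R) (w f1 f2 f : R) : 0 <= w -> f1 <= f <= f2 -> f2 - f1 <= pi / 2 ->
  edist (C + w *: dir f1) x <= w -> edist (C + w *: dir f2) x <= w ->
  edist (C + w *: dir f) x <= w.
Proof.
move=> w0 /andP[h1 h2] hpi; have p0 := @pi_gt0 R.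
pose z := x - C; pose D := dot z z; have D0 : 0 <= D by exact: dot_ge0.
have key g : (edist (C + w *: dir g) x <= w) = (D <= 2 * w * dot z (dir g)).
  rewrite /edist enorm_le//.
  have -> : dot (C + w *: dir g - x) (C + w *: dir g - x) = D - 2 * w * dot z (dir g) + w ^+ 2 * dot (dir g) (dir g).
    by rewrite /D /z /dot /= /GRing.scale /=; ring.
  by rewrite dot_dir mulr1 gerDr subr_le0.
rewrite !key => k1 k2.
move: h1; rewrite le_eqVlt => /predU1P[<- //|h1].
pose a := f2 - f; pose b := f - f1.
have sa : 0 <= sin a by apply: sin_ge0_pi; rewrite /a; apply/andP; split; lra.
have sb : 0 <= sin b by apply: sin_ge0_pi; rewrite /b; apply/andP; split; lra.
have sab : 0 < sin (a + b) by apply: sin_gt0_pi; rewrite /a /b; apply/andP; split; lra.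
have sub : sin (a + b) <= sin a + sin b.
  rewrite sinD; apply: lerD.
    by rewrite ler_piMr// cos_le1.
  by rewrite ler_piMl// cos_le1.
have E : sin (a + b) * dot z (dir f) = sin a * dot z (dir f1) + sin b * dot z (dir f2).
  have gen (u v : R) : sin (u + v) * dot z (dir f) = sin u * dot z (dir (f - v)) + sin v * dot z (dir (f + u)).
    by rewrite /dot /dir /= !sinD !cosD !sinN !cosN; ring.
  by rewrite gen /b /a subKr subrKC.
rewrite -(ler_pM2l sab).
have -> : sin (a + b) * (2 * w * dot z (dir f)) = sin a * (2 * w * dot z (dir f1)) + sin b * (2 * w * dot z (dir f2)).
  by rewrite mulrCA E; ring.
apply: (@le_trans _ _ ((sin a + sin b) * D)); first exact: ler_wpM2r.
by rewrite mulrDl; apply: lerD; exact: ler_wpM2l.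
Qed.

End Angle.

Section SlopedArc.
Context {R : realType}.
Variables (O : R * R) (Om : set (R * R)).
Hypothesis cOm : compact Om.
Hypothesis sOm : segment_closed Om.
Hypothesis OmO : Om O.

(** The first positivity condition keeps the arc in the half plane where [angle_from al] is a polar
    angle; the second, with [m] and [h] the middle and half-length of a piece, makes that angle
    increase by [wedge_arc]. *)
Lemma fan_sloped_arc (al : R) (c : R * R) (rho f1 f2 eps : R) :
  0 < rho -> f1 <= f2 -> 0 < eps -> f2 - f1 <= pi ->
  (forall f, f1 <= f <= f2 -> 0 < dot (dir al) (c + rho *: dir f)) ->
  (forall m h, f1 <= m <= f2 -> 0 <= h <= (f2 - f1) / 2 -> 0 < dot c (dir m) + rho * cos h) ->
  (forall f, f1 <= f <= f2 -> Om (O + (c + rho *: dir f))) ->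
  angle_from al (c + rho *: dir f1) <= angle_from al (c + rho *: dir f2) /\
  fan O Om (angle_from al (c + rho *: dir f1)) (angle_from al (c + rho *: dir f2))
    (c + rho *: dir f1) (c + rho *: dir f2) (rho * (f2 - f1))
    ((rho * (wedge c (dir f2) - wedge c (dir f1)) + rho ^+ 2 * (f2 - f1)) / 2 - eps).
Proof.
move=> rho0 f12 eps0 fpi dpos wpos inOm; have p0 := @pi_gt0 R.
have mono f f' : f1 <= f -> f < f' -> f' <= f2 ->
    angle_from al (c + rho *: dir f) < angle_from al (c + rho *: dir f') <
    angle_from al (c + rho *: dir f) + pi.
  move=> h1 h2 h3; apply: angle_from_lt.
  - by apply: dpos; apply/andP; split; lra.
  - by apply: dpos; apply/andP; split; lra.
  rewrite wedge_arc; apply: mulr_gt0.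
    by apply: mulr_gt0; [lra|apply: sin_gt0_pi; apply/andP; split; lra].
  by apply: wpos; apply/andP; split; lra.
split.
  move: f12; rewrite le_eqVlt => /predU1P[-> //|f12].
  by have /andP[/ltW] := mono f1 f2 (lexx _) f12 (lexx _).
apply: (@fan_arc _ O Om cOm sOm OmO c rho f1 f2 (fun f => angle_from al (c + rho *: dir f)) 1 eps) => //.
- by move=> f hf; apply: angle_from_polar; exact: dpos.
- by move=> f f' h1 /andP[h2 _] h3; exact: mono.
- have h1 := atan_gtNpi2 (wedge (dir al) (c + rho *: dir f1) / dot (dir al) (c + rho *: dir f1)).
  have h2 := atan_ltpi2 (wedge (dir al) (c + rho *: dir f2) / dot (dir al) (c + rho *: dir f2)).
  by rewrite /angle_from; lra.
Qed.

Lemma fan_centered_arc (rho f1 f2 eps : R) :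
  0 < rho -> f1 <= f2 -> 0 < eps -> f2 <= f1 + 2 * pi ->
  (forall f, Om (O + rho *: dir f)) ->
  fan O Om f1 f2 (rho *: dir f1) (rho *: dir f2) (rho * (f2 - f1))
    (rho ^+ 2 * (f2 - f1) / 2 - eps).
Proof.
move=> rho0 f12 eps0 fpi inOm; have p0 := @pi_gt0 R.
have := @fan_arc _ O Om cOm sOm OmO 0 rho f1 f2 id 1 eps rho0 f12 ltr01 eps0.
have w0 z : wedge 0 z = 0 by rewrite /wedge /=; ring.
rewrite !add0r !w0 subrr mulr0 add0r; apply => //.
- by move=> f _; exists rho; rewrite ?add0r.
- by move=> f f' _ /andP[h1 h2] _; have := @pi_ge2 R; rewrite h1 /=; lra.
- by move=> f _; rewrite add0r.
Qed.

End SlopedArc.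

(** * The competitor near one contact point *)

Section Corner.
Context {R : realType}.
Variables (O : R * R) (K : set (R * R)) (w r s be psi al : R).
Hypothesis cK : compact K.
Hypothesis sK : segment_closed K.
Hypothesis KO : K O.
Hypothesis w0 : 0 < w.
Hypothesis diamK : forall x y, K x -> K y -> edist x y <= w.
Hypothesis complete : forall p, (forall x, K x -> edist p x <= w) -> K p.
Hypothesis ball : forall x, K x -> edist x O <= r.
Hypothesis contact : K (O + r *: dir al).
Hypothesis psi_itv : 0 < psi <= pi / 6.
Hypothesis rE : 2 * r * cos psi = w.
Hypothesis s_itv : 7 / 10 < s < 4 / 5.
Hypothesis be_itv : psi <= be <= 2 * psi.
Hypothesis sbe : s * sin be = sin psi.

Local Notation t := (1 - s).
Local Notation eta := (s * w * cos be - r * cos (2 * psi)).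

Let p0 : 0 < pi :> R. Proof. exact: pi_gt0. Qed.
Let cpsi : 17 / 20 < cos psi.
Proof.
have h : 0 <= psi <= pi / 6 by move: psi_itv; lra.
have q2 := @sqrt3_sqr R; have q0 := sqrt3_gt0 R.
have := sqrt3_itv q2 q0; have := cos_ge_sqrt3 h; lra.
Qed.
Let cpsi1 : cos psi <= 1. Proof. exact: cos_le1. Qed.
Let r_itv : 1 / 2 * w <= r < 3 / 5 * w.
Proof. by move: rE w0 cpsi cpsi1 => h1 h2 h3 h4; apply/andP; split; nra. Qed.
Let c2psi : 2 / 5 < cos (2 * psi) <= 1.
Proof.
have -> : 2 * psi = psi + psi by ring.
by rewrite cos_le1 andbT cosD; have h1 := cos2Dsin2 psi; have h2 := cpsi; nra.
Qed.
Let cos_large (x : R) : - (2 * psi) <= x <= 2 * psi -> cos (2 * psi) <= cos x.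
Proof.
move=> /andP[h1 h2]; have hp := psi_itv; have pp := p0.
wlog x0 : x h1 h2 / 0 <= x => [H|].
  have [x0|x0] := leP 0 x; first exact: H.
  by rewrite -[cos x]cosN; apply: H; lra.
move: h2; rewrite le_eqVlt => /predU1P[-> //|h2].
by apply: ltW; rewrite ltr_cos// in_itv/=; apply/andP; split; lra.
Qed.
(** The law of sines in the triangle formed by [O], the point [O + eta *: dir al] and the arc centre
    [O - r *: dir (al - 2 * psi)]. *)
Let eta_ge0 : 0 <= eta.
Proof.
have sb0 : 0 < sin be.
  by apply: sin_gt0_pi; have := psi_itv; have := be_itv; have := p0; lra.
rewrite -(pmulr_rge0 _ sb0).
have -> : sin be * (s * w * cos be - r * cos (2 * psi)) = r * sin (2 * psi - be).
  have e : s * w * sin be = r * sin (2 * psi).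
    rewrite mulrAC sbe mulr_natl mulr2n sinD -rE; ring.
  by rewrite sinB; transitivity (s * w * sin be * cos be - sin be * r * cos (2 * psi));
    [ring|rewrite e; ring].
apply: mulr_ge0; first by have := r_itv; have := w0; lra.
by apply: sin_ge0_pi; have := psi_itv; have := be_itv; have := p0; lra.
Qed.

(** The centres of the two arcs are [s * w] apart in direction [al - be], which is the difference of
    the radii; hence internal tangency at this point. *)
Let junction1 : eta *: dir al + (t * w) *: dir (al - be) = - r *: dir (al - 2 * psi) + w *: dir (al - be).
Proof.
have e : s * w * sin be = r * sin (2 * psi).
  by rewrite mulrAC sbe mulr_natl mulr2n sinD -rE; ring.
have e1 := congr1 (fun z => z * sin al) e; have e2 := congr1 (fun z => z * cos al) e.
rewrite /= in e1 e2.
by apply: plane_eq; rewrite /= /GRing.scale /= ?cosB ?sinB; lra.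
Qed.

Let junction2 : eta *: dir al + (t * w) *: dir (al + be) = - r *: dir (al + 2 * psi) + w *: dir (al + be).
Proof.
have e : s * w * sin be = r * sin (2 * psi).
  by rewrite mulrAC sbe mulr_natl mulr2n sinD -rE; ring.
have e1 := congr1 (fun z => z * sin al) e; have e2 := congr1 (fun z => z * cos al) e.
rewrite /= in e1 e2.
by apply: plane_eq; rewrite /= /GRing.scale /= ?cosD ?sinD; lra.
Qed.

(** Extended to [al - psi], the arc runs from a point at distance [w - r] from [O] to the contact
    point. Both are within [w] of all of [K], so by [spindle] is every point between, and
    completeness applies. *)
Let in1 (f : R) : al - 2 * psi <= f <= al - be -> K (O + (- r *: dir (al - 2 * psi) + w *: dir f)).
Proof.
move=> /andP[f1 f2]; apply: complete => x Kx; rewrite addrA.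
have hp := psi_itv; have hb := be_itv; have hr := r_itv; have pp := p0.
apply: (@spindle R _ _ _ (al - 2 * psi) (al - psi)); [exact: ltW|by apply/andP; split; lra|lra| |].
  have -> : O + - r *: dir (al - 2 * psi) + w *: dir (al - 2 * psi) = O + (w - r) *: dir (al - 2 * psi).
    by rewrite scaleNr -addrA [- _ + _]addrC -scalerBl.
  apply: le_trans (edist_triangle O _ _) _.
  rewrite edist_addl enormZ enorm_dir mulr1 ger0_norm; last by have := w0; lra.
  by have := ball Kx; rewrite edistC; lra.
have -> : O + - r *: dir (al - 2 * psi) + w *: dir (al - psi) = O + r *: dir al.
  rewrite -addrA; congr (O + _).
  have -> : dir al = dir ((al - psi) + psi) by congr dir; ring.
  have -> : dir (al - 2 * psi) = dir ((al - psi) - psi) by congr dir; ring.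
  apply: plane_eq; rewrite /= /GRing.scale /= -rE.
    by rewrite [cos (_ + psi)]cosD [cos (_ - psi)]cosB; ring.
  by rewrite [sin (_ + psi)]sinD [sin (_ - psi)]sinB; ring.
exact: diamK.
Qed.

Let in3 (f : R) : al + be <= f <= al + 2 * psi -> K (O + (- r *: dir (al + 2 * psi) + w *: dir f)).
Proof.
move=> /andP[f1 f2]; apply: complete => x Kx; rewrite addrA.
have hp := psi_itv; have hb := be_itv; have hr := r_itv; have pp := p0.
apply: (@spindle R _ _ _ (al + psi) (al + 2 * psi)); [exact: ltW|by apply/andP; split; lra|lra| |].
  have -> : O + - r *: dir (al + 2 * psi) + w *: dir (al + psi) = O + r *: dir al.
    rewrite -addrA; congr (O + _).
    have -> : dir al = dir ((al + psi) - psi) by congr dir; ring.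
    have -> : dir (al + 2 * psi) = dir ((al + psi) + psi) by congr dir; ring.
    apply: plane_eq; rewrite /= /GRing.scale /= -rE.
      by rewrite [cos (_ + psi + psi)]cosD [cos (_ - psi)]cosB; ring.
    by rewrite [sin (_ + psi + psi)]sinD [sin (_ - psi)]sinB; ring.
  exact: diamK.
have -> : O + - r *: dir (al + 2 * psi) + w *: dir (al + 2 * psi) = O + (w - r) *: dir (al + 2 * psi).
  by rewrite scaleNr -addrA [- _ + _]addrC -scalerBl.
apply: le_trans (edist_triangle O _ _) _.
rewrite edist_addl enormZ enorm_dir mulr1 ger0_norm; last by have := w0; lra.
by have := ball Kx; rewrite edistC; lra.
Qed.

(** It suffices that all of [K] is within [s * w] of [O + eta *: dir al]. [K] lies in the lens of
    points within [r] of [O] and within [w] of the contact point. By Stewart's identity the squared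
    distance to a point between these two centres is controlled by both constraints, with equality
    at the lens corners [O - r *: dir (al - 2 * psi)] and [O - r *: dir (al + 2 * psi)], where it is
    [(s * w) ^+ 2]. *)
Let in2 (f : R) : K (O + (eta *: dir al + (t * w) *: dir f)).
Proof.
apply: complete => x Kx.
have hr := r_itv; have wp := w0; have hs := s_itv.
have r0 : 0 < r by lra.
suff h : edist (O + eta *: dir al) x <= s * w.
  rewrite addrA; apply: le_trans (edist_triangle (O + eta *: dir al) _ _) _.
  rewrite edist_addl enormZ enorm_dir mulr1 ger0_norm; last first.
    by apply: mulr_ge0; lra.
  lra.
rewrite /edist enorm_le; last by apply: mulr_ge0; lra.
pose z := x - O; pose X := dot z z; pose Y := dot (dir al) z.
have X0 : X <= r ^+ 2.
  by rewrite /X -enorm_sqr ler_sqr ?nnegrE ?enorm_ge0 ?ball// ltW.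
have XY : X - 2 * r * Y + r ^+ 2 <= w ^+ 2.
  have := diamK contact Kx; rewrite /edist enorm_le; last exact: ltW.
  have -> : dot (O + r *: dir al - x) (O + r *: dir al - x) = X - 2 * r * Y + r ^+ 2 * dot (dir al) (dir al).
    by rewrite /X /Y /z /dot /= /GRing.scale /=; ring.
  by rewrite dot_dir mulr1.
have -> : dot (O + eta *: dir al - x) (O + eta *: dir al - x) = X - 2 * eta * Y + eta ^+ 2 * dot (dir al) (dir al).
  by rewrite /X /Y /z /dot /= /GRing.scale /=; ring.
rewrite dot_dir mulr1.
have e0 := eta_ge0; set et := eta in e0 *.
have cs := cos2Dsin2 be; have cs' := cos2Dsin2 psi.
have c0 : 0 < cos psi by have := cpsi; lra.
have c2 : cos (2 * psi) = 2 * cos psi ^+ 2 - 1.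
  have -> : 2 * psi = psi + psi by ring.
  by rewrite cosD; lra.
have etE : et = s * w * cos be - w * cos psi + r.
  by rewrite /et c2 -rE; ring.
have kE : (s * cos be) ^+ 2 = s ^+ 2 - sin psi ^+ 2.
  have cE : cos be ^+ 2 = 1 - sin be ^+ 2 by lra.
  by rewrite -sbe !exprMn cE; ring.
have kc : s * cos be <= cos psi.
  rewrite leNgt; apply/negP => h.
  have : cos psi ^+ 2 < (s * cos be) ^+ 2 by rewrite ltr_sqr ?nnegrE//; lra.
  rewrite kE; nra.
have etr : et <= r by rewrite etE; have := ler_wpM2l (ltW wp) kc; lra.
have main : r * (X - 2 * et * Y + et ^+ 2) <= r * (s * w) ^+ 2.
  have -> : r * (X - 2 * et * Y + et ^+ 2) = (r - et) * X + et * (X - 2 * r * Y + r ^+ 2) + r * et ^+ 2 - et * r ^+ 2.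
    by ring.
  have h1 : (r - et) * X <= (r - et) * r ^+ 2 by rewrite ler_wpM2l// subr_ge0.
  have h2 : et * (X - 2 * r * Y + r ^+ 2) <= et * w ^+ 2 by rewrite ler_wpM2l.
  have h3 : r * (s * w) ^+ 2 = (r - et) * r ^+ 2 + et * w ^+ 2 + r * et ^+ 2 - et * r ^+ 2.
    have -> : (s * w) ^+ 2 = w ^+ 2 * ((s * cos be) ^+ 2 + sin psi ^+ 2) by rewrite kE; ring.
    have -> : sin psi ^+ 2 = 1 - cos psi ^+ 2 by lra.
    rewrite etE -rE; ring.
  lra.
by rewrite -(ler_pM2l r0).
Qed.

Let big (h : R) : 0 <= h <= psi -> 17 / 20 <= cos h.
Proof.
have hp := psi_itv; have pp := p0; have hc := cpsi.
move=> /andP[h0 h1]; apply: (@le_trans _ _ (cos psi)); first exact: ltW.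
move: h1; rewrite le_eqVlt => /predU1P[-> //|h1].
by apply: ltW; rewrite ltr_cos// in_itv/=; apply/andP; split; lra.
Qed.

Let cos_pos (x : R) : - (2 * psi) <= x <= 2 * psi -> 0 < cos x.
Proof. by move=> /cos_large; have := c2psi; lra. Qed.

Let dotZ (a x y : R) : dot (a *: dir x) (dir y) = a * cos (y - x).
Proof. by rewrite -dot_dir2 /dot /= /GRing.scale /=; ring. Qed.

Let dotZ' (a x y : R) : dot (dir y) (a *: dir x) = a * cos (x - y).
Proof. by rewrite -dot_dir2 /dot /= /GRing.scale /=; ring. Qed.

Let wedgeZ (a x y : R) : wedge (a *: dir x) (dir y) = a * sin (y - x).
Proof. by rewrite -wedge_dir /wedge /= /GRing.scale /=; ring. Qed.

Let wide (f : R) : cos (2 * psi) <= cos f -> 0 < - r * cos (2 * psi) + w * cos f.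
Proof.
move=> h; have wp := w0; have := ler_wpM2l (ltW wp) h.
have : 0 < (w - r) * cos (2 * psi).
  by apply: mulr_gt0; [have := r_itv; lra|have := c2psi; lra].
lra.
Qed.

Let dp1 (f : R) : al - 2 * psi <= f <= al - be ->
  0 < dot (dir al) (- r *: dir (al - 2 * psi) + w *: dir f).
Proof.
move=> /andP[h1 h2]; rewrite dot_arc dotZ'.
have -> : al - 2 * psi - al = - (2 * psi) by ring.
rewrite cosN; apply: wide; apply: cos_large.
by have := be_itv; have := psi_itv; lra.
Qed.

Let dp3 (f : R) : al + be <= f <= al + 2 * psi ->
  0 < dot (dir al) (- r *: dir (al + 2 * psi) + w *: dir f).
Proof.
move=> /andP[h1 h2]; rewrite dot_arc dotZ'.
have -> : al + 2 * psi - al = 2 * psi by ring.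
apply: wide; apply: cos_large.
by have := be_itv; have := psi_itv; lra.
Qed.

Let narrow (x h : R) : 0 <= h <= psi -> 0 < - r * cos x + w * cos h.
Proof.
move=> /big hh; have wp := w0; have hr := r_itv; have r0 : 0 <= r by lra.
have := ler_wpM2l r0 (cos_le1 x); have := ler_wpM2l (ltW wp) hh; lra.
Qed.

Let wp1 (m h : R) : al - 2 * psi <= m <= al - be ->
  0 <= h <= (al - be - (al - 2 * psi)) / 2 ->
  0 < dot (- r *: dir (al - 2 * psi)) (dir m) + w * cos h.
Proof.
move=> _ hh; rewrite dotZ; apply: narrow.
by have := be_itv; have := psi_itv; lra.
Qed.

Let wp3 (m h : R) : al + be <= m <= al + 2 * psi ->
  0 <= h <= (al + 2 * psi - (al + be)) / 2 ->
  0 < dot (- r *: dir (al + 2 * psi)) (dir m) + w * cos h.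
Proof.
move=> _ hh; rewrite dotZ; apply: narrow.
by have := be_itv; have := psi_itv; lra.
Qed.

Let tw0 : 0 < t * w.
Proof. by have hs := s_itv; apply: mulr_gt0 => //; lra. Qed.

Let dp2 (f : R) : al - be <= f <= al + be ->
  0 < dot (dir al) (eta *: dir al + (t * w) *: dir f).
Proof.
move=> /andP[h1 h2]; rewrite dot_arc dotZ' subrr cos0 mulr1.
apply: ltr_wpDl; first exact: eta_ge0.
apply: (mulr_gt0 tw0); apply: cos_pos.
by have := be_itv; lra.
Qed.

Let wp2 (m h : R) : al - be <= m <= al + be ->
  0 <= h <= (al + be - (al - be)) / 2 ->
  0 < dot (eta *: dir al) (dir m) + (t * w) * cos h.
Proof.
move=> /andP[h1 h2] h3; rewrite dotZ.
apply: ltr_wpDl.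
  apply: (mulr_ge0 eta_ge0); apply: ltW; apply: cos_pos.
  by have := be_itv; lra.
apply: (mulr_gt0 tw0); apply: cos_pos.
by have := psi_itv; have := be_itv; lra.
Qed.

Let endE u : - r *: dir u + w *: dir u = (w - r) *: dir u.
Proof. by rewrite scaleNr addrC -scalerBl. Qed.

Let angE (x : R) : - (2 * psi) <= x <= 2 * psi ->
  angle_from al ((w - r) *: dir (al + x)) = al + x.
Proof.
move=> hx; apply: angle_from_dir; first by have := r_itv; have := w0; lra.
by have := psi_itv; have := p0; lra.
Qed.

Let es : eta * sin be = r * sin (2 * psi - be).
Proof.
have e : s * w * sin be = r * sin (2 * psi).
  have -> : 2 * psi = psi + psi by ring.
  by rewrite sinD mulrAC sbe -rE; ring.
by rewrite sinB; have := congr1 (fun z => z * cos be) e; rewrite /=; lra.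
Qed.

(* Arcs of radius [w] about [O - r *: dir (al -+ 2 * psi)], joined by an arc of radius
   [t * w] about [O + eta *: dir al]; [eta] makes the tangents agree at the junctions. *)
Lemma fan_corner (eps : R) : 0 < eps ->
  fan O K (al - 2 * psi) (al + 2 * psi) ((w - r) *: dir (al - 2 * psi)) ((w - r) *: dir (al + 2 * psi))
    (2 * w * (2 * psi - be) + 2 * (1 - s) * w * be)
    (w ^+ 2 * (2 * psi - be) - s * w * r * sin (2 * psi - be) + (1 - s) ^+ 2 * w ^+ 2 * be - 3 * eps).
Proof.
move=> eps0.
have hp := psi_itv; have hb := be_itv; have pp := p0.
have o1 : al - 2 * psi <= al - be by lra.
have o2 : al - be <= al + be by lra.
have o3 : al + be <= al + 2 * psi by lra.
have q1 : al - be - (al - 2 * psi) <= pi by lra.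
have q2 : al + be - (al - be) <= pi by lra.
have q3 : al + 2 * psi - (al + be) <= pi by lra.
have turn : al + 2 * psi <= al - 2 * psi + 2 * pi by lra.
have ang1 : angle_from al ((w - r) *: dir (al - 2 * psi)) = al - 2 * psi.
  by apply: angE; lra.
have ang2 : angle_from al ((w - r) *: dir (al + 2 * psi)) = al + 2 * psi.
  by apply: angE; lra.
have [m1 F1] := @fan_sloped_arc _ O K cK sK KO al _ _ _ _ _ w0 o1 eps0 q1 dp1 wp1 in1.
have [m2 F2] := @fan_sloped_arc _ O K cK sK KO al _ _ _ _ _ tw0 o2 eps0 q2 dp2 wp2 (fun f _ => in2 f).
have [m3 F3] := @fan_sloped_arc _ O K cK sK KO al _ _ _ _ _ w0 o3 eps0 q3 dp3 wp3 in3.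
rewrite junction1 junction2 in m2 F2.
rewrite endE ang1 in m1 F1; rewrite endE ang2 in m3 F3.
have F12 := fan_cat cK m1 m2 (le_trans m3 turn) F1 F2.
have F := fan_cat cK (le_trans m1 m2) m3 turn F12 F3.
clear F1 F2 F3 F12 m1 m2 m3.
have ese := es.
apply: fan_weaken F; first lra.
rewrite !wedgeZ.
have -> : al - be - (al - 2 * psi) = 2 * psi - be by ring.
have -> : al + be - al = be by ring.
have -> : al - be - al = - be by ring.
have -> : al + be - (al + 2 * psi) = - (2 * psi - be) by ring.
rewrite !subrr sin0 !sinN.
set S := sin (2 * psi - be) in ese *; set et := eta in ese *.
have es' : t * w * (et * sin be - et * - sin be) = 2 * (t * w) * (r * S) by rewrite -ese; ring.
rewrite es'; lra.
Qed.

End Corner.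

(** * Assembling the competitor *)

Section UpperBound.
Context {R : realType}.
Implicit Types (K : set (R * R)) (w t s : R).

(** Inscribed polygons reach the area [A] only up to [eps], while their perimeters never exceed [L].
    For a tolerance [d] the error is taken such that [A - eps = A / (1 + d * tau)]. *)
Lemma cheeger_le K (tau L A : R) : 0 < tau -> 0 < L -> tau * L <= A ->
  (forall eps, 0 < eps -> exists E : set (measurableTypeR R * measurableTypeR R),
    [/\ measurable E, E `<=` K, ((A - eps)%:E <= area E)%E & (perimeter E <= L%:E)%E]) ->
  (cheeger K <= (tau^-1)%:E)%E.
Proof.
move=> tau0 L0 LA h; apply/lee_addgt0Pr => d d0.
have A0 : 0 < A by apply: lt_le_trans LA; exact: mulr_gt0.
have u0 : 0 < 1 + d * tau by apply: ltr_pwDl => //; apply: ltW; exact: mulr_gt0.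
have eps0 : 0 < A * (d * tau) / (1 + d * tau) by rewrite divr_gt0 // mulr_gt0 // mulr_gt0.
have [E [mE EK]] := h _ eps0.
have -> : A - A * (d * tau) / (1 + d * tau) = A / (1 + d * tau) by field; lra.
set B := A / (1 + d * tau); have B0 : 0 < B by rewrite divr_gt0.
have LB : L / B <= tau^-1 + d.
  rewrite ler_pdivrMr// /B mulrA ler_pdivlMr// -(ler_pM2l tau0) mulrA.
  have -> : tau * ((tau^-1 + d) * A) = A * (1 + d * tau) by field; lra.
  by rewrite ler_wpM2r// ltW.
move=> EA EP; apply: (@le_trans _ _ (perimeter E / area E)%E).
  apply: ereal_inf_lbound; exists E => //; split => //.
  by apply: lt_le_trans EA; rewrite lte_fin.
case aE : (area E) EA => [a| |]; rewrite ?lee_fin//.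
- move=> Ba; have a0 : 0 < a by lra.
  rewrite inver gt_eqF//; apply: (@le_trans _ _ (L%:E * (a^-1)%:E)%E).
    by apply: lee_wpmul2r => //; rewrite lee_fin invr_ge0 ltW.
  rewrite -EFinM -EFinD lee_fin; apply: le_trans LB.
  by rewrite ler_pM2l// lef_pV2.
- by move=> _; rewrite invey mule0 -EFinD lee_fin addr_ge0 ?invr_ge0 ?ltW.
Qed.

(** The upper bound [2 * psi] comes from [1 <= 2 * s * cos psi], which says that the circumradius is
    at most [s] times the width. *)
Lemma asin_div_itv s psi : 7 / 10 < s < 1 -> 1 <= 2 * s * cos psi -> 0 < psi <= pi / 6 ->
  [/\ psi <= asin (sin psi / s), asin (sin psi / s) <= 2 * psi & s * sin (asin (sin psi / s)) = sin psi].
Proof.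
move=> hs sc hpsi; have p0 := @pi_gt0 R.
have h : 0 <= psi <= pi / 6 by lra.
have /andP[sn0 sn1] := sin_le_half h.
have s0 : 0 < s by lra.
have hx : -1 <= sin psi / s <= 1.
  by rewrite ler_pdivlMr// ler_pdivrMr//; apply/andP; split; lra.
have sb : sin (asin (sin psi / s)) = sin psi / s by rewrite asinK// in_itv.
have b1 := asin_geNpi2 hx; have b2 := asin_lepi2 hx.
have mono x : 0 <= x <= pi / 2 -> (x <= asin (sin psi / s)) = (sin x <= sin psi / s).
  move=> hx'; rewrite -[in RHS]sb leNgt [in RHS]leNgt; congr negb.
  by rewrite ltr_sin// in_itv/=; apply/andP; split; lra.
have mono' x : 0 <= x <= pi / 2 -> (asin (sin psi / s) <= x) = (sin psi / s <= sin x).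
  move=> hx'; rewrite -[in RHS]sb leNgt [in RHS]leNgt; congr negb.
  by rewrite ltr_sin// in_itv/=; apply/andP; split; lra.
split; last by rewrite sb; field; lra.
- rewrite mono; last lra.
  by rewrite ler_pdivlMr//; nra.
- rewrite mono'; last lra.
  have -> : sin (2 * psi) = 2 * sin psi * cos psi.
    have -> : 2 * psi = psi + psi by ring.
    by rewrite sinD; ring.
  by rewrite ler_pdivrMr//; have := ler_wpM2l sn0 sc; lra.
Qed.

(** The disk of radius [w / 2] has ratio [4 / w], and [t <= 1 / 4]. *)
Lemma cheeger_disk w t O K : compact K -> segment_closed K -> 0 < w -> 0 < t -> t <= 1 / 4 ->
  K O -> (forall f, K (O + (w / 2) *: dir f)) -> (cheeger K <= ((w * t)^-1)%:E)%E.
Proof.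
move=> cK sK w0 t0 t4 KO Kd; have p0 := @pi_gt0 R.
apply: (@cheeger_le K (w * t) (w / 2 * (2 * pi)) ((w / 2) ^+ 2 * (2 * pi) / 2)).
- exact: mulr_gt0.
- by rewrite mulr_gt0//; lra.
- have -> : (w / 2) ^+ 2 * (2 * pi) / 2 = w ^+ 2 * pi * (1 / 4) by field.
  have -> : w * t * (w / 2 * (2 * pi)) = w ^+ 2 * pi * t by field.
  by rewrite ler_wpM2l// ltW// mulr_gt0// exprn_gt0.
move=> eps eps0.
have F := @fan_centered_arc _ O K cK sK KO (w / 2) 0 (0 + 2 * pi) eps _ _ eps0 (lexx _) Kd.
have {}F := F ltac:(lra) ltac:(lra).
have per : dir (0 + 2 * pi) = dir 0 :> R * R.
  by rewrite /dir add0r mulr_natl cos2pi sin2pi cos0 sin0.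
rewrite per in F; have [E [mE EK EA EP]] := fan_close cK F.
exists E; split => //.
  by apply: le_trans EA; rewrite lee_fin; lra.
by apply: le_trans EP _; rewrite lee_fin; lra.
Qed.

Lemma dirDpi2 (x : R) : dir (x + 2 * pi) = dir x.
Proof. by rewrite /dir cosD sinD mulr_natl cos2pi sin2pi; apply: plane_eq; rewrite /=; ring. Qed.

(** The difference of the two sides is [3 * w ^+ 2] times the difference in the hypothesis, once
    [(2 * cos psi)^-1] is written as [r / w]. *)
Lemma corner_ratio s t w r psi be S : t = 1 - s -> 0 < w -> 0 < cos psi -> 2 * r * cos psi = w ->
  pi / 3 * t ^+ 2 <= s ^+ 2 * (2 * psi - be) - s / (2 * cos psi) * S +
    (pi / 3 - 2 * psi) * (s - (2 * cos psi)^-1) ^+ 2 ->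
  w * t * (3 * (2 * w * (2 * psi - be) + 2 * (1 - s) * w * be) + (w - r) * (2 * pi - 12 * psi)) <=
  3 * (w ^+ 2 * (2 * psi - be) - s * w * r * S + (1 - s) ^+ 2 * w ^+ 2 * be) +
    (w - r) ^+ 2 * (pi - 6 * psi).
Proof.
move=> -> w0 c0 rE.
have -> : (2 * cos psi)^-1 = r / w by rewrite -rE; field; nra.
rewrite -subr_ge0 => h; rewrite -subr_ge0; move: h; set D := (X in 0 <= X -> _).
set N := (X in _ -> 0 <= X).
have -> : D = w ^- 2 / 3 * N by rewrite /D /N; field; lra.
by rewrite pmulr_rge0// divr_gt0// invr_gt0 exprn_gt0.
Qed.

Lemma corner_length_gt0 s w r psi be : 0 < w -> r < w -> s < 1 -> psi <= be <= 2 * psi ->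
  0 < psi <= pi / 6 ->
  0 < 3 * (2 * w * (2 * psi - be) + 2 * (1 - s) * w * be) + (w - r) * (2 * pi - 12 * psi).
Proof.
move=> w0 rw s1 hbe hpsi.
have h1 : 0 <= (w - r) * (2 * pi - 12 * psi) by apply: mulr_ge0; lra.
have h2 : 0 <= w * (2 * psi - be) by apply: mulr_ge0; lra.
have h3 : 0 < (1 - s) * w * be by apply: mulr_gt0; [apply: mulr_gt0|]; lra.
lra.
Qed.

(** Each corner takes up an angle [4 * psi]; the gaps are closed by arcs of radius [w - r] about
    [O], whose total angle is [2 * pi - 12 * psi] wherever the contact points lie. Of the error,
    [9 * eps] stems from the corners and [3 * eps] from the gaps. *)
Lemma fan_three_corners w r s be psi a1 a2 a3 eps O K :
  compact K -> segment_closed K -> K O -> 0 < w -> r < w ->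
  (forall x y, K x -> K y -> edist x y <= w) ->
  (forall p, (forall x, K x -> edist p x <= w) -> K p) ->
  (forall x, K x -> edist x O <= r) ->
  [/\ K (O + r *: dir a1), K (O + r *: dir a2) & K (O + r *: dir a3)] ->
  0 < psi <= pi / 6 -> 2 * r * cos psi = w -> 7 / 10 < s < 4 / 5 ->
  psi <= be <= 2 * psi -> s * sin be = sin psi ->
  [/\ a1 + 4 * psi <= a2, a2 + 4 * psi <= a3 & a3 + 4 * psi <= a1 + 2 * pi] -> 0 < eps ->
  fan O K (a1 - 2 * psi) (a1 - 2 * psi + 2 * pi)
    ((w - r) *: dir (a1 - 2 * psi)) ((w - r) *: dir (a1 - 2 * psi))
    (3 * (2 * w * (2 * psi - be) + 2 * (1 - s) * w * be) + (w - r) * (2 * pi - 12 * psi))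
    (3 * (w ^+ 2 * (2 * psi - be) - s * w * r * sin (2 * psi - be) + (1 - s) ^+ 2 * w ^+ 2 * be) +
      (w - r) ^+ 2 * (pi - 6 * psi) - 12 * eps).
Proof.
move=> cK sK KO w0 rw diam complete ball [K1 K2 K3] psi_itv rE s78 be_itv sbe [h12 h23 h31] e0.
have p0 := @pi_gt0 R.
have inner f : K (O + (w - r) *: dir f).
  apply: complete => x Kx; apply: le_trans (edist_triangle O _ _) _.
  rewrite edist_addl enormZ enorm_dir mulr1 ger0_norm; last by lra.
  by have := ball _ Kx; rewrite edistC; lra.
have wr0 : 0 < w - r by rewrite subr_gt0.
have [i1 i2 i3] : [/\ a1 - 2 * psi <= a1 + 2 * psi, a1 + 2 * psi <= a2 - 2 * psi &
  a2 - 2 * psi <= a2 + 2 * psi] by split; lra.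
have [i4 i5 i6] : [/\ a2 + 2 * psi <= a3 - 2 * psi, a3 - 2 * psi <= a3 + 2 * psi &
  a3 + 2 * psi <= a1 - 2 * psi + 2 * pi] by split; lra.
have [u1 u2 u3] : [/\ a2 - 2 * psi <= a1 + 2 * psi + 2 * pi, a3 - 2 * psi <= a2 + 2 * psi + 2 * pi &
  a1 - 2 * psi + 2 * pi <= a3 + 2 * psi + 2 * pi] by split; lra.
have i12 := le_trans i1 i2; have i13 := le_trans i12 i3.
have i14 := le_trans i13 i4; have i15 := le_trans i14 i5.
have v5 := i6; have v4 := le_trans i5 v5; have v3 := le_trans i4 v4; have v2 := le_trans i3 v3.
have C1 := fan_corner cK sK KO w0 diam complete ball K1 psi_itv rE s78 be_itv sbe e0.
have C2 := fan_corner cK sK KO w0 diam complete ball K2 psi_itv rE s78 be_itv sbe e0.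
have C3 := fan_corner cK sK KO w0 diam complete ball K3 psi_itv rE s78 be_itv sbe e0.
have D1 := fan_centered_arc cK sK KO wr0 i2 e0 u1 inner.
have D2 := fan_centered_arc cK sK KO wr0 i4 e0 u2 inner.
have D3 := fan_centered_arc cK sK KO wr0 i6 e0 u3 inner.
have F1 := fan_cat cK i1 i2 v2 C1 D1.
have F2 := fan_cat cK i12 i3 v3 F1 C2.
have F3 := fan_cat cK i13 i4 v4 F2 D2.
have F4 := fan_cat cK i14 i5 v5 F3 C3.
have := fan_cat cK i15 i6 (lexx _) F4 D3; rewrite dirDpi2.
by apply: fan_weaken; clear; lra.
Qed.

Lemma cheeger_constant_width b s t mu w K : 0 < b <= pi / 4 -> t = 1 - s -> mu = pi / 3 - b ->
  s * sin b = 1 / 2 -> 1 / 2 <= s ^+ 2 -> 0 < s <= (3 + Num.sqrt 3) / 6 ->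
  s ^+ 2 * mu - Num.sqrt 3 / 3 * s * sin mu = pi / 3 * t ^+ 2 -> 0 < w ->
  constant_width_body w K -> (cheeger K <= ((w * t)^-1)%:E)%E.
Proof.
move=> b_itv tE muE ssb s2 s_itv tile w0 wK; have p0 := @pi_gt0 R.
have t4 := t_le_quarter b_itv tE muE ssb s2 s_itv tile.
have [cK cvK _ _] := wK; have sK := convex_segment_closed cvK.
have qq := sqrt3_itv (@sqrt3_sqr R) (@sqrt3_gt0 R).
have s78 : 7 / 10 < s < 4 / 5.
  by have s3 := s_itv; apply/andP; split; [rewrite ltNge; apply/negP => h; nra|lra].
have t0 : 0 < t by lra.
have diam x y : K x -> K y -> edist x y <= w := constant_width_diam wK.
have complete p : (forall x, K x -> edist p x <= w) -> K p := constant_width_complete wK.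
have [ O [r [wr ball hu]]] := smallest_enclosing_disk wK.
have center : r <= w -> K O.
  move=> rw; apply: complete => x Kx; rewrite edistC; apply: le_trans rw; exact: ball.
(* If the circumradius is [w / 2], then [w - r = w / 2] and [K] contains the whole disk of that
   radius about [O]; otherwise contact points at a positive angle [psi] are available. *)
move: wr; rewrite le_eqVlt => /predU1P[wr|wr].
  have rw : r <= w by lra.
  apply: (@cheeger_disk w t O) => //; first exact: center.
  have e : w / 2 = w - r by lra.
  move=> f; apply: complete => x Kx; apply: le_trans (edist_triangle O _ _) _.
  rewrite edist_addl enormZ enorm_dir mulr1 ger0_norm; last by lra.
  by have := ball _ Kx; rewrite edistC; lra.
have [psi [a1 [a2 [a3 [psi_itv rE Ks hs]]]]] := contact_points cK w0 wr diam ball hu.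
have psi_itv' : 0 <= psi <= pi / 6 by lra.
have cpsi := cos_ge_sqrt3 psi_itv'.
have c0 : 0 < cos psi by lra.
have rw : r < w by nra.
have KO := center (ltW rw).
have scpsi : 1 <= 2 * s * cos psi by nra.
pose be := asin (sin psi / s).
have s71 : 7 / 10 < s < 1 by lra.
have [be1 be2 sbe] := asin_div_itv s71 scpsi psi_itv.
rewrite -/be in be1 be2 sbe.
have be_itv : psi <= be <= 2 * psi by rewrite be1.
have s1 : s < 1 by lra.
have ratio : pi / 3 * t ^+ 2 <= s ^+ 2 * (2 * psi - be) - s / (2 * cos psi) * sin (2 * psi - be) +
    (pi / 3 - 2 * psi) * (s - (2 * cos psi)^-1) ^+ 2.
  rewrite -(profileE s2 s_itv psi_itv' (erefl be)).
  exact: profile_ge b_itv muE ssb s2 s_itv tile _ psi_itv'.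
apply: (cheeger_le (mulr_gt0 w0 t0) (corner_length_gt0 w0 rw s1 be_itv psi_itv)
  (corner_ratio tE w0 c0 rE ratio)).
move=> eps eps0.
have e0 : 0 < eps / 12 by rewrite divr_gt0.
have F := fan_three_corners cK sK KO w0 rw diam complete ball Ks psi_itv rE s78 be_itv sbe hs e0.
have [E [mE EK EA EP]] := fan_close cK F.
have e12 : 12 * (eps / 12) = eps by field.
by exists E; split => //; rewrite e12 in EA.
Qed.

End UpperBound.

Theorem theorem1p1 (R : realType) (w : R) (Omega T : set (plane R))
    (w_gt0 : 0 < w)
    (HOmega : constant_width_body w Omega)
    (HT : reuleaux_triangle w T) :
  (cheeger Omega <= cheeger T)%E.
Proof.
have [b [s [t [mu [[b_itv tE muE] ssb s2 s_itv tile]]]]] := sharp_parameter R.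
apply: le_trans (cheeger_constant_width b_itv tE muE ssb s2 s_itv tile w_gt0 HOmega) _.
exact: cheeger_reuleaux w_gt0 b_itv tE muE ssb s2 s_itv tile HT.
Qed.
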